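(* Let $d,d_0\ge 1$ and $m\ge 0$ be integers. Let $\{\varepsilon_j\}_{j\in\mathbb{Z}}$ be i.i.d. centered Gaussian random vectors in $\mathbb{R}^{d_0}$ with identity covariance matrix, and let $\Psi_l=(\psi_{ij,l})_{i,j=1,\dots,d_0}\in\mathbb{R}^{d_0\times d_0}$, $l\ge 0$, be matrices such that $\Psi_0$ is nonsingular and $\psi_{ij,l}=o\big(l^{-1/2}(\log l)^{-1}\big)$ as $l\to\infty$ for all $i,j=1,\dots,d_0$. Let $X_k=\sum_{l=0}^\infty \Psi_l\varepsilon_{k-l}$, $k\in\mathbb{Z}$. Let $G_i:\mathbb{R}^{d_0\times(m+1)}\to\mathbb{R}$, $i=1,\dots,d$, be measurable and let $Y_k=(Y_{k,1},\dots,Y_{k,d})'$ with $Y_{k,i}=G_i(X_k,X_{k-1},\dots,X_{k-m})$, $k\in\mathbb{Z}$. Suppose that for each $\tau=(\tau_1,\dots,\tau_d)'\in(0,\infty)^d$ there is a sequence of thresholds $u_n(\tau)=(u_{n,1}(\tau_1),\dots,u_{n,d}(\tau_d))'\in\mathbb{R}^d$, $n\ge1$, such that (i) $\lim_{n\to\infty} n\,\mathbb{P}(Y_{0,i}>u_{n,i}(\tau_i))=\tau_i$ for $i=1,\dots,d$; (ii) $\lim_{n\to\infty} n\,\mathbb{P}(Y_0\nleq u_n(\tau))=-\log H(\tau)$ for some function $H$ on $(0,\infty)^d$ with $H(\tau)\in(0,1)$; (iii) for every $\ell=0,\dots,m$ the limit $\theta_\ell(\tau):=\lim_{n\to\infty}\mathbb{P}\big(Y_1\le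 u_n(\tau),\dots,Y_\ell\le u_n(\tau)\,\big|\,Y_0\nleq u_n(\tau)\big)$ exists. Let $M_n=(M_{n,1},\dots,M_{n,d})'$ with $M_{n,i}=\max_{1\le k\le n}Y_{k,i}$. Then for every $\tau\in(0,\infty)^d$, $$\lim_{n\to\infty}\mathbb{P}(M_n\le u_n(\tau))=H(\tau)^{\theta(\tau)},$$ with the same $H$ as in (ii) and with multivariate extremal index $\theta(\tau)=\theta_m(\tau)$.
   Context: Inequalities $\le$ between vectors are componentwise, and $x\nleq y$ means that at least one component of $x$ is strictly greater than the corresponding component of $y$. For $\ell=0$ the event $\{Y_1\le u_n,\dots,Y_\ell\le u_n\}$ is the whole space, so $\theta_0(\tau)=1$. Multivariate extremal index: for a stationary $\mathbb{R}^d$-valued sequence $\{Y_k\}$ and thresholds $u_n(\tau)$ with $n\mathbb{P}(Y_{0,i}>u_{n,i}(\tau_i))\to\tau_i$ for $i=1,\dots,d$, let $\widehat M_n$ be the vector of componentwise maxima of $n$ i.i.d. copies of $Y_0$. The multivariate extremal index $\theta(\tau)\in[0,1]$ is defined by the limit relations $\mathbb{P}(\widehat M_n\le u_n(\tau))\to H(\tau)\in(0,1)$ and $\mathbb{P}(M_n\le u_n(\tau))\to H(\tau)^{\theta(\tau)}$. (Given (i), condition (ii) is equivalent to $\mathbb{P}(\widehat M_n\le u_n(\tau))\to H(\tau)$.) *)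

(* Defs.v *)
From HB Require Import structures.
From mathcomp Require Export all_boot all_order all_algebra.
From mathcomp Require Export all_classical all_reals all_analysis.
Export Order.TTheory GRing.Theory Num.Theory.
Export numFieldNormedType.Exports.

Set Implicit Arguments.
Unset Strict Implicit.
Unset Printing Implicit Defensive.

Local Open Scope classical_set_scope.
Local Open Scope ring_scope.

(* Vectors of [R^n] are [n.-tuple R]: tuples carry the product sigma-algebra,
   which for [R^n] is the Borel one. *)
Section vectors.
Context {R : realType} {n : nat}.
Implicit Types x y : n.-tuple R.

Definition vle x y : Prop := forall i : 'I_n, tnth x i <= tnth y i.

Definition vnle x y : Prop := exists i : 'I_n, tnth y i < tnth x i.

Definition vpos x : Prop := forall i : 'I_n, 0 < tnth x i.

(* The [i]-th threshold depends on [tau] only through its [i]-th component. *)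
Definition thresholds (u : nat -> 'I_n -> R -> R) (k : nat) (tau : n.-tuple R)
    : n.-tuple R :=
  [tuple u k i (tnth tau i) | i < n].

End vectors.

Section probability.
Context {d : measure_display} {T : measurableType d} {R : realType}
  (P : probability T R).

Definition prob (A : set T) : R := fine (P A).

Definition cond_prob (A B : set T) : R := prob (A `&` B) / prob B.

Definition mutually_independent {I : choiceType} {d' : measure_display}
    {T' : measurableType d'} (X : I -> T -> T') : Prop :=
  forall (s : seq I) (A : I -> set T'), uniq s ->
    (forall i, measurable (A i)) ->
    prob [set w | forall i, i \in s -> A i (X i w)] =
    \prod_(i <- s) prob (X i @^-1` A i).

(* [normal_prob mu 0] is not the Dirac mass at [mu] but the uniform law on
   [0, 1], hence the case split. *)
Definition gaussian_law (mu sigma : R) : set R -> \bar R :=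
  if sigma == 0 then \d_mu else normal_prob mu sigma.

Definition gaussian_vector {n : nat} (X : T -> n.-tuple R) : Prop :=
  forall a : 'I_n -> R, exists mu sigma : R,
    forall A : set R, measurable A ->
      P [set w | A (\sum_(i < n) a i * tnth (X w) i)] = gaussian_law mu sigma A.

Definition centered {n : nat} (X : T -> n.-tuple R) : Prop :=
  forall i : 'I_n, ('E_P[fun w => tnth (X w) i] = 0)%E.

Definition identity_covariance {n : nat} (X : T -> n.-tuple R) : Prop :=
  forall i j : 'I_n,
    covariance P (fun w => tnth (X w) i) (fun w => tnth (X w) j)
    = ((i == j)%:R)%:E.

Definition stationary {d' : measure_display} {T' : measurableType d'}
    (Y : int -> T -> T') : Prop :=
  forall (n : nat) (h : int) (A : set (n.-tuple T')), measurable A ->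
    P [set w | A [tuple Y (k%:Z + h) w | k < n]] =
    P [set w | A [tuple Y k%:Z w | k < n]].

End probability.

Definition same_law {R : realType} {d1 d2 d' : measure_display}
    {T1 : measurableType d1} {T2 : measurableType d2} {T' : measurableType d'}
    (P1 : probability T1 R) (P2 : probability T2 R)
    (X1 : T1 -> T') (X2 : T2 -> T') : Prop :=
  forall A : set T', measurable A -> P1 (X1 @^-1` A) = P2 (X2 @^-1` A).

Section processes.
Context {d : measure_display} {T : measurableType d} {R : realType}
  (P : probability T R).

(* The series defining a linear process converges almost surely. *)
Definition linear_process {n : nat} (Psi : nat -> 'M[R]_n)
    (eps : int -> T -> n.-tuple R) (X : int -> T -> n.-tuple R) : Prop :=
  forall k : int, {ae P, forall w, forall i : 'I_n,
    (\sum_(0 <= l < N) \sum_(j < n) Psi l i j * tnth (eps (k - l%:Z) w) j)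
      @[N --> \oo] --> tnth (X k w) i}.

Definition transformed_process {n m p : nat}
    (G : 'I_p -> m.+1.-tuple (n.-tuple R) -> R)
    (X : int -> T -> n.-tuple R) : int -> T -> p.-tuple R :=
  fun k w => [tuple G i [tuple X (k - j%:Z) w | j < m.+1] | i < p].

(* Componentwise maximum of [Y 1], ..., [Y n]; the value at [n = 0] is junk. *)
Definition running_max {p : nat} (Y : nat -> T -> p.-tuple R) (n : nat) (w : T)
    : p.-tuple R :=
  [tuple \big[Num.max/tnth (Y 1%N w) i]_(1 <= k < n.+1) tnth (Y k w) i
  | i < p].

End processes.

(* [theta] is the multivariate extremal index of [Y] for the thresholds [u].
   The law of the maximum of i.i.d. copies of [Y 0] does not depend on the
   probability space carrying the copies, so we quantify over all of them. *)
Record extremal_index {d : measure_display} {T : measurableType d}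
    {R : realType} (P : probability T R) {p : nat}
    (Y : int -> T -> p.-tuple R) (u : nat -> 'I_p -> R -> R)
    (H theta : p.-tuple R -> R) : Prop := ExtremalIndex {
  ei_stationary : stationary P Y ;
  ei_thresholds : forall (tau : p.-tuple R), vpos tau -> forall i : 'I_p,
    n%:R * prob P [set w | u n i (tnth tau i) < tnth (Y 0 w) i]
      @[n --> \oo] --> tnth tau i ;
  ei_range : forall tau : p.-tuple R, vpos tau -> 0 <= theta tau <= 1 ;
  ei_H_range : forall tau : p.-tuple R, vpos tau -> 0 < H tau < 1 ;
  ei_iid_max : forall (d' : measure_display) (T' : measurableType d')
      (Q : probability T' R) (Z : nat -> {RV Q >-> p.-tuple R}),
    mutually_independent Q (fun k => Z k : T' -> p.-tuple R) ->
    (forall k, same_law Q P (Z k) (Y 0)) ->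
    forall tau : p.-tuple R, vpos tau ->
      prob Q [set w | vle (running_max (fun k => Z k) n w) (thresholds u n tau)]
        @[n --> \oo] --> H tau ;
  ei_max : forall tau : p.-tuple R, vpos tau ->
    prob P [set w | vle (running_max (fun k => Y k%:Z) n w) (thresholds u n tau)]
      @[n --> \oo] --> H tau `^ theta tau
}.

(* Main.v *)
Require Import Defs.
From mathcomp Require Import measurable_realfun lebesgue_integral_fubini zify ring lra.

(* Transport everything to the space of real sequences indexed by (time,
   coordinate) with its i.i.d. standard Gaussian measure. Since [Psi 0] is
   invertible, [Psi] has a power series inverse, so that the path of X over a
   window is a function of the innovations in the window displaced by a linear
   functional [h] of the older ones, and by Cameron-Martin events of the window
   are described by an explicit density in [h].
   - Mixing: conditioning on innovations older by a gap [L] only sees a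
     displacement of variance o(1 / log L), while up to probability n^-4 the
     window has norm O(sqrt (log n)); the density is therefore 1 + o(1) when [L]
     is a power of [n]. This is what the decay of [Psi] is for.
   - Anticlustering: two exceedances whose windows do not overlap have joint
     probability O(n^-(1 + eta)): the density in [h] is at most a small power of
     n unless [h] is of order sqrt (log n), which costs a power of n by itself.
   - Counting the ends of clusters in blocks of length L^2, the probability of no
     exceedance up to time n is exp (- lim n P(D)) with D the event of exceeding
     at time 0 and at none of the times 1, ..., m; n P(D) tends to
     - theta_m log H.
   The innovations have independent standard coordinates by Cramer-Wold, with
   products of trigonometric polynomials approximating indicators of boxes; as
   the variance of [normal_prob 0 1] is not at hand, they are rescaled by an
   unspecified constant, absorbed in [Psi]. *)

Set Implicit Arguments.
Unset Strict Implicit.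
Unset Printing Implicit Defensive.

Local Open Scope classical_set_scope.
Local Open Scope ring_scope.

(** * One-dimensional Gaussian measures *)

(** The functions [G i] are merely measurable, so comparing covariances or using smoothness of the
    observables is impossible: each estimate must hold for an arbitrary event of a window, hence the
    passage to densities. Moreover an exceedance has probability of order 1/n and about n times are
    examined, so only errors of smaller order than 1/n are tolerable. This dictates relative bounds:
    mixing takes the form [e * (p + n^-1)], and anticlustering has to gain a power [eta] over the
    product of two exponentials of size 1/n. For mixing, a lower bound on the density is obtained
    from [1 + x <= expR x] and an upper one from exponential moments; together they bound the
    covariance from one side for every conditioning event, and the complementary event gives the
    other side. In the block argument the gap [L] must satisfy two opposite demands: [ln n / ln L]
    has to stay bounded for mixing, while [L ^ 3] must stay below n and below n to the power [eta],
    so that gaps, double counting and the incomplete last block all contribute order 1/L. *)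

Section density.
Local Open Scope ereal_scope.
Context d (T : measurableType d) (R : realType).
Variables (m nu : {measure set T -> \bar R}) (p : T -> R).
Hypothesis mp : measurable_fun setT p.
Hypothesis p0 : forall x, (0 <= p x)%R.
Hypothesis nuE : forall A, measurable A -> nu A = \int[m]_(x in A) (p x)%:E.

Import HBNNSimple.

Let density_nnsfun (f : {nnsfun T >-> R}) :
  \int[nu]_x (f x)%:E = \int[m]_x ((f x)%:E * (p x)%:E).
Proof.
under eq_integral do rewrite fimfunE -fsumEFin//.
rewrite ge0_integral_fsum//; last 2 first.
- by move=> y; exact/measurable_EFinP/measurable_funM.
- by move=> y x _; rewrite nnfun_muleindic_ge0.
under [RHS]eq_integral.
  move=> x _; rewrite fimfunE -fsumEFin// ge0_mule_fsuml; last first.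
    by move=> i; exact: nnfun_muleindic_ge0.
  over.
rewrite ge0_integral_fsum//; last 2 first.
- move=> y; apply: emeasurable_funM => //; apply/measurable_EFinP => //; exact: measurable_funM.
- move=> y x _; rewrite mule_ge0 ?lee_fin//; exact: nnfun_muleindic_ge0.
apply: eq_fsbigr => r rf.
rewrite integralZl_indic_nnsfun// integral_indic// setIT nuE//.
have [k kf] : range f r by rewrite inE in rf.
case=> fkr; have r0 : (0 <= r)%R by rewrite -fkr.
under [RHS]eq_integral do rewrite EFinM -muleA.
rewrite ge0_integralZl//; first last.
- by move=> x _; rewrite mule_ge0// lee_fin.
- by apply: emeasurable_funM => //; exact/measurable_EFinP.
congr *%E; rewrite integral_mkcond; apply: eq_integral => x _.
by rewrite patchE/= indicE; case: ifPn => _; rewrite ?mul1e ?mul0e.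
Qed.

Lemma ge0_integral_density (f : T -> \bar R) :
  measurable_fun setT f -> (forall x, 0 <= f x) ->
  \int[nu]_x f x = \int[m]_x (f x * (p x)%:E).
Proof.
move=> mf f0; pose f_ := nnsfun_approx measurableT mf.
transitivity (lim (\int[nu]_x (f_ n x)%:E @[n --> \oo])).
  rewrite -monotone_convergence//=.
  - apply: eq_integral => ? /[!inE] xD; apply/esym/cvg_lim => //=.
    exact: cvg_nnsfun_approx.
  - by move=> n; exact/measurable_EFinP/measurable_funTS.
  - by move=> n ? _; rewrite lee_fin.
  - by move=> ? _ ? ? mn; rewrite lee_fin; exact/lefP/nd_nnsfun_approx.
rewrite [RHS](_ : _ = lim (\int[m]_x ((f_ n x)%:E * (p x)%:E) @[n --> \oo])).
  by apply: congr_lim; apply/funext => n; exact: density_nnsfun.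
rewrite -monotone_convergence//=.
- apply: eq_integral => x _; apply/esym/cvg_lim => //=.
  apply: cvgeZr => //; exact: cvg_nnsfun_approx.
- by move=> n; apply: emeasurable_funM => //; exact/measurable_EFinP.
- by move=> n x _; rewrite mule_ge0// lee_fin.
- move=> x _ a b ab; apply: lee_wpmul2r; rewrite lee_fin//.
  exact/lefP/nd_nnsfun_approx.
Qed.

End density.

Section gauss1.
Local Open Scope ereal_scope.
Context {R : realType}.
Local Notation leb := (@lebesgue_measure R).
Implicit Types (f : R -> \bar R) (c h : R).

(** Uniqueness of Lebesgue measure: [c] times the image of Lebesgue measure under [x |-> c * x + h]
    gives every half-open interval its length. *)
Lemma lebesgue_affine f c h : (0 < c)%R -> measurable_fun setT f ->
  (forall x, 0 <= f x) ->
  \int[leb]_x f x = c%:E * \int[leb]_x f (c * x + h)%R.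
Proof.
move=> c0 mf f0.
pose phi := fun x : R => (c * x + h)%R.
have mphi : measurable_fun setT (phi : R -> measurableTypeR R).
  by apply: measurable_funD => //; exact: mulrl_measurable.
rewrite (_ : (fun x : R => f (c * x + h)%R) = f \o phi)//.
have -> : \int[leb]_x (f \o phi) x = \int[pushforward leb (phi : R -> measurableTypeR R)]_x f x.
  by rewrite ge0_integral_pushforward// preimage_setT.
pose c' := NngNum (ltW c0).
rewrite -[c]/(c'%:num) -ge0_integral_mscale//.
apply: eq_measure_integral => A mA _.
apply: lebesgue_measure_unique => // _ [[a b] _ <-].
rewrite [RHS](_ : _ = c%:E * leb (phi @^-1` `]a, b]%classic))//.
have -> : phi @^-1` `]a, b]%classic = `]((a - h) / c)%R, ((b - h) / c)%R]%classic.
  apply/seteqP; split => x; rewrite /phi /= !in_itv/= => /andP[x1 x2].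
    by rewrite ltr_pdivrMr// ler_pdivlMr//; apply/andP; split; lra.
  by move: x1 x2; rewrite ltr_pdivrMr// ler_pdivlMr// => x1 x2; apply/andP; split; lra.
rewrite !lebesgue_measure_itv/= !lte_fin ltr_pM2r ?invr_gt0// ltrBlDr subrK.
case: ifPn => ab; last by rewrite mule0.
rewrite -!EFinB -EFinM; congr EFin; field; exact: lt0r_neq0.
Qed.

Lemma integral_normal_prob (m s : R) f : measurable_fun setT f ->
  (forall x, 0 <= f x) ->
  \int[normal_prob m s]_x f x = \int[leb]_x (f x * (normal_pdf m s x)%:E).
Proof.
move=> mf f0.
apply: (@ge0_integral_density _ (measurableTypeR R) R leb
   (@normal_prob R m s : {measure set _ -> \bar R})
  (normal_pdf m s)) => //.
- exact: measurable_normal_pdf.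
- exact: normal_pdf_ge0.
Qed.

(* Junk value: [normal_pdf 0 0] is uniform, hence [s != 0]. *)
Lemma integral_normal_probE (m s : R) f : s != 0%R -> measurable_fun setT f ->
  (forall x, 0 <= f x) ->
  \int[normal_prob m s]_x f x =
  \int[normal_prob 0 1]_x f (`|s| * x + m)%R.
Proof.
move=> s0 mf f0.
have s1 : (0 < `|s|)%R by rewrite normr_gt0.
have mg : measurable_fun setT (fun x : R => f (`|s| * x + m)%R).
  by apply: measurableT_comp => //; apply: measurable_funD => //; exact: mulrl_measurable.
have g0 (x : R) : 0 <= f (`|s| * x + m)%R by exact: f0.
apply: etrans (integral_normal_prob m s mf f0) _.
apply: etrans (esym (integral_normal_prob 0 1 mg g0)).
have mfp : measurable_fun setT (fun x : R => f x * (normal_pdf m s x)%:E).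
  by apply: emeasurable_funM => //; apply/measurable_EFinP; exact: measurable_normal_pdf.
have fp0 (x : R) : 0 <= f x * (normal_pdf m s x)%:E.
  by rewrite mule_ge0// lee_fin normal_pdf_ge0.
apply: etrans (lebesgue_affine m s1 mfp fp0) _.
have mh : measurable_fun setT (fun x : R =>
    f (`|s| * x + m)%R * (normal_pdf m s (`|s| * x + m))%:E).
  apply: emeasurable_funM => //.
  apply/measurable_EFinP; apply: (measurableT_comp (measurable_normal_pdf m s)).
  by apply: measurable_funD => //; exact: mulrl_measurable.
have h0 (x : R) : 0 <= f (`|s| * x + m)%R * (normal_pdf m s (`|s| * x + m))%:E.
  by rewrite mule_ge0// lee_fin normal_pdf_ge0.
rewrite -ge0_integralZl//.
apply: eq_integral => x _; rewrite muleCA -EFinM; congr (_ * _%:E).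
rewrite !normal_pdfE ?oner_eq0// /normal_peak /normal_fun addrK subr0.
rewrite mulrA; congr (_ * _)%R.
  rewrite expr1n mul1r -mulrnAr sqrtrM ?sqr_ge0// sqrtr_sqr invfM mulrA.
  by rewrite divff ?mul1r// gt_eqF.
congr expR; rewrite exprMn real_normK ?num_real// expr1n.
by field.
Qed.

(** The exponential is the ratio of the standard normal densities at [c * x + h] and at [x]. Shifts
    and dilations are the cases [c = 1] and [h = 0]. *)
Lemma gauss_affine f c h : (0 < c)%R -> measurable_fun setT f ->
  (forall x, 0 <= f x) ->
  \int[normal_prob 0 1]_x f x = c%:E * \int[normal_prob 0 1]_x
   (f (c * x + h)%R * (expR (x ^+ 2 / 2 - (c * x + h) ^+ 2 / 2))%:E).
Proof.
move=> c0 mf f0.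
have ma : measurable_fun setT (fun x : R => c * x + h)%R.
  by apply: measurable_funD => //; exact: mulrl_measurable.
have mg : measurable_fun setT (fun x : R =>
    f (c * x + h)%R * (expR (x ^+ 2 / 2 - (c * x + h) ^+ 2 / 2))%:E).
  apply: emeasurable_funM; first exact: measurableT_comp.
  apply/measurable_EFinP; apply: measurableT_comp => //.
  by apply: measurable_funB; apply: measurable_funM => //; exact: measurable_funX.
have g0 (x : R) : 0 <= f (c * x + h)%R * (expR (x ^+ 2 / 2 - (c * x + h) ^+ 2 / 2))%:E.
  by rewrite mule_ge0// lee_fin expR_ge0.
apply: etrans (integral_normal_prob 0 1 mf f0) _.
have mfp : measurable_fun setT (fun x : R => f x * (normal_pdf 0 1 x)%:E).
  by apply: emeasurable_funM => //; apply/measurable_EFinP; exact: measurable_normal_pdf.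
have fp0 (x : R) : 0 <= f x * (normal_pdf 0 1 x)%:E.
  by rewrite mule_ge0// lee_fin normal_pdf_ge0.
apply: etrans (lebesgue_affine h c0 mfp fp0) _.
rewrite (integral_normal_prob 0 1 mg g0).
congr (_ * _); apply: eq_integral => x _; rewrite -muleA -EFinM; congr (_ * _%:E).
rewrite !normal_pdfE ?oner_eq0// /normal_peak /normal_fun.
rewrite mulrCA; congr (_ * _)%R.
by rewrite -expRD; congr expR; rewrite expr1n; field.
Qed.

(** One-dimensional Cameron-Martin formula, from the change of variable by [- h] applied to the
    already shifted function. *)
Lemma gauss_shift f h : measurable_fun setT f -> (forall x, 0 <= f x) ->
  \int[normal_prob 0 1]_x f (x + h)%R =
  \int[normal_prob 0 1]_x (f x * (expR (h * x - h ^+ 2 / 2))%:E).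
Proof.
move=> mf f0.
rewrite (@gauss_affine (fun x => f (x + h)%R) 1 (- h))//; last first.
  by apply: measurableT_comp => //; exact: measurable_funD.
rewrite mul1e; apply: eq_integral => x _; rewrite mul1r subrK.
by congr (_ * (expR _)%:E); field.
Qed.

Lemma gauss_scale f c : (0 < c)%R -> measurable_fun setT f ->
  (forall x, 0 <= f x) ->
  \int[normal_prob 0 1]_x f x = c%:E * \int[normal_prob 0 1]_x
    (f (c * x)%R * (expR ((1 - c ^+ 2) / 2 * x ^+ 2))%:E).
Proof.
move=> c0 mf f0; rewrite (gauss_affine 0 c0 mf f0); apply: congr1.
apply: eq_integral => x _; rewrite addr0.
by congr (_ * (expR _)%:E); field.
Qed.

End gauss1.
(** * Independent standard Gaussian sequences *)

Section sequence_space.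
Context (R : realType) (I : choiceType).

Definition cylinder (l : seq I) (A : I -> set R) : set (I -> R) :=
  [set s | forall i, i \in l -> A i (s i)].

Definition cylinders : set (set (I -> R)) :=
  [set E | exists l A, (forall i, measurable (A i)) /\ E = cylinder l A].

Definition seqspace : measurableType (sigma_display cylinders) :=
  g_sigma_algebraType cylinders.

Lemma measurable_cylinder l A : (forall i, measurable (A i)) ->
  measurable (cylinder l A : set seqspace).
Proof. by move=> mA; apply: sub_sigma_algebra; exists l, A. Qed.

Lemma measurable_coord i : measurable_fun setT (fun s : seqspace => s i).
Proof.
move=> _ B mB; rewrite setTI.
rewrite (_ : _ @^-1` _ = cylinder [:: i] (fun=> B)); first exact: measurable_cylinder.
apply/seteqP; split => s /=; first by move=> Bs j; rewrite inE => /eqP ->.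
by apply; rewrite inE.
Qed.

(** The index lists are concatenated; each family constrains the indices of its own list and is
    replaced by [setT] elsewhere. *)
Lemma cylindersI : setI_closed cylinders.
Proof.
move=> _ _ [l [A [mA ->]]] [l' [A' [mA' ->]]].
exists (l ++ l'), (fun i => (if i \in l then A i else setT) `&`
  (if i \in l' then A' i else setT)); split.
  by move=> i; apply: measurableI; case: ifP.
apply/seteqP; split => s /=.
  by move=> [sA sA'] i _; split; case: ifPn => // il; [exact: sA|exact: sA'].
move=> h; split=> i il.
  by have := h i; rewrite mem_cat il /= => /(_ isT)[].
by have := h i; rewrite mem_cat il orbT /= => /(_ isT)[].
Qed.

Lemma measurable_seqspace d (T : measurableType d) (f : T -> seqspace) :
  (forall i, measurable_fun setT (fun t => f t i)) -> measurable_fun setT f.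
Proof.
move=> mf; apply: (@measurability _ _ _ _ setT f cylinders) => //.
move=> _ [E [l [A [mA ->]]] <-].
rewrite setTI; elim: l => [|j l IH].
  by rewrite (_ : _ @^-1` _ = setT)//; apply/seteqP; split.
rewrite (_ : _ @^-1` _ = (fun t => f t j) @^-1` (A j) `&` f @^-1` cylinder l A).
  by apply: measurableI => //; rewrite -[X in measurable X]setTI; exact: mf.
apply/seteqP; split => t /=.
  move=> h; split; first by apply: h; rewrite mem_head.
  by move=> i il; apply: h; rewrite inE il orbT.
by move=> [h1 h2] i; rewrite inE => /predU1P[->//|]; exact: h2.
Qed.

(** Cylinders form a pi-system, and removing repetitions from the list does not change a cylinder,
    so duplicate-free lists suffice. *)
Lemma seqspace_measure_unique (m1 m2 : {measure set seqspace -> \bar R}) :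
  (m1 setT < +oo)%E ->
  (forall l A, uniq l -> (forall i, measurable (A i)) ->
    m1 (cylinder l A) = m2 (cylinder l A)) ->
  forall E, measurable E -> m1 E = m2 E.
Proof.
move=> m1T m12 E mE.
apply: (@measure_unique _ R seqspace cylinders (fun=> setT)) => //.
- exact: cylindersI.
- by move=> _; exists [::], (fun=> setT); split => //; apply/seteqP; split.
- by apply/seteqP; split => // x _; exists 0%N.
- move=> _ [l [A [mA ->]]].
  have -> : cylinder l A = cylinder (undup l) A.
    by apply/seteqP; split => s /= h i; have := h i; rewrite mem_undup.
  by apply: m12 => //; exact: undup_uniq.
Qed.

Definition glue (J : pred I) (a b : seqspace) : seqspace :=
  fun i => if J i then a i else b i.

Lemma measurable_glue J :
  measurable_fun setT (fun p : seqspace * seqspace => glue J p.1 p.2).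
Proof.
apply: measurable_seqspace => i; rewrite /glue; case: (J i).
  exact: (measurableT_comp (measurable_coord i) measurable_fst).
exact: (measurableT_comp (measurable_coord i) measurable_snd).
Qed.

(** Stands for measurability with respect to the coordinates in [J]. Being a pointwise condition, it
    is checked by unfolding, without sub-sigma-algebras. *)
Definition dep (U : Type) (J : pred I) (f : seqspace -> U) :=
  forall s s', (forall i, J i -> s i = s' i) -> f s = f s'.

Lemma dep_indic (J : pred I) (A : set seqspace) :
  dep J A -> dep J (fun s => (\1_A s)%:E : \bar R).
Proof.
move=> dA s s' h; rewrite !indicE; congr ((nat_of_bool _)%:R%:E).
by apply/idP/idP; rewrite !inE (dA _ _ h).
Qed.

(** A property of a given measure instead of a construction of the infinite product: it will be
    verified for the image of [P] under the rescaled innovations. *)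
Definition iid_gauss (mu : set seqspace -> \bar R) :=
  forall l A, uniq l -> (forall i, measurable (A i)) ->
    mu (cylinder l A) = (\prod_(i <- l) fine (normal_prob 0 1 (A i)))%:E.

End sequence_space.
Arguments measurable_coord {R I} i.

Section iid.
Local Open Scope ereal_scope.
Context (R : realType) (I : choiceType).
Local Notation S := (seqspace R I).
Variable (mu : probability S R).
Hypothesis muP : iid_gauss mu.
Local Notation gamma := (@normal_prob R 0 1).

(** Independence of the coordinates in [J] from the others, expressed as invariance of the law when
    the two groups are taken from two independent copies. On cylinders this splits the product over
    [l]. *)
Lemma glue_law (J : pred I) E : measurable E ->
  (mu \x mu) ((fun p => glue J p.1 p.2) @^-1` E) = mu E.
Proof.
pose f : S * S -> S := fun p => glue J p.1 p.2.
have mf : measurable_fun setT f := measurable_glue J.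
move=> mE.
suff : forall E, measurable E -> pushforward (mu \x mu) f E = mu E by apply.
apply: seqspace_measure_unique => //=.
  by rewrite /pushforward/= preimage_setT probability_setT ltry.
move=> l A ul mA; rewrite /pushforward/=.
have -> : f @^-1` cylinder l A =
    cylinder (seq.filter J l) A `*` cylinder (seq.filter (predC J) l) A.
  apply/seteqP; split => -[a b] /=; rewrite /f /glue /cylinder/=.
    move=> h; split => i; rewrite mem_filter => /andP[/= Ji il].
      by have := h i il; rewrite Ji.
    by have := h i il; rewrite (negbTE Ji).
  move=> [h1 h2] i il; case: ifPn => Ji.
    by apply: h1; rewrite mem_filter Ji.
  by apply: h2; rewrite mem_filter /= Ji.
rewrite product_measure1E//; [|exact: measurable_cylinder..].
rewrite [in RHS]muP// [X in X * _ = _]muP ?filter_uniq// [X in _ * X = _]muP ?filter_uniq//.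
rewrite -EFinM !big_filter.
by rewrite [in RHS](bigID J).
Qed.

Lemma integral_glue (J : pred I) (f : S -> \bar R) :
  measurable_fun setT f -> (forall s, 0 <= f s) ->
  \int[mu]_s f s = \int[mu]_b \int[mu]_a f (glue J a b).
Proof.
move=> mf f0.
have mg := @measurable_glue R I J.
rewrite -(fubini_tonelli2 (fun p => f (glue J p.1 p.2)))//; last first.
  exact: measurableT_comp.
have -> : \int[mu \x mu]_z f (glue J z.1 z.2) =
  \int[pushforward (mu \x mu) (fun p => glue J p.1 p.2)]_z f z.
  by rewrite ge0_integral_pushforward// preimage_setT.
by apply: eq_measure_integral => A mA _; exact/esym/(glue_law J mA).
Qed.

Lemma integral_glue2 (J : pred I) (f : S -> \bar R) :
  measurable_fun setT f -> (forall s, 0 <= f s) ->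
  \int[mu]_s f s = \int[mu]_a \int[mu]_b f (glue J a b).
Proof.
move=> mf f0; rewrite (integral_glue J)//.
rewrite -(fubini_tonelli (fun p => f (glue J p.1 p.2)))//.
apply: measurableT_comp => //; exact: measurable_glue.
Qed.

Lemma integral_dep (J : pred I) (f g : S -> \bar R) :
  measurable_fun setT f -> measurable_fun setT g ->
  (forall s, 0 <= f s) -> (forall s, 0 <= g s) ->
  dep J f -> dep (predC J) g ->
  \int[mu]_s (f s * g s) = \int[mu]_s f s * \int[mu]_s g s.
Proof.
move=> mf mg f0 g0 df dg; rewrite (integral_glue2 J)//; last 2 first.
- exact: emeasurable_funM.
- by move=> s; rewrite mule_ge0.
transitivity (\int[mu]_a (f a * \int[mu]_b g b)).
  apply: eq_integral => a _; rewrite -ge0_integralZl//.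
  apply: eq_integral => b _; congr (_ * _).
    by apply: df => i Ji; rewrite /glue Ji.
  by apply: dg => i /=/negbTE Ji; rewrite /glue Ji.
by rewrite ge0_integralZr// integral_ge0.
Qed.

Lemma measure_dep (J : pred I) (A B : set S) :
  measurable A -> measurable B -> dep J A -> dep (predC J) B ->
  mu (A `&` B) = mu A * mu B.
Proof.
move=> mA mB dA dB.
have muE C : measurable C -> mu C = \int[mu]_s (\1_C s)%:E.
  by move=> mC; rewrite integral_indic// setIT.
rewrite !muE//; last exact: measurableI.
rewrite -(integral_dep (J := J))//; first last.
- exact: dep_indic.
- exact: dep_indic.
- exact/measurable_EFinP/measurable_indic.
- exact/measurable_EFinP/measurable_indic.
by apply: eq_integral => s _; rewrite indicI.
Qed.

Lemma coord_law i (A : set R) : measurable A ->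
  mu [set s | A (s i)] = gamma A.
Proof.
move=> mA; rewrite (_ : [set s | _] = cylinder [:: i] (fun=> A)); last first.
  apply/seteqP; split => s /=; first by move=> h j; rewrite inE => /eqP ->.
  by apply; rewrite mem_head.
by rewrite muP// big_seq1 fineK// fin_num_measure.
Qed.

Definition upd (c : I) (x : R) (s : S) : S := fun i => if i == c then x else s i.

Lemma measurable_upd c (s : S) : measurable_fun setT (fun x : R => upd c x s).
Proof. by apply: measurable_seqspace => i; rewrite /upd; case: eqP. Qed.

Lemma integral_upd c (f : S -> \bar R) :
  measurable_fun setT f -> (forall s, 0 <= f s) ->
  \int[mu]_s f s = \int[mu]_s \int[gamma]_x f (upd c x s).
Proof.
move=> mf f0; rewrite (integral_glue (pred1 c))//; apply: eq_integral => b _.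
have mfu : measurable_fun setT (fun x : R => f (upd c x b)).
  apply: measurableT_comp => //.
  exact: measurable_upd.
transitivity (\int[pushforward mu (fun s : S => s c : measurableTypeR R)]_x f (upd c x b)).
  rewrite ge0_integral_pushforward//; last exact: measurable_coord.
  apply: eq_integral => a _ /=; congr f; apply/funext => i.
  by rewrite /glue /upd /=; case: eqP => // ->.
apply: eq_measure_integral; first exact: measurable_coord.
move=> mc A mA _; exact: coord_law.
Qed.

End iid.

(** * The Cameron-Martin formula and dilations of finitely many coordinates *)

Section cameron_martin.
Context (R : realType) (I : choiceType).
Local Notation S := (seqspace R I).
Variable (mu : probability S R).
Hypothesis muP : iid_gauss mu.
Implicit Types (W : seq I) (h : I -> S -> R) (f : S -> \bar R).

Definition shift W h (s : S) : S := fun i => if i \in W then s i + h i s else s i.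

Definition dilate W (c : R) (s : S) : S :=
  fun i => if i \in W then c * s i else s i.

Definition sumsq W (s : S) : R := \sum_(i <- W) s i ^+ 2.

Definition log_density W h (s : S) : R :=
  \sum_(i <- W) (h i s * s i - h i s ^+ 2 / 2).

Lemma sumsq_ge0 W s : 0 <= sumsq W s.
Proof. by apply: sumr_ge0 => i _; exact: sqr_ge0. Qed.

Lemma measurable_shift W h : (forall i, measurable_fun setT (h i)) ->
  measurable_fun setT (shift W h).
Proof.
move=> mh; apply: measurable_seqspace => i; rewrite /shift.
case: (i \in W); last exact: measurable_coord.
by apply: measurable_funD => //; exact: measurable_coord.
Qed.

Lemma measurable_sumsq W : measurable_fun setT (sumsq W).
Proof.
by apply: measurable_sum => i; apply: measurable_funX; exact: measurable_coord.
Qed.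

Lemma measurable_log_density W h : (forall i, measurable_fun setT (h i)) ->
  measurable_fun setT (log_density W h).
Proof.
move=> mh; apply: measurable_sum => i; apply: measurable_funB.
  by apply: measurable_funM => //; exact: measurable_coord.
by apply: measurable_funM => //; exact: measurable_funX.
Qed.

Local Open Scope ereal_scope.

Lemma integral_shift1 c (h : S -> R) f :
  measurable_fun setT h -> dep (predC1 c) h ->
  measurable_fun setT f -> (forall s, 0 <= f s) ->
  \int[mu]_s f (upd c (s c + h s)%R s) =
  \int[mu]_s (f s * (expR (h s * s c - h s ^+ 2 / 2))%:E).
Proof.
move=> mh dh mf f0.
have mc := @measurable_coord R I.
rewrite (integral_upd muP c)//; last first.
  apply: measurableT_comp => //; apply: measurable_seqspace => i; rewrite /upd.
  by case: eqP => _; [exact: measurable_funD|exact: mc].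
rewrite [RHS](integral_upd muP c); first last.
- by move=> s; rewrite mule_ge0// lee_fin expR_ge0.
- apply: emeasurable_funM => //; apply/measurable_EFinP/measurableT_comp => //.
  apply: measurable_funB; first exact: measurable_funM.
  by apply: measurable_funM => //; exact: measurable_funX.
apply: eq_integral => s _.
have hu x : h (upd c x s) = h s.
  by apply: dh => i /= /negbTE ic; rewrite /upd ic.
transitivity (\int[normal_prob 0 1]_x f (upd c (x + h s)%R s)).
  apply: eq_integral => x _; congr f; apply/funext => i.
  by rewrite hu /upd eqxx; case: eqP.
have mfu : measurable_fun setT (fun x : R => f (upd c x s)).
  by apply: measurableT_comp => //; exact: measurable_upd.
apply: etrans (gauss_shift (h s) mfu (fun=> f0 _)) _.
by apply: eq_integral => x _; rewrite hu [upd c x s c]/upd eqxx.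
Qed.

(** Coordinates are displaced one at a time. No [h i] looks at a coordinate in [W], so successive
    displacements do not interfere and their log-densities add up. *)
Lemma integral_shift W h f : uniq W ->
  (forall i, i \in W -> measurable_fun setT (h i)) ->
  (forall i, i \in W -> dep (fun j => j \notin W) (h i)) ->
  measurable_fun setT f -> (forall s, 0 <= f s) ->
  \int[mu]_s f (shift W h s) =
  \int[mu]_s (f s * (expR (log_density W h s))%:E).
Proof.
elim: W f => [|c W IH] f uW mh dh mf f0.
  by apply: eq_integral => s _; rewrite /log_density big_nil expR0 mule1.
have mhc := mh c (mem_head _ _).
have mhW i : i \in W -> measurable_fun setT (h i).
  by move=> iW; apply: mh; rewrite inE iW orbT.
have [cW uW'] : c \notin W /\ uniq W by case/andP: uW.
have mc := @measurable_coord R I.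
have dW i : i \in W -> dep (fun j => j \notin W) (h i).
  move=> iW s s' ss'; apply: (dh i) => [|j]; first by rewrite inE iW orbT.
  by rewrite inE negb_or => /andP[_]; exact: ss'.
have dc : dep (predC1 c) (h c).
  move=> s s' ss'; apply: (dh c) => [|j]; first exact: mem_head.
  by rewrite inE negb_or => /andP[jc _]; exact: ss'.
have hcW s : h c (shift W h s) = h c s.
  apply: (dh c) => [|j]; first exact: mem_head.
  by rewrite inE negb_or /shift => /andP[_ /negbTE ->].
(* [g] displaces the coordinate [c]; as [h c] is unchanged by the shift over [W], composing [g] with
   that shift evaluates [f] at the shift over [c :: W]. *)
pose g (s : S) := f (upd c (s c + h c s)%R s).
have mg : measurable_fun setT g.
  apply: measurableT_comp => //; apply: measurable_seqspace => i; rewrite /upd.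
  by case: eqP => _; [exact: measurable_funD|exact: mc].
transitivity (\int[mu]_s g (shift W h s)).
  apply: eq_integral => s _; congr f; apply/funext => i.
  rewrite /upd hcW /shift inE (negbTE cW).
  by case: eqVneq => //= ->.
apply: etrans (IH g uW' mhW dW mg (fun=> f0 _)) _.
pose F (s : S) := f s * (expR (log_density W h s))%:E.
have ld s x : log_density W h (upd c x s) = log_density W h s.
  rewrite /log_density !big_seq; apply: eq_bigr => i iW.
  have ic : i != c by apply: contraNneq cW => <-.
  have -> : h i (upd c x s) = h i s.
    apply: (dh i) => [|j]; first by rewrite inE iW orbT.
    by rewrite inE negb_or /upd => /andP[/negbTE ->].
  by rewrite /upd (negbTE ic).
have mld : measurable_fun setT (log_density W h).
  rewrite [X in measurable_fun _ X](_ : _ = log_density W (fun i => if i \in W then h i else cst 0%R)).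
    by apply: measurable_log_density => i /=; case: ifP => // /mhW.
  by apply/funext => s; rewrite /log_density !big_seq; apply: eq_bigr => i ->.
transitivity (\int[mu]_s F (upd c (s c + h c s)%R s)).
  by apply: eq_integral => s _; rewrite /F ld.
have mF : measurable_fun setT F.
  by apply: emeasurable_funM => //; apply/measurable_EFinP/measurableT_comp.
have F0 s : 0 <= F s by rewrite mule_ge0// lee_fin expR_ge0.
apply: etrans (integral_shift1 mhc dc mF F0) _.
apply: eq_integral => s _; rewrite /F -muleA -EFinM -expRD.
by rewrite {2}/log_density big_cons addrC.
Qed.

Lemma integral_dilate1 c (a : R) f : (0 < a)%R ->
  measurable_fun setT f -> (forall s, 0 <= f s) ->
  \int[mu]_s f s = a%:E * \int[mu]_s (f (upd c (a * s c)%R s) *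
    (expR ((1 - a ^+ 2) / 2 * s c ^+ 2))%:E).
Proof.
move=> a0 mf f0; have mc := @measurable_coord R I.
rewrite (integral_upd muP c)//.
have mF : measurable_fun setT (fun s : S => f (upd c (a * s c)%R s) *
    (expR ((1 - a ^+ 2) / 2 * s c ^+ 2))%:E).
  apply: emeasurable_funM; last first.
    apply/measurable_EFinP/measurableT_comp => //; apply: measurable_funM => //.
    exact: measurable_funX.
  apply: measurableT_comp => //; apply: measurable_seqspace => i; rewrite /upd.
  by case: eqP => _; [exact: measurable_funM|exact: mc].
have F0 s : 0 <= f (upd c (a * s c)%R s) * (expR ((1 - a ^+ 2) / 2 * s c ^+ 2))%:E.
  by rewrite mule_ge0// lee_fin expR_ge0.
rewrite -ge0_integralZl//; last by rewrite lee_fin ltW.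
rewrite [RHS](integral_upd muP c); first last.
- by move=> s; rewrite mule_ge0// lee_fin ltW.
- exact: measurable_funeM.
apply: eq_integral => s _.
rewrite ge0_integralZl//; first last.
- by rewrite lee_fin ltW.
- by apply: (measurableT_comp mF); exact: measurable_upd.
have mfu : measurable_fun setT (fun x : R => f (upd c x s)).
  by apply: measurableT_comp => //; exact: measurable_upd.
apply: etrans (gauss_scale a0 mfu (fun=> f0 _)) _.
apply: (congr1 (fun z => _ * z)); apply: eq_integral => x _.
have -> : upd c x s c = x by rewrite /upd eqxx.
congr (f _ * _); apply/funext => i.
by rewrite /upd; case: eqP.
Qed.

Lemma integral_dilate W (a : R) f : uniq W -> (0 < a)%R ->
  measurable_fun setT f -> (forall s, 0 <= f s) ->
  \int[mu]_s f s = (a ^+ size W)%:E * \int[mu]_s (f (dilate W a s) *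
    (expR ((1 - a ^+ 2) / 2 * sumsq W s))%:E).
Proof.
move=> + a0; elim: W f => [|c W IH] f uW mf f0.
  rewrite mul1e; apply: eq_integral => s _.
  by rewrite /sumsq big_nil mulr0 expR0 mule1.
have [cW uW'] : c \notin W /\ uniq W by case/andP: uW.
have mc := @measurable_coord R I.
pose g (s : S) := f (upd c (a * s c)%R s) * (expR ((1 - a ^+ 2) / 2 * s c ^+ 2))%:E.
have mg : measurable_fun setT g.
  apply: emeasurable_funM; last first.
    apply/measurable_EFinP/measurableT_comp => //; apply: measurable_funM => //.
    exact: measurable_funX.
  apply: measurableT_comp => //; apply: measurable_seqspace => i; rewrite /upd.
  by case: eqP => _; [exact: measurable_funM|exact: mc].
have g0 s : 0 <= g s by rewrite mule_ge0// lee_fin expR_ge0.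
rewrite (integral_dilate1 c a0 mf f0) (IH g uW' mg g0).
rewrite muleA -EFinM -exprS; apply: (congr1 (fun z => _ * z)); apply: eq_integral => s _.
rewrite /g -muleA -EFinM -expRD /dilate (negbTE cW).
congr (f _ * (expR _)%:E).
  by apply/funext => i; rewrite /upd inE; case: eqVneq => //= ->.
by rewrite /sumsq big_cons mulrDr.
Qed.

(** The dilation formula for the constant function 1 and ratio 1/2, which produces the exponent (1 -
    1/4) / 2 = 3/8. It supplies the tails of the norm of a window. *)
Lemma integral_expR_sumsq W : uniq W ->
  \int[mu]_s (expR (3 / 8 * sumsq W s))%:E = (2 ^+ size W)%:E.
Proof.
move=> uW.
have h0 : (0 < 2^-1 :> R)%R by rewrite invr_gt0.
have := @integral_dilate W 2^-1 (cst 1) uW h0 (measurable_cst _) (fun=> lee01).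
rewrite integral_cst//= mul1e probability_setT => /esym.
under eq_integral do rewrite mul1e.
have -> : ((1 - 2^-1 ^+ 2) / 2 = 3 / 8 :> R)%R by field.
move=> /(congr1 (fun x => (2 ^+ size W)%:E * x)); rewrite muleA -EFinM -exprMn.
by rewrite divff ?pnatr_eq0// expr1n mul1e mule1.
Qed.

(* The exponential moments come from the Cameron-Martin formula for [f = 1]. *)
Lemma integral_expR_lin W (a : I -> R) : uniq W ->
  \int[mu]_s (expR (\sum_(i <- W) a i * s i))%:E =
  (expR (\sum_(i <- W) a i ^+ 2 / 2))%:E.
Proof.
move=> uW.
have := @integral_shift W (fun i => cst (a i)) (cst 1) uW (fun _ _ => measurable_cst _)
   (fun _ _ _ _ _ => erefl) (measurable_cst _) (fun=> lee01).
rewrite integral_cst//= mul1e probability_setT => /esym.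
under eq_integral do rewrite mul1e /log_density sumrB expRD EFinM muleC /=.
rewrite ge0_integralZl//; first last.
- apply/measurable_EFinP/measurableT_comp => //; apply: measurable_sum => i.
  by apply: measurable_funM => //; exact: measurable_coord.
move=> /(congr1 (fun x => (expR (\sum_(i <- W) a i ^+ 2 / 2))%:E * x)).
by rewrite muleA -EFinM -expRD subrr expR0 mul1e mule1.
Qed.

End cameron_martin.
(** * Mixing and anticlustering for displaced windows *)

Section real_prob.
Context d (T : measurableType d) (R : realType) (P : probability T R).
Implicit Types A B : set T.

Lemma probE A : measurable A -> P A = (prob P A)%:E.
Proof. by move=> mA; rewrite /prob fineK// fin_num_measure. Qed.

Lemma prob_ge0 A : 0 <= prob P A.
Proof. by rewrite /prob fine_ge0. Qed.

Lemma prob_le1 A : measurable A -> prob P A <= 1.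
Proof. by move=> mA; rewrite -lee_fin -probE// probability_le1. Qed.

Lemma probT : prob P setT = 1.
Proof. by rewrite /prob probability_setT. Qed.

Lemma le_prob A B : measurable A -> measurable B -> A `<=` B ->
  prob P A <= prob P B.
Proof. by move=> mA mB AB; rewrite -lee_fin -!probE// le_measure// inE. Qed.

Lemma probU_le A B : measurable A -> measurable B ->
  prob P (A `|` B) <= prob P A + prob P B.
Proof.
move=> mA mB; rewrite -lee_fin EFinD -!probE//; last exact: measurableU.
exact: measureU2.
Qed.

Lemma prob_bigU_le (I : Type) (s : seq I) (A : I -> set T) :
  (forall i, measurable (A i)) ->
  prob P (\big[setU/set0]_(i <- s) A i) <= \sum_(i <- s) prob P (A i).
Proof.
move=> mA; elim: s => [|i s IH]; first by rewrite !big_nil /prob measure0.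
rewrite !big_cons (le_trans (probU_le _ _))//; last by rewrite lerD2l.
exact: bigsetU_measurable.
Qed.

Lemma probC A : measurable A -> prob P (~` A) = 1 - prob P A.
Proof.
move=> mA; rewrite /prob probability_setC// probE//.
Qed.

Lemma probD_I A B : measurable A -> measurable B ->
  prob P B = prob P (A `&` B) + prob P (~` A `&` B).
Proof.
move=> mA mB; apply: EFin_inj; rewrite EFinD -!probE//; last 2 first.
- by apply: measurableI => //; exact: measurableC.
- exact: measurableI.
rewrite -measureU//; last 3 first.
- exact: measurableI.
- by apply: measurableI => //; exact: measurableC.
- by rewrite setIACA setICr set0I.
by rewrite -setIUl setUCr setTI.
Qed.

Lemma integral_1 A : measurable A ->
  (\int[P]_s (\1_A s)%:E = (prob P A)%:E)%E.
Proof. by move=> mA; rewrite integral_indic// setIT; exact: probE. Qed.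

End real_prob.

Section linear_combination.
Local Open Scope ereal_scope.
Context d (T : measurableType d) (R : realType) (P : {measure set T -> \bar R}).

Lemma ge0_le_integralT (f g : T -> \bar R) : (forall x, 0 <= f x) ->
  measurable_fun setT f -> measurable_fun setT g -> (forall x, f x <= g x) ->
  \int[P]_x f x <= \int[P]_x g x.
Proof. by move=> f0 mf mg fg; apply: ge0_le_integral. Qed.

Lemma ge0_integral_lin2 (k1 k2 : R) (f g : T -> \bar R) : (0 <= k1)%R -> (0 <= k2)%R ->
  measurable_fun setT f -> measurable_fun setT g ->
  (forall x, 0 <= f x) -> (forall x, 0 <= g x) ->
  \int[P]_x (k1%:E * f x + k2%:E * g x) =
  k1%:E * \int[P]_x f x + k2%:E * \int[P]_x g x.
Proof.
move=> k10 k20 mf mg f0 g0.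
rewrite (@ge0_integralD _ _ _ P _ measurableT (fun x => k1%:E * f x) (fun x => k2%:E * g x)).
- rewrite (@ge0_integralZl _ _ _ P _ measurableT _ mf)//.
  by rewrite (@ge0_integralZl _ _ _ P _ measurableT _ mg).
- by move=> x _; rewrite mule_ge0.
- exact: measurable_funeM.
- by move=> x _; rewrite mule_ge0.
- exact: measurable_funeM.
Qed.

End linear_combination.

(** * Sub-Gaussian variables *)

Section moment.
Context d (T : measurableType d) (R : realType) (P : probability T R).

(** For [t >= 0], [expR t] is the square of [expR (t / 2) >= 1 + t / 2], hence at least
    [t ^+ 2 / 4]. *)
Lemma sqr_le_expR (x : R) : x ^+ 2 <= 4 * (expR x + expR (- x)).
Proof.
suff H (t : R) : 0 <= t -> t ^+ 2 <= 4 * expR t.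
  have [x0|x0] := leP 0 x.
    by rewrite (le_trans (H _ x0))// ler_pM2l// lerDl expR_ge0.
  rewrite -sqrrN (le_trans (H (- x) _))//; first by rewrite oppr_ge0 ltW.
  by rewrite ler_pM2l// lerDr expR_ge0.
move=> t0; have h := expR_ge1Dx (t / 2).
have -> : expR t = expR (t / 2) ^+ 2 by rewrite -expRM_natl; congr expR; field.
have : (1 + t / 2) ^+ 2 <= expR (t / 2) ^+ 2.
  by rewrite ler_sqr// nnegrE ?expR_ge0// addr_ge0// divr_ge0.
nra.
Qed.

(** Only an upper bound on the exponential moments is kept. It survives limits by Fatou's lemma and
    sums by convexity, so neither Gaussianity of infinite series nor joint laws have to be
    established. *)
Definition subgauss (sg : R) (Z : T -> R) := forall t,
  (\int[P]_s (expR (t * Z s))%:E <= (expR (t ^+ 2 * sg ^+ 2 / 2))%:E)%E.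

(** The exponential bound is used at [t = sg^-1] and [t = - sg^-1], where it equals [expR (1 / 2)];
    the two values and the factor 4 of [sqr_le_expR] make 8. *)
Lemma subgauss_sqr (sg : R) (Z : T -> R) : 0 < sg -> measurable_fun setT Z ->
  subgauss sg Z ->
  (\int[P]_s ((Z s) ^+ 2)%:E <= (8 * expR (1 / 2) * sg ^+ 2)%:E)%E.
Proof.
move=> sg0 mZ hZ.
have mE t : measurable_fun setT (fun s => (expR (t * Z s))%:E).
  by apply/measurable_EFinP/measurableT_comp => //; exact: measurable_funM.
apply: (@le_trans _ _ (\int[P]_s ((4 * sg ^+ 2)%:E *
   ((expR (sg^-1 * Z s))%:E + (expR (- sg^-1 * Z s))%:E)))%E).
  apply: ge0_le_integral => //.
  - by move=> s _; rewrite lee_fin sqr_ge0.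
  - exact/measurable_EFinP/measurable_funX.
  - by apply: measurable_funeM; exact: emeasurable_funD.
  move=> s _; rewrite -EFinD -EFinM lee_fin.
  have := sqr_le_expR (sg^-1 * Z s); rewrite exprMn mulNr => h.
  have /(ler_wpM2l (sqr_ge0 sg)) := h.
  rewrite mulrA -exprMn divff ?gt_eqF// expr1n mul1r => /le_trans; apply.
  by rewrite mulrCA mulrA.
rewrite ge0_integralZl//; first last.
- by rewrite lee_fin mulr_ge0// sqr_ge0.
- by move=> s _; rewrite -EFinD lee_fin addr_ge0 ?expR_ge0.
- exact: emeasurable_funD.
rewrite ge0_integralD//.
have h1 t : t ^+ 2 = (sg^-1) ^+ 2 -> (\int[P]_s (expR (t * Z s))%:E <= (expR (1/2))%:E)%E.
  move=> ht; apply: (le_trans (hZ t)).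
  by rewrite lee_fin ht -exprMn mulVf ?gt_eqF// expr1n.
apply: (@le_trans _ _ ((4 * sg ^+ 2)%:E * ((expR (1/2))%:E + (expR (1/2))%:E))%E).
  apply: lee_wpmul2l; first by rewrite lee_fin mulr_ge0// sqr_ge0.
  by apply: leeD; apply: h1; rewrite ?sqrrN.
by rewrite -EFinD -EFinM lee_fin; rewrite le_eqVlt; apply/orP; left; apply/eqP; ring.
Qed.

Lemma subgauss_tail (sg x : R) (Z : T -> R) : 0 < sg -> 0 <= x ->
  measurable_fun setT Z -> subgauss sg Z ->
  prob P [set s | x < `|Z s|] <= 2 * expR (- (x ^+ 2 / (2 * sg ^+ 2))).
Proof.
move=> sg0 x0 mZ hZ.
have mE t : measurable_fun setT (fun s => (expR (t * Z s))%:E).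
  by apply/measurable_EFinP/measurableT_comp => //; exact: measurable_funM.
have mA : measurable [set s | x < `|Z s|].
  rewrite -[X in measurable X]setTI.
  by apply: measurable_fun_ltr => //; exact: measurableT_comp.
(* Minimiser of [t ^+ 2 * sg ^+ 2 / 2 - t * x], the exponent in the Chernoff bound. *)
pose t := x / sg ^+ 2.
have t0 : 0 <= t by rewrite divr_ge0// sqr_ge0.
rewrite -lee_fin -integral_1//.
apply: (@le_trans _ _ (\int[P]_s ((expR (- (t * x)))%:E *
   ((expR (t * Z s))%:E + (expR (- t * Z s))%:E)))%E).
  apply: ge0_le_integral => //.
  - by apply/measurable_EFinP; exact: measurable_indic.
  - by apply: measurable_funeM; exact: emeasurable_funD.
  move=> s _; rewrite -EFinD -EFinM lee_fin indicE.
  case: (boolP (_ \in _)) => [|_]; last by rewrite mulr_ge0 ?addr_ge0 ?expR_ge0.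
  rewrite inE/= => xZ; rewrite mulrDr -!expRD.
  have [Z0|Z0] := leP 0 (Z s).
    rewrite ger0_norm// in xZ.
    apply: (@le_trans _ _ (expR (- (t * x) + t * Z s))); last by rewrite lerDl expR_ge0.
    by rewrite -[leLHS]expR0 ler_expR; nra.
  rewrite ltr0_norm// in xZ.
  apply: (@le_trans _ _ (expR (- (t * x) + - t * Z s))); last by rewrite lerDr expR_ge0.
  by rewrite -[leLHS]expR0 ler_expR; nra.
rewrite ge0_integralZl//; first last.
- by move=> s _; rewrite -EFinD lee_fin addr_ge0 ?expR_ge0.
- exact: emeasurable_funD.
rewrite ge0_integralD//.
apply: (@le_trans _ _ ((expR (- (t * x)))%:E *
   ((expR (t ^+ 2 * sg ^+ 2 / 2))%:E + (expR (t ^+ 2 * sg ^+ 2 / 2))%:E))%E).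
  apply: lee_wpmul2l; first by rewrite lee_fin expR_ge0.
  by apply: leeD; first exact: hZ; rewrite -sqrrN; exact: hZ.
rewrite -EFinD -EFinM lee_fin mulrDr -expRD.
have -> : - (t * x) + t ^+ 2 * sg ^+ 2 / 2 = - (x ^+ 2 / (2 * sg ^+ 2)).
  by rewrite /t; field; rewrite gt_eqF.
lra.
Qed.

End moment.

Section sumsq_tail.
Context (R : realType) (I : choiceType).
Local Notation S := (seqspace R I).
Variable (mu : probability S R).
Hypothesis muP : iid_gauss mu.

Lemma measurable_sumsq_gt (W : seq I) (rho : R) :
  measurable [set s : S | rho < sumsq W s].
Proof.
rewrite -[X in measurable X]setTI.
by apply: measurable_fun_ltr => //; exact: measurable_sumsq.
Qed.

(** Markov's inequality for [expR (3 / 8 * sumsq W s)]; of the available exponent 3/8 only 1/4 is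
    kept. *)
Lemma prob_sumsq_gt (W : seq I) (rho : R) : uniq W -> 0 <= rho ->
  prob mu [set s | rho < sumsq W s] <= 2 ^+ size W * expR (- (rho / 4)).
Proof.
move=> uW rho0.
have mA := measurable_sumsq_gt W rho.
have m2 : measurable_fun setT (fun a : S => (expR (3 / 8 * sumsq W a))%:E).
  apply/measurable_EFinP.
  by apply: measurableT_comp => //; apply: measurable_funM => //; exact: measurable_sumsq.
rewrite -lee_fin -integral_1//.
apply: (@le_trans _ _ (\int[mu]_a ((expR (- (rho / 4)))%:E * (expR (3 / 8 * sumsq W a))%:E))%E).
  apply: ge0_le_integral => //.
  - by apply/measurable_EFinP; exact: measurable_indic.
  - exact: measurable_funeM.
  move=> s _; rewrite -EFinM lee_fin indicE -expRD.
  case: (boolP (_ \in _)) => [|_]; last by rewrite expR_ge0.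
  by rewrite inE/= => h; rewrite -[leLHS]expR0 ler_expR; lra.
rewrite (@ge0_integralZl _ _ _ mu _ measurableT _ m2); last 2 first.
- by move=> s _; rewrite lee_fin expR_ge0.
- by rewrite lee_fin expR_ge0.
by rewrite integral_expR_sumsq// -EFinM mulrC.
Qed.

End sumsq_tail.

(** * Mixing: a small displacement barely changes the law of a window *)

Section mixing.
Context (R : realType) (I : choiceType).
Local Notation S := (seqspace R I).
Variable (mu : probability S R).
Hypothesis muP : iid_gauss mu.
Variables (W : seq I) (J : pred I) (h : I -> S -> R) (D0 : set S).
Hypothesis uW : uniq W.
Hypothesis WJ : forall i, i \in W -> J i.
Hypothesis mh : forall i, measurable_fun setT (h i).
Hypothesis dh : forall i, dep (predC J) (h i).
Hypothesis mD0 : measurable D0.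
Hypothesis dD0 : dep J D0.

Definition shifted : set S := shift W h @^-1` D0.

Lemma measurable_shifted : measurable shifted.
Proof.
rewrite -[X in measurable X]setTI.
exact: (@measurable_shift R I W h mh).
Qed.

(* Cameron-Martin density of the displacement by [h b]: since [h] does not look
   at the coordinates in [J], the event [shifted] has conditional probability
   the [weight]-mass of [D0] given those outside [J]. *)
Definition weight (a b : S) : R :=
  expR (\sum_(i <- W) (h i b * a i - h i b ^+ 2 / 2)).

Lemma weight_ge0 a b : 0 <= weight a b. Proof. exact: expR_ge0. Qed.

Lemma measurable_weight : measurable_fun setT (fun p : S * S => weight p.1 p.2).
Proof.
apply: measurableT_comp => //; apply: measurable_sum => i.
have m2 : measurable_fun setT (fun p : S * S => h i p.2).
  exact: (measurableT_comp (mh i) measurable_snd).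
apply: measurable_funB.
  apply: measurable_funM => //.
  exact: (measurableT_comp (measurable_coord i) measurable_fst).
by apply: measurable_funM => //; exact: measurable_funX.
Qed.

Lemma measurable_weightr a : measurable_fun setT (weight a).
Proof.
apply: measurableT_comp => //; apply: measurable_sum => i.
apply: measurable_funB; first exact: measurable_funM.
by apply: measurable_funM => //; exact: measurable_funX.
Qed.

Lemma dep_shift (U : Type) (f : S -> U) s : dep (predC J) f -> f (shift W h s) = f s.
Proof.
move=> df; apply: df => i /=; rewrite /shift.
by case: ifPn => // /WJ ->.
Qed.

Local Open Scope ereal_scope.

Lemma integral_shifted (f : S -> \bar R) :
  measurable_fun setT f -> (forall s, 0 <= f s) ->
  \int[mu]_s f (shift W h s) =
  \int[mu]_s (f s * (expR (log_density W h s))%:E).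
Proof.
move=> mf f0; apply: (integral_shift muP uW _ _ mf f0) => i iW; first exact: mh.
by move=> s s' ss'; apply: dh => j /= Jj; apply: ss'; apply: contra Jj; exact: WJ.
Qed.

(** Cameron-Martin followed by Fubini: [a] carries the coordinates in [J], on which [D0] depends,
    and [b] the others, on which [C] and [h] depend. *)
Lemma mixture (C : set S) : measurable C -> dep (predC J) C ->
  (prob mu (C `&` shifted))%:E =
  \int[mu]_a ((\1_D0 a)%:E * \int[mu]_b ((\1_C b)%:E * (weight a b)%:E)).
Proof.
move=> mC dC.
have m1 (A : set S) : measurable A -> measurable_fun setT (fun s => (\1_A s)%:E : \bar R).
  by move=> mA; apply/measurable_EFinP; exact: measurable_indic.
rewrite -integral_1; last by apply: measurableI => //; exact: measurable_shifted.
pose F (s : S) := (\1_C s)%:E * (\1_D0 s)%:E : \bar R.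
have mF : measurable_fun setT F by apply: emeasurable_funM; exact: m1.
have F0 s : 0 <= F s by rewrite mule_ge0// lee_fin.
transitivity (\int[mu]_s F (shift W h s)).
  apply: eq_integral => s _; rewrite indicI EFinM /F; congr (_ * _).
  exact: (esym (dep_shift s (dep_indic (R := R) dC))).
apply: etrans (integral_shifted mF F0) _.
rewrite (integral_glue2 muP J); last 2 first.
- apply: emeasurable_funM => //; apply/measurable_EFinP/measurableT_comp => //.
  exact: measurable_log_density.
- by move=> s; rewrite mule_ge0// lee_fin expR_ge0.
apply: eq_integral => a _.
rewrite -ge0_integralZl//; last 2 first.
- apply: emeasurable_funM; first exact: m1.
  by apply/measurable_EFinP; exact: measurable_weightr.
- by move=> s _; rewrite mule_ge0 ?lee_fin// weight_ge0.
apply: eq_integral => b _.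
rewrite /F [in LHS](_ : (\1_C (glue J a b))%:E = (\1_C b)%:E); last first.
  by apply: (dep_indic (R := R) dC) => i /= /negbTE Ji; rewrite /glue Ji.
rewrite [in LHS](_ : (\1_D0 (glue J a b))%:E = (\1_D0 a)%:E); last first.
  by apply: (dep_indic (R := R) dD0) => i Ji; rewrite /glue Ji.
have -> : log_density W h (glue J a b) =
    (\sum_(i <- W) (h i b * a i - h i b ^+ 2 / 2))%R.
  rewrite /log_density !big_seq; apply: eq_bigr => i /WJ iJ.
  have -> : h i (glue J a b) = h i b.
    by apply: dh => j /= /negbTE Jj; rewrite /glue Jj.
  by rewrite {1}/glue iJ.
by rewrite -muleA muleCA.
Qed.

Lemma measurable_mix (C : set S) : measurable C ->
  measurable_fun setT (fun a => \int[mu]_b ((\1_C b)%:E * (weight a b)%:E)).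
Proof.
move=> mC.
apply: (measurable_fun_fubini_tonelli_F (m2 := mu)
  (fun p : S * S => (\1_C p.2)%:E * (weight p.1 p.2)%:E)).
  apply: emeasurable_funM.
    apply/measurable_EFinP.
    have mi : measurable_fun setT (\1_C : S -> R) by exact: measurable_indic.
    exact: (measurableT_comp mi measurable_snd).
  by apply/measurable_EFinP; exact: measurable_weight.
by move=> p; rewrite mule_ge0// lee_fin weight_ge0.
Qed.

Variable sg : R.
Hypothesis sg0 : (0 < sg)%R.
Hypothesis hMGF : forall a : S, \int[mu]_b (expR (\sum_(i <- W) a i * h i b))%:E <=
  (expR (sg ^+ 2 / 2 * sumsq W a))%:E.
Hypothesis hsub : forall i, i \in W -> subgauss mu sg (h i).

(** Where the window has squared norm at most [rho], averaging the weight over [b] costs at most the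
    factor [expR (sg ^+ 2 * rho / 2)]; the rest is a Gaussian tail. *)
Lemma shifted_le (rho : R) : (0 <= rho -> sg ^+ 2 <= 1 / 4 ->
  prob mu shifted <=
  expR (sg ^+ 2 * rho / 2) * prob mu D0 + 2 ^+ size W * expR (- (rho / 4)))%R.
Proof.
move=> rho0 sg4.
rewrite -lee_fin -[shifted]setTI mixture//.
apply: (@le_trans _ _ (\int[mu]_a ((expR (sg ^+ 2 * rho / 2))%:E * (\1_D0 a)%:E
   + (expR (- (rho / 4)))%:E * (expR (3 / 8 * sumsq W a))%:E))).
  apply: ge0_le_integral => //.
  - move=> a _; rewrite mule_ge0 ?lee_fin// integral_ge0// => b _.
    by rewrite mule_ge0 ?lee_fin// weight_ge0.
  - apply: emeasurable_funM; last exact: measurable_mix.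
    by apply/measurable_EFinP; exact: measurable_indic.
  - apply: emeasurable_funD; apply: measurable_funeM; apply/measurable_EFinP.
      exact: measurable_indic.
    by apply: measurableT_comp => //; apply: measurable_funM => //; exact: measurable_sumsq.
  move=> a _.
  have step : \int[mu]_b ((\1_setT b)%:E * (weight a b)%:E) <=
      (expR (sg ^+ 2 / 2 * sumsq W a))%:E.
    apply: le_trans (hMGF a); apply: ge0_le_integral => //.
    - by move=> b _; rewrite mule_ge0 ?lee_fin// weight_ge0.
    - apply: emeasurable_funM; apply/measurable_EFinP; first exact: measurable_indic.
      exact: measurable_weightr.
    - apply/measurable_EFinP/measurableT_comp => //; apply: measurable_sum => i.
      exact: measurable_funM.
    move=> b _; rewrite indicT mul1e lee_fin ler_expR; apply: ler_sum => i _.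
    by rewrite mulrC gerBl divr_ge0// sqr_ge0.
  apply: (le_trans (lee_wpmul2l _ step)); first by rewrite lee_fin.
  rewrite -!EFinM -EFinD lee_fin indicE; case: (_ \in _); last first.
    by rewrite !(mul0r, mulr0) add0r mulr_ge0 ?expR_ge0.
  rewrite mul1r mulr1 -expRD.
  have [le|gt] := leP (sumsq W a) rho.
    apply: (@le_trans _ _ (expR (sg ^+ 2 * rho / 2))); last by rewrite lerDl expR_ge0.
    by rewrite ler_expR mulrAC ler_pM2r ?invr_gt0// ler_wpM2l// sqr_ge0.
  (* Beyond [rho] the averaged weight has exponent at most 1/8, as [sg ^+ 2 <= 1 / 4], and 1/8 + 1/4
     = 3/8 is the exponent with a known moment. *)
  apply: (@le_trans _ _ (expR (- (rho / 4) + 3 / 8 * sumsq W a))); last first.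
    by rewrite lerDr expR_ge0.
  have sq := sqr_ge0 sg.
  rewrite ler_expR; nra.
have m1 : measurable_fun setT (fun a : S => (\1_D0 a)%:E : \bar R).
  by apply/measurable_EFinP; exact: measurable_indic.
have m2 : measurable_fun setT (fun a : S => (expR (3 / 8 * sumsq W a))%:E).
  apply/measurable_EFinP.
  by apply: measurableT_comp => //; apply: measurable_funM => //; exact: measurable_sumsq.
rewrite (ge0_integral_lin2 mu (expR_ge0 _) (expR_ge0 _) m1 m2); last 2 first.
- by move=> s; rewrite lee_fin.
- by move=> s; rewrite lee_fin expR_ge0.
rewrite integral_1// integral_expR_sumsq//.
by rewrite -!EFinM -EFinD mulrC (mulrC (expR (- _))) mulrC.
Qed.

Let M2 : R := (8 * expR (1 / 2))%R.

Definition sumsq_tail (r : R) : R := (2 ^+ size W * expR (- (r ^+ 2 / 4)))%R.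

(** Bounds how much the weight can fall below 1, averaged over [b], when the window has norm at most
    [r]: first the part quadratic in [h], then the part quadratic in the window coordinates. *)
Definition weight_defect (r : R) : R :=
  ((size W)%:R * M2 * (sg * r + sg ^+ 2) + sg * r)%R.

Lemma weight_defect_ge0 (r : R) : (0 < r)%R -> (0 <= weight_defect r)%R.
Proof.
move=> r0.
have M20 : (0 < M2)%R by rewrite /M2 mulr_gt0 ?expR_gt0.
have sg2 : (0 < sg ^+ 2)%R by rewrite exprn_gt0.
by rewrite /weight_defect addr_ge0// ?mulr_ge0// ?addr_ge0// ?mulr_ge0// ltW.
Qed.

(** Since [expR x >= 1 + x], the weight is at least 1 plus its logarithm, whose negative part is
    small on average over [b] as long as the window has norm at most [r]. The part of [D0] of larger
    norm is given up, which costs the Gaussian tail on the left. *)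
Lemma shifted_ge (r : R) (C : set S) : (0 < r)%R -> measurable C -> dep (predC J) C ->
  ((prob mu D0 - 2 ^+ size W * expR (- (r ^+ 2 / 4))) * prob mu C <=
  prob mu (C `&` shifted) + weight_defect r * prob mu D0)%R.
Proof.
move=> r0 mC dC; set kap := weight_defect r; set tl := (2 ^+ size W * _)%R.
have sg2 : (0 < sg ^+ 2)%R by rewrite exprn_gt0.
have M20 : (0 < M2)%R by rewrite /M2 mulr_gt0 ?expR_gt0.
have kap0 : (0 <= kap)%R := weight_defect_ge0 r0.
have m1 (A : set S) : measurable A -> measurable_fun setT (fun s => (\1_A s)%:E : \bar R).
  by move=> mA; apply/measurable_EFinP; exact: measurable_indic.
have mw a : measurable_fun setT (fun b => (\1_C b)%:E * (weight a b)%:E : \bar R).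
  apply: emeasurable_funM; first exact: m1.
  by apply/measurable_EFinP; exact: measurable_weightr.
have w0 a b : 0 <= (\1_C b)%:E * (weight a b)%:E.
  by rewrite mule_ge0 ?lee_fin// weight_ge0.
pose E := [set s : S | (r ^+ 2 < sumsq W s)%R].
have mE : measurable E := measurable_sumsq_gt W (r ^+ 2).
have inner a : ~ E a -> (prob mu C)%:E <=
    \int[mu]_b ((\1_C b)%:E * (weight a b)%:E) + kap%:E.
  move=> /negP; rewrite -leNgt => Ea.
  (* The product [h i b * a i] is split with weights [r / sg] and [sg / r]: [h] is of order [sg] and
     [a] of order [r], so both squares contribute order [sg * r]. The [+ 1] covers the term
     [h i b ^+ 2 / 2]. *)
  pose c := (r / sg + 1)%R.
  have c0 : (0 < c)%R by rewrite /c addr_gt0// divr_gt0.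
  pose Q b := (\sum_(i <- W) (c * h i b ^+ 2))%R.
  have mQ : measurable_fun setT Q.
    by apply: measurable_sum => i; apply: measurable_funM => //; exact: measurable_funX.
  have Q0 b : (0 <= Q b)%R.
    by apply: sumr_ge0 => i _; rewrite mulr_ge0 ?sqr_ge0// ltW.
  have IQ : \int[mu]_b (Q b)%:E <= ((size W)%:R * M2 * (sg * r + sg ^+ 2))%:E.
    under eq_integral do rewrite /Q -sumEFin.
    rewrite ge0_integral_sum//; last 2 first.
    - move=> i; apply/measurable_EFinP; apply: measurable_funM => //.
      exact: measurable_funX.
    - by move=> i b _; rewrite lee_fin mulr_ge0 ?sqr_ge0// ltW.
    rewrite (_ : ((size W)%:R * M2 * (sg * r + sg ^+ 2))%R =
      (\sum_(i <- W) M2 * (sg * r + sg ^+ 2))%R); last first.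
      by rewrite big_const_seq count_predT iter_addr_0 -[RHS]mulr_natl mulrA.
    rewrite -sumEFin !big_seq; apply: lee_sum => i iW.
    have mhi2 : measurable_fun setT (fun b => (h i b ^+ 2)%:E).
      exact/measurable_EFinP/measurable_funX.
    under eq_integral do rewrite EFinM.
    rewrite (@ge0_integralZl _ _ _ mu _ measurableT _ mhi2); last 2 first.
    - by move=> b _; rewrite lee_fin sqr_ge0.
    - by rewrite lee_fin ltW.
    have := subgauss_sqr sg0 (mh i) (hsub iW).
    move=> /(lee_wpmul2l (_ : 0 <= c%:E)) -/(_ _)/le_trans; apply.
      by rewrite lee_fin ltW.
    rewrite -EFinM lee_fin le_eqVlt; apply/orP; left; apply/eqP; rewrite /c /M2.
    by field; rewrite gt_eqF.
  rewrite -integral_1//.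
  apply: (@le_trans _ _ (\int[mu]_b ((\1_C b)%:E * (weight a b)%:E +
      ((Q b)%:E + (sg * r)%:E)))).
    apply: ge0_le_integral => //.
    - exact: m1.
    - apply: emeasurable_funD => //; apply: emeasurable_funD => //.
      exact/measurable_EFinP.
    move=> b _; rewrite -EFinM -!EFinD lee_fin indicE.
    case: (_ \in _); last by rewrite mul0r add0r addr_ge0// mulr_ge0// ltW.
    rewrite mul1r -[_%:R]/(1%R : R).
    have hw : (1 + \sum_(i <- W) (h i b * a i - h i b ^+ 2 / 2) <= weight a b)%R.
      exact: expR_ge1Dx.
    have : (- \sum_(i <- W) (h i b * a i - h i b ^+ 2 / 2) <=
        \sum_(i <- W) (c * h i b ^+ 2 + (sg / r) * a i ^+ 2))%R.
      rewrite -sumrN; apply: ler_sum => i _; rewrite /c.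
      have : (0 <= (sg / r) * (a i + (r / sg) * h i b) ^+ 2)%R.
        by rewrite mulr_ge0 ?sqr_ge0// divr_ge0// ltW.
      have -> : ((sg / r) * (a i + (r / sg) * h i b) ^+ 2 =
        (sg / r) * a i ^+ 2 + 2 * (h i b * a i) + (r / sg) * h i b ^+ 2)%R.
        by field; rewrite !gt_eqF.
      have := sqr_ge0 (h i b).
      have : (0 <= (sg / r) * a i ^+ 2)%R by rewrite mulr_ge0 ?sqr_ge0// divr_ge0// ltW.
      have : (0 <= (r / sg) * h i b ^+ 2)%R by rewrite mulr_ge0 ?sqr_ge0// divr_ge0// ltW.
      lra.
    have -> : (\sum_(i <- W) (c * h i b ^+ 2 + (sg / r) * a i ^+ 2) =
       Q b + sg / r * sumsq W a)%R by rewrite big_split/= /sumsq mulr_sumr.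
    have : (sg / r * sumsq W a <= sg * r)%R.
      rewrite (_ : sg * r = sg / r * r ^+ 2)%R; last by field; rewrite gt_eqF.
      by rewrite ler_wpM2l// divr_ge0// ltW.
    lra.
  rewrite (@ge0_integralD _ _ _ mu _ measurableT (fun b => (\1_C b)%:E * (weight a b)%:E)
    (fun b => (Q b)%:E + (sg * r)%:E)); last 4 first.
  - by [].
  - exact: mw.
  - by move=> b _; rewrite -EFinD lee_fin addr_ge0// mulr_ge0// ltW.
  - by apply: emeasurable_funD => //; exact/measurable_EFinP.
  apply: leeD2l.
  rewrite (@ge0_integralD _ _ _ mu _ measurableT (fun b => (Q b)%:E)
    (fun b => (sg * r)%:E)); last 4 first.
  - by move=> b _; rewrite lee_fin.
  - exact/measurable_EFinP.
  - by move=> b _; rewrite lee_fin mulr_ge0// ltW.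
  - by [].
  rewrite integral_cst//= probability_setT mule1 /kap /weight_defect EFinD.
  exact: leeD2r.
pose G := D0 `&` ~` E.
have mG : measurable G by apply: measurableI => //; exact: measurableC.
have key : (prob mu G * prob mu C <= prob mu (C `&` shifted) + kap * prob mu D0)%R.
  rewrite -lee_fin EFinM !EFinD mixture// EFinM -(integral_1 mu mG) -(integral_1 mu mD0).
  have mmix := measurable_mix mC.
  rewrite -(@ge0_integralZr _ _ _ mu _ measurableT _ (m1 _ mG)); last 2 first.
  - by move=> s _; rewrite lee_fin.
  - by rewrite lee_fin prob_ge0.
  rewrite -(@ge0_integralZl _ _ _ mu _ measurableT _ (m1 _ mD0)); last 2 first.
  - by move=> s _; rewrite lee_fin.
  - by rewrite lee_fin.
  rewrite -(@ge0_integralD _ _ _ mu _ measurableT (fun a => (\1_D0 a)%:E * \int[mu]_b ((\1_C b)%:E * (weight a b)%:E))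
     (fun a => kap%:E * (\1_D0 a)%:E)); last 4 first.
  - by move=> a _; rewrite mule_ge0 ?lee_fin ?integral_ge0.
  - by apply: emeasurable_funM => //; exact: m1.
  - by move=> a _; rewrite mule_ge0 ?lee_fin.
  - by apply: measurable_funeM; exact: m1.
  apply: ge0_le_integral => //.
  - by move=> a _; rewrite mule_ge0 ?lee_fin ?prob_ge0.
  - by apply: emeasurable_funM => //; exact: m1.
  - apply: emeasurable_funD; first by apply: emeasurable_funM => //; exact: m1.
    by apply: measurable_funeM; exact: m1.
  move=> a _; rewrite !indicE /G in_setI.
  case: (boolP (a \in D0)) => aD /=; last by rewrite !mul0e mule0 adde0.
  rewrite mul1e mule1; case: (boolP (a \in ~` E)) => aE /=; last first.
    by rewrite mul0e adde_ge0 ?lee_fin ?integral_ge0.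
  by rewrite mul1e; apply: inner; rewrite inE in aE.
apply: le_trans key; apply: ler_wpM2r; first exact: prob_ge0.
have := probD_I mu (measurableC mE) mD0.
rewrite setIC -/G setCK => ->.
have : (prob mu (E `&` D0) <= tl)%R.
  apply: le_trans (prob_sumsq_gt muP uW (sqr_ge0 r)).
  by apply: le_prob => //; exact: measurableI.
lra.
Qed.

(** Both bounds compare with the undisplaced event [D0]: [shifted_ge] bounds the joint probability
    from below and [shifted_le] the marginal from above. The case [C = setT], with
    [weight_defect r <= 1 / 2], then bounds [prob mu D0] in terms of [shifted]. *)
Lemma shifted_mixing1 (r : R) (C : set S) : (0 < r)%R -> (sg ^+ 2 <= 1 / 4)%R ->
  (weight_defect r <= 1 / 2)%R -> measurable C -> dep (predC J) C ->
  (prob mu C * prob mu shifted - prob mu (C `&` shifted) <=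
   (weight_defect r + (expR (sg ^+ 2 * r ^+ 2 / 2) - 1)) * (2 * prob mu shifted + 2 * sumsq_tail r)
   + 2 * sumsq_tail r)%R.
Proof.
move=> r0 sg4 k2 mC dC; set tl := sumsq_tail r.
have U := shifted_le (sqr_ge0 r) sg4; rewrite -/(sumsq_tail r) -/tl in U.
have L := shifted_ge r0 mC dC; rewrite -/(sumsq_tail r) -/tl in L.
have L1 := @shifted_ge r setT r0 measurableT (fun _ _ _ => erefl).
rewrite -/(sumsq_tail r) -/tl setTI probT mulr1 in L1.
have tl0 : (0 <= tl)%R by rewrite /tl /sumsq_tail mulr_ge0 ?expR_ge0 ?exprn_ge0.
have := prob_ge0 mu C; have := prob_le1 mu mC.
have := prob_ge0 mu D0; have := prob_ge0 mu shifted.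
have : (1 <= expR (sg ^+ 2 * r ^+ 2 / 2))%R.
  by rewrite -[leLHS]expR0 ler_expR divr_ge0// mulr_ge0 ?sqr_ge0.
have kap0 := weight_defect_ge0 r0.
move: kap0 L U L1 k2 tl0.
move: (weight_defect r) (expR _) (prob mu D0) (prob mu shifted) (prob mu C)
  (prob mu (C `&` shifted)) (tl).
move=> k e p0 p c pc t k0 L U L1 k2 t0 e1 pp0 pp c1 c0.
have b0 : (p0 <= 2 * p + 2 * t)%R by nra.
have : (c * p <= c * (e * p0 + t))%R by rewrite ler_wpM2l.
have : ((k + (e - 1)) * p0 <= (k + (e - 1)) * (2 * p + 2 * t))%R.
  by rewrite ler_wpM2l// addr_ge0// subr_ge0.
have : (c * ((e - 1) * p0) <= (e - 1) * p0)%R.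
  by rewrite ler_piMl// mulr_ge0// subr_ge0.
have : (c * t <= t)%R by rewrite ler_piMl.
lra.
Qed.

(** The reverse inequality is the one-sided one for the complement of [C]. *)
Lemma shifted_mixing (r : R) (C : set S) : (0 < r)%R -> (sg ^+ 2 <= 1 / 4)%R ->
  (weight_defect r <= 1 / 2)%R -> measurable C -> dep (predC J) C ->
  (`|prob mu (C `&` shifted) - prob mu C * prob mu shifted| <=
   (weight_defect r + (expR (sg ^+ 2 * r ^+ 2 / 2) - 1)) * (2 * prob mu shifted + 2 * sumsq_tail r)
   + 2 * sumsq_tail r)%R.
Proof.
move=> r0 sg4 k2 mC dC; set tl := sumsq_tail r.
have H1 := shifted_mixing1 r0 sg4 k2 mC dC.
have dC' : dep (predC J) (~` C).
  by move=> s s' ss'; rewrite /setC /= (dC _ _ ss').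
have H2 := shifted_mixing1 r0 sg4 k2 (measurableC mC) dC'.
rewrite probC// in H2.
have := probD_I mu mC measurable_shifted.
rewrite ler_norml; move: H1 H2; rewrite -/tl => H1 H2 E.
by apply/andP; split; lra.
Qed.

End mixing.

(** * Anticlustering: displacements that need not be small *)

Section anticlustering.
Context (R : realType) (I : choiceType).
Local Notation S := (seqspace R I).
Variable (mu : probability S R).
Hypothesis muP : iid_gauss mu.
Variables (W : seq I) (J : pred I) (h : I -> S -> R) (D0 : set S).
Hypothesis uW : uniq W.
Hypothesis WJ : forall i, i \in W -> J i.
Hypothesis mh : forall i, measurable_fun setT (h i).
Hypothesis dh : forall i, dep (predC J) (h i).
Hypothesis mD0 : measurable D0.
Hypothesis dD0 : dep J D0.

(** [hn] is the displacement caused by the coordinates in [V], and homogeneous in them; [hf] is the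
    one caused by the remoter past, and insensitive to [V]. *)
Variables (V : seq I) (hn hf : I -> S -> R) (K sg sf : R).
Hypothesis uV : uniq V.
Hypothesis VJ : forall i, i \in V -> ~~ J i.
Hypothesis mhn : forall i, measurable_fun setT (hn i).
Hypothesis dhn : forall i, dep (predC J) (hn i).
Hypothesis mhf : forall i, measurable_fun setT (hf i).
Hypothesis hE : forall i s, h i s = hn i s + hf i s.
Hypothesis hn_dilate : forall i c s, hn i (dilate V c s) = c * hn i s.
Hypothesis hf_dilate : forall i c s, hf i (dilate V c s) = hf i s.
Hypothesis K1 : 1 <= K.
Hypothesis hn_le : forall s, \sum_(i <- W) hn i s ^+ 2 <= K * sumsq V s.
Hypothesis sg0 : 0 < sg.
Hypothesis sf0 : 0 < sf.
Hypothesis hsub : forall i, i \in W -> subgauss mu sg (h i).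
Hypothesis hfsub : forall i, i \in W -> subgauss mu sf (hf i).

Local Notation D := (shifted W h D0).
Let mD : measurable D := @measurable_shifted R I W h D0 mh mD0.
(** Contracting the near coordinates by [lam] gains [t * sumsq V] to first order, while the
    quadratic losses sum to [t ^+ 2 * (K + 1) * sumsq V / 2]; this [t] makes them a quarter of the
    gain. *)
Let t : R := (2 * (K + 1))^-1.
Let lam : R := 1 - t.
Let K0 : 0 < K. Proof. exact: lt_le_trans K1. Qed.
Let t0 : 0 < t. Proof. by rewrite /t invr_gt0 mulr_gt0// addr_gt0. Qed.
Let t0' : 0 <= t := ltW t0.
Let K0' : 0 <= K := ltW K0.
Let tK : t * (K + 1) = 1 / 2.
Proof. by rewrite /t; field; rewrite gt_eqF// addr_gt0. Qed.
Let t4 : t <= 1 / 4. Proof. by have := tK; have := t0; have := K1; nra. Qed.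
Let lam0 : 0 < lam. Proof. by have := t4; rewrite /lam; lra. Qed.

Definition hsq (s : S) : R := \sum_(i <- W) h i s ^+ 2.

Lemma measurable_hsq : measurable_fun setT hsq.
Proof. by apply: measurable_sum => i; exact: measurable_funX. Qed.

Let m1 (A : set S) : measurable A ->
  measurable_fun setT (fun s => (\1_A s)%:E : \bar R).
Proof. by move=> mA; apply/measurable_EFinP; exact: measurable_indic. Qed.

Lemma measurable_gt_set (f : S -> R) c : measurable_fun setT f ->
  measurable [set s | c < f s].
Proof.
by move=> mf; rewrite -[X in measurable X]setTI; apply: measurable_fun_ltr.
Qed.

Lemma measurable_le_set (f : S -> R) c : measurable_fun setT f ->
  measurable [set s | f s <= c].
Proof.
by move=> mf; rewrite -[X in measurable X]setTI; apply: measurable_fun_ler.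
Qed.

Let hshift (g : I -> S -> R) i s : h i (shift W g s) = h i s.
Proof. by apply: dh => j /= Jj; rewrite /shift; case: ifPn => // /WJ; rewrite (negbTE Jj). Qed.

(** The dilation is applied to the whole event [D], not to the small one: [prob mu D] becomes the
    integral over [D] of a density which is at least [expR (t * rho / 4)] on the event considered,
    up to the Jacobian [lam ^+ size V]. *)
Lemma near_excess (rho : R) : 0 <= rho ->
  prob mu (D `&` [set s | rho < sumsq V s] `&` [set s | sumsq W s <= rho / (4 * K)]) <=
  (lam ^+ size V)^-1 * expR (- (t * rho / 4)) * prob mu D.
Proof.
move=> rho0; set A := _ `&` _ `&` _.
have mV := measurable_sumsq V; have mW := measurable_sumsq W.
have mA : measurable A.
  by apply: measurableI; [apply: measurableI => //; exact: measurable_gt_set|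
    exact: measurable_le_set].
pose e (s : S) : \bar R := (expR ((1 - lam ^+ 2) / 2 * sumsq V s))%:E.
have me : measurable_fun setT e.
  apply/measurable_EFinP; apply: measurableT_comp => //.
  by apply: measurable_funM => //; exact: measurable_sumsq.
(* After contraction the near displacement is [lam * hn = hn - t * hn]; displacing the window by
   [hm] without dilating [V] has the same effect on [D]. *)
pose hm i s := - t * hn i s.
pose G (s : S) : \bar R := ((\1_D s)%:E * e s)%E.
have mG : measurable_fun setT G by apply: emeasurable_funM => //; exact: m1.
have G0 s : (0 <= G s)%E by rewrite mule_ge0// lee_fin// expR_ge0.
have mhm i : measurable_fun setT (hm i) by exact: measurable_funM.
have E1 : ((prob mu D)%:E = (lam ^+ size V)%:E * \int[mu]_s G (shift W hm s))%E.
  rewrite -integral_1//.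
  have D10 (s : S) : (0 <= (\1_D s)%:E :> \bar R)%E by rewrite lee_fin.
  apply: etrans (integral_dilate muP uV lam0 (m1 mD) D10) _.
  apply: (congr1 (fun z => _ * z)%E); apply: eq_integral => s _.
  rewrite /G /e.
  have -> : sumsq V (shift W hm s) = sumsq V s.
    rewrite /sumsq !big_seq; apply: eq_bigr => i iV; rewrite /shift.
    by case: ifPn => // /WJ; rewrite (negbTE (VJ iV)).
  congr (_ * _)%E; rewrite !indicE; congr ((nat_of_bool _)%:R%:E).
  have DE : D (dilate V lam s) = D (shift W hm s); last first.
    by apply/idP/idP; rewrite !inE DE.
  apply: dD0 => i Ji.
  have iV : i \notin V by apply: contraL Ji; exact: VJ.
  rewrite /shift /dilate (negbTE iV); case: ifPn => // iW.
  rewrite -/(shift W hm s) hshift !hE -/(dilate V lam s) hn_dilate hf_dilate.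
  by rewrite /hm /lam; ring.
have E2 : (\int[mu]_s G (shift W hm s) =
   \int[mu]_s (G s * (expR (log_density W hm s))%:E))%E.
  apply: (integral_shift muP uW _ _ mG G0) => i iW //.
  move=> s s' ss'; rewrite /hm; congr (_ * _); apply: dhn => j /= Jj.
  by apply: ss'; apply: contra Jj; exact: WJ.
have E3 : ((expR (t * rho / 4) * prob mu A)%:E <= \int[mu]_s G (shift W hm s))%E.
  rewrite E2 EFinM -(integral_1 mu mA).
  rewrite -(@ge0_integralZl _ _ _ mu _ measurableT _ (m1 mA)); last 2 first.
  - by move=> s _; rewrite lee_fin.
  - by rewrite lee_fin expR_ge0.
  have mGl : measurable_fun setT (fun s => G s * (expR (log_density W hm s))%:E)%E.
    apply: (emeasurable_funM mG); apply/measurable_EFinP; apply: measurableT_comp => //.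
    exact: measurable_log_density.
  have Gl0 s : (0 <= G s * (expR (log_density W hm s))%:E)%E.
    by rewrite mule_ge0// lee_fin expR_ge0.
  have mkA := measurable_funeM (expR (t * rho / 4))%:E (m1 mA).
  apply: (ge0_le_integralT mu _ mkA mGl) => s.
    by rewrite mule_ge0// lee_fin ?expR_ge0.
  rewrite indicE; case: (boolP (s \in A)) => sA; last first.
    by rewrite mule0 mule_ge0// lee_fin expR_ge0.
  have : A s by rewrite inE in sA.
  move=> [[sD /= Vs] Ws].
  rewrite mule1 /G indicE mem_set// mul1e /e -EFinM lee_fin -expRD ler_expR.
  have : log_density W hm s >= - (t / (4 * K) + t ^+ 2 / 2) * (K * sumsq V s)
     - t * K * sumsq W s.
    apply: (@le_trans _ _ (- (t / (4 * K) + t ^+ 2 / 2) * (\sum_(i <- W) hn i s ^+ 2)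
     - t * K * sumsq W s)).
      rewrite lerD2r !mulNr lerN2 ler_wpM2l//.
      apply: addr_ge0; last by apply: divr_ge0; [exact: sqr_ge0|exact: ler0n].
      by apply: divr_ge0; [exact: t0'|apply: mulr_ge0; [exact: ler0n|exact: K0']].
    (* Cross terms are split so that the window coordinates receive the coefficient [t * K], matched
       by the bound [rho / (4 * K)] on their squared norm. *)
    rewrite /log_density /sumsq !mulr_sumr -sumrB; apply: ler_sum => i _.
    rewrite /hm -subr_ge0.
    have -> : - t * hn i s * s i - (- t * hn i s) ^+ 2 / 2 -
      (- (t / (4 * K) + t ^+ 2 / 2) * hn i s ^+ 2 - t * K * s i ^+ 2) =
      t * K * (s i - (2 * K)^-1 * hn i s) ^+ 2 by field; rewrite gt_eqF.
    by rewrite mulr_ge0 ?sqr_ge0// mulr_ge0.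
  have : K * sumsq W s <= sumsq V s / 4.
    apply: (@le_trans _ _ (K * (rho / (4 * K)))); first by rewrite ler_pM2l.
    rewrite (_ : K * (rho / (4 * K)) = rho / 4); last by field; rewrite gt_eqF.
    by rewrite ler_pM2r// ltW.
  have -> : - (t / (4 * K) + t ^+ 2 / 2) * (K * sumsq V s) =
     - (t * sumsq V s) / 4 - (t * (K + 1)) * (t * sumsq V s) / 2
     + t ^+ 2 * sumsq V s / 2 by field; rewrite gt_eqF.
  rewrite tK /lam.
  have -> : t * K * sumsq W s = t * (K * sumsq W s) by rewrite mulrA.
  have -> : (1 - (1 - t) ^+ 2) / 2 * sumsq V s =
    t * sumsq V s - t ^+ 2 * sumsq V s / 2 by field.
  move=> h1 h2.
  have : t * (K * sumsq W s) <= t * (sumsq V s / 4) by rewrite ler_pM2l.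
  have : t * rho <= t * sumsq V s by rewrite ler_pM2l// ltW.
  lra.
have lV : 0 < lam ^+ size V by rewrite exprn_gt0.
rewrite expRN -invfM ler_pdivlMl ?mulr_gt0 ?expR_gt0// -[X in X <= _]mulrA.
rewrite -lee_fin E1 EFinM; apply: (lee_wpmul2l _ E3).
by rewrite lee_fin ltW.
Qed.

Let M2 : R := 8 * expR (1 / 2).
(** Twice the bound on the mean of [hsq], so that Markov's inequality leaves probability at least
    1/2; adding 1 keeps it positive. *)
Definition hsq_bound : R := 2 * (size W)%:R * M2 * sg ^+ 2 + 1.

Lemma hsq_bound_gt0 : 0 < hsq_bound.
Proof.
rewrite /hsq_bound ltr_pwDr// mulr_ge0 ?sqr_ge0// /M2.
by rewrite mulr_ge0 ?mulr_ge0 ?expR_ge0// ler0n.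
Qed.

Lemma prob_hsq_le : 1 / 2 <= prob mu [set s | hsq s <= hsq_bound].
Proof.
have mle := measurable_le_set hsq_bound measurable_hsq.
have mgt := measurable_gt_set hsq_bound measurable_hsq.
have -> : [set s | hsq s <= hsq_bound] = ~` [set s | hsq_bound < hsq s].
  by apply/seteqP; split => s /=; rewrite leNgt => /negP.
rewrite probC//.
suff : hsq_bound * prob mu [set s | hsq_bound < hsq s] <= hsq_bound / 2.
  by rewrite ler_pM2l ?hsq_bound_gt0//; lra.
apply: (@le_trans _ _ ((size W)%:R * M2 * sg ^+ 2)); last first.
  by rewrite /hsq_bound; lra.
rewrite -lee_fin EFinM -(integral_1 mu mgt).
rewrite -(@ge0_integralZl _ _ _ mu _ measurableT _ (m1 mgt)); last 2 first.
- by move=> s _; rewrite lee_fin.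
- by rewrite lee_fin ltW ?hsq_bound_gt0.
have mq : measurable_fun setT (fun s => (hsq s)%:E).
  by apply/measurable_EFinP; exact: measurable_hsq.
apply: (@le_trans _ _ (\int[mu]_s (hsq s)%:E)%E).
  apply: (ge0_le_integralT mu _ (measurable_funeM _ (m1 mgt)) mq) => s.
    by rewrite mule_ge0 ?lee_fin// ltW ?hsq_bound_gt0.
  rewrite -EFinM lee_fin indicE; case: (boolP (_ \in _)) => [|_].
    by rewrite inE/= mulr1 => /ltW.
  by rewrite mulr0 sumr_ge0// => i _; exact: sqr_ge0.
under eq_integral do rewrite /hsq -sumEFin.
rewrite ge0_integral_sum//; last 2 first.
- by move=> i; exact/measurable_EFinP/measurable_funX.
- by move=> i b _; rewrite lee_fin sqr_ge0.
rewrite (_ : (size W)%:R * M2 * sg ^+ 2 = \sum_(i <- W) M2 * sg ^+ 2); last first.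
  by rewrite big_const_seq count_predT iter_addr_0 -[RHS]mulr_natl mulrA.
rewrite -sumEFin !big_seq; apply: lee_sum => i iW.
exact: (subgauss_sqr sg0 (mh i) (hsub iW)).
Qed.

(** Joint and marginal probabilities are both compared with the centred event [B], which is
    independent of [F]. The density is at most [expR (k2 / 2)] for the former; for the latter it is
    at least [expR (- hsq_bound - k2 / 2)] on an event of probability at least 1/2. *)
Lemma shifted_far (e0 k1 : R) (F : set S) : 0 <= e0 -> 0 <= k1 ->
  measurable F -> dep (predC J) F ->
  prob mu (F `&` D `&` ([set s | hsq s <= k1] `&` [set s | sumsq W s <= e0])) <=
  2 * expR (hsq_bound + 2 * (e0 + k1)) * prob mu F * prob mu D.
Proof.
move=> e00 k10 mF dF; set X := _ `&` _ `&` _.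
(* If the window has squared norm at most [e0] and its displacement at most [k1], the displaced
   window has at most [2 * (e0 + k1)]. *)
pose k2 := 2 * (e0 + k1).
pose B := D0 `&` [set s | sumsq W s <= k2].
have mW := measurable_sumsq W.
have mB : measurable B by apply: measurableI => //; exact: measurable_le_set.
have mld : measurable_fun setT (fun s => (expR (log_density W h s))%:E : \bar R).
  apply/measurable_EFinP; apply: measurableT_comp => //.
  exact: measurable_log_density.
have mX : measurable X.
  by apply: measurableI; [exact: measurableI|apply: measurableI;
    apply: measurable_le_set => //; exact: measurable_hsq].
have dB : dep J B.
  move=> s s' ss'; rewrite /B /setI/= (dD0 ss').
  rewrite (_ : sumsq W s = sumsq W s')// /sumsq !big_seq.
  by apply: eq_bigr => i /WJ Ji; rewrite ss'.
have dH k : dep (predC J) [set s | hsq s <= k].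
  move=> s s' ss' /=; rewrite (_ : hsq s = hsq s')// /hsq.
  by apply: eq_bigr => i _; congr (_ ^+ 2); exact: dh.
have hsq_shift s : hsq (shift W h s) = hsq s.
  by rewrite /hsq; apply: eq_bigr => i _; rewrite hshift.
have upper : prob mu X <= expR (k2 / 2) * (prob mu F * prob mu B).
  have -> : prob mu F * prob mu B = prob mu (B `&` F).
    apply: EFin_inj; rewrite mulrC EFinM -!probE//; last exact: measurableI.
    exact/esym/(measure_dep muP mB mF dB dF).
  rewrite -lee_fin EFinM -(integral_1 mu mX).
  pose Q := F `&` D0 `&` [set s | hsq s <= k1] `&`
    [set s | \sum_(i <- W) (s i - h i s) ^+ 2 <= e0].
  have mQ : measurable Q.
    apply: measurableI; last first.
      apply: measurable_le_set; apply: measurable_sum => i; apply: measurable_funX.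
      by apply: measurable_funB => //; exact: measurable_coord.
    apply: measurableI; first exact: measurableI.
    by apply: measurable_le_set; exact: measurable_hsq.
  have -> : (\int[mu]_s (\1_X s)%:E = \int[mu]_s (\1_Q (shift W h s))%:E)%E.
    apply: eq_integral => s _; rewrite !indicE; congr ((nat_of_bool _)%:R%:E).
    have E1 : \sum_(i <- W) (shift W h s i - h i (shift W h s)) ^+ 2 = sumsq W s.
      rewrite /sumsq !big_seq; apply: eq_bigr => i iW.
      by rewrite hshift {1}/shift iW addrK.
    have E2 : F (shift W h s) = F s.
      apply: dF => j /= Jj; rewrite /shift; case: ifPn => // /WJ.
      by rewrite (negbTE Jj).
    apply/idP/idP; rewrite !inE.
      by move=> [[? ?] [? ?]]; split => /=; [split;[split|]|]; rewrite ?E2 ?hsq_shift ?E1.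
    move=> [[[? ?] ?] ?]; split; split => //=; [by rewrite -E2|by rewrite -hsq_shift|by rewrite -E1].
  have Q0 (s : S) : (0 <= (\1_Q s)%:E :> \bar R)%E by rewrite lee_fin.
  rewrite (integral_shifted muP uW WJ mh dh (m1 mQ) Q0).
  have mBF : measurable (B `&` F) by exact: measurableI.
  rewrite -(integral_1 mu mBF).
  rewrite -(@ge0_integralZl _ _ _ mu _ measurableT _ (m1 mBF)); last 2 first.
  - by move=> s _; rewrite lee_fin.
  - by rewrite lee_fin expR_ge0.
  apply: (ge0_le_integralT mu _ (emeasurable_funM (m1 mQ) mld) (measurable_funeM _ (m1 mBF))) => s.
    by rewrite mule_ge0// lee_fin expR_ge0.
  rewrite !indicE; case: (boolP (s \in Q)) => sQ; last first.
    by rewrite mul0e mule_ge0 ?lee_fin ?expR_ge0.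
  have [[[Fs Ds] /= hs] es] : Q s by rewrite inE in sQ.
  have Ws : sumsq W s <= k2.
    apply: (@le_trans _ _ (2 * (\sum_(i <- W) (s i - h i s) ^+ 2 + hsq s))).
      rewrite /hsq -big_split/= mulr_sumr; apply: ler_sum => i _.
      have := sqr_ge0 (s i - h i s - h i s); lra.
    by rewrite /k2 ler_pM2l// lerD.
  rewrite mem_set; last by split.
  rewrite mul1e mule1 lee_fin ler_expR.
  apply: le_trans (_ : sumsq W s / 2 <= _); last by rewrite ler_pM2r.
  rewrite /sumsq mulr_suml; apply: ler_sum => i _.
  have := sqr_ge0 (s i - h i s); lra.
have lower : expR (- hsq_bound - k2 / 2) * (prob mu B / 2) <= prob mu D.
  pose H0 := [set s | hsq s <= hsq_bound].
  have mH0 : measurable H0 by apply: measurable_le_set; exact: measurable_hsq.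
  have mBH : measurable (B `&` H0) by exact: measurableI.
  apply: (@le_trans _ _ (expR (- hsq_bound - k2 / 2) * prob mu (B `&` H0))).
    rewrite ler_pM2l ?expR_gt0//.
    have -> : prob mu (B `&` H0) = prob mu B * prob mu H0.
      apply: EFin_inj; rewrite EFinM -!probE//.
      exact: (measure_dep muP mB mH0 dB (dH _)).
    by rewrite ler_wpM2l ?prob_ge0//; have := prob_hsq_le; rewrite -/H0; lra.
  rewrite -lee_fin EFinM -(integral_1 mu mBH) -(integral_1 mu mD).
  have -> : (\int[mu]_s (\1_D s)%:E = \int[mu]_s (\1_D0 (shift W h s))%:E)%E.
    by [].
  have D00 (s : S) : (0 <= (\1_D0 s)%:E :> \bar R)%E by rewrite lee_fin.
  rewrite (integral_shifted muP uW WJ mh dh (m1 mD0) D00).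
  rewrite -(@ge0_integralZl _ _ _ mu _ measurableT _ (m1 mBH)); last 2 first.
  - by move=> s _; rewrite lee_fin.
  - by rewrite lee_fin expR_ge0.
  apply: (ge0_le_integralT mu _ (measurable_funeM _ (m1 mBH)) (emeasurable_funM (m1 mD0) mld)) => s.
    by rewrite mule_ge0// lee_fin ?expR_ge0.
  rewrite !indicE; case: (boolP (s \in _)) => sQ; last first.
    by rewrite mule0 mule_ge0 ?lee_fin ?expR_ge0.
  have [[Ds /= Ws] hs] : (B `&` H0) s by rewrite inE in sQ.
  rewrite mem_set// mul1e mule1 lee_fin ler_expR.
  apply: (@le_trans _ _ (- hsq s - sumsq W s / 2)).
    by apply: lerB; rewrite ?lerN2 ?ler_pM2r.
  rewrite /hsq /sumsq /log_density mulr_suml -sumrN -sumrB; apply: ler_sum => i _.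
  have := sqr_ge0 (s i + h i s); lra.
apply: (le_trans upper).
have e1 : expR (hsq_bound + k2) = expR (k2 / 2) * expR (hsq_bound + k2 / 2).
  by rewrite -expRD; congr expR; lra.
have e2 : expR (- hsq_bound - k2 / 2) * expR (hsq_bound + k2 / 2) = 1.
  by rewrite -expRD [X in expR X](_ : _ = 0) ?expR0//; lra.
have : prob mu B <= 2 * expR (hsq_bound + k2 / 2) * prob mu D.
  have := ler_wpM2l (expR_ge0 (hsq_bound + k2 / 2)) lower.
  have -> : expR (hsq_bound + k2 / 2) * (expR (- hsq_bound - k2 / 2) * (prob mu B / 2)) =
     expR (- hsq_bound - k2 / 2) * expR (hsq_bound + k2 / 2) * (prob mu B / 2) by ring.
  by rewrite e2; lra.
rewrite -/k2 e1 => le.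
have -> : 2 * (expR (k2 / 2) * expR (hsq_bound + k2 / 2)) * prob mu F * prob mu D =
  expR (k2 / 2) * (prob mu F * (2 * expR (hsq_bound + k2 / 2) * prob mu D)) by ring.
by rewrite ler_pM2l ?expR_gt0// ler_wpM2l ?prob_ge0.
Qed.

(* The displacement [h = hn + hf] is large only if [hf] is, or if the sum of
   squares of the near coordinates [V] is. In the second case either the new
   window coordinates are large too (first term), or [V] may be contracted by
   [lam = 1 - t] at the price of the density [expR (- (t * rho ^+ 2 / 4))], the
   change of [t * hn] being undone by Cameron-Martin (third term). Otherwise [h]
   is at most of order [rho] and the densities are bounded (last term). *)
Lemma shifted_anticluster (rho : R) (F : set S) : 0 <= rho ->
  measurable F -> dep (predC J) F ->
  prob mu (F `&` D) <=
    prob mu F * (2 ^+ size W * expR (- (rho ^+ 2 / (16 * K))))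
  + (size W)%:R * (2 * expR (- (rho ^+ 2 / (2 * sf ^+ 2))))
  + (lam ^+ size V)^-1 * expR (- (t * rho ^+ 2 / 4)) * prob mu D
  + 2 * expR (hsq_bound + 2 * (rho ^+ 2 / (4 * K) + 2 * (K + (size W)%:R) * rho ^+ 2))
    * prob mu F * prob mu D.
Proof.
move=> rho0 mF dF.
pose e0 := rho ^+ 2 / (4 * K); pose k1 := 2 * (K + (size W)%:R) * rho ^+ 2.
have e00 : 0 <= e0 by rewrite /e0 divr_ge0 ?sqr_ge0// mulr_ge0.
have k10 : 0 <= k1 by rewrite /k1 mulr_ge0 ?sqr_ge0// mulr_ge0// addr_ge0.
have mW := measurable_sumsq W; have mV := measurable_sumsq V.
pose A1 := [set s : S | e0 < sumsq W s].
pose A2 := \big[setU/set0]_(i <- W) [set s | rho < `|hf i s|].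
pose A3 := D `&` [set s | rho ^+ 2 < sumsq V s] `&` [set s | sumsq W s <= e0].
pose A4 := F `&` D `&` ([set s | hsq s <= k1] `&` [set s | sumsq W s <= e0]).
have mA1 : measurable A1 by exact: measurable_gt_set.
have mAi i : measurable [set s | rho < `|hf i s|].
  by apply: measurable_gt_set; exact: measurableT_comp.
have mA2 : measurable A2 by exact: bigsetU_measurable.
have mA3 : measurable A3.
  by apply: measurableI; [apply: measurableI => //; exact: measurable_gt_set|
    exact: measurable_le_set].
have mA4 : measurable A4.
  by apply: measurableI; [exact: measurableI|apply: measurableI;
    apply: measurable_le_set => //; exact: measurable_hsq].
have mFA1 : measurable (F `&` A1) by exact: measurableI.
have cover : F `&` D `<=` (F `&` A1) `|` A2 `|` A3 `|` A4.
  move=> s [Fs Ds].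
  have [We|We] := ltP e0 (sumsq W s); first by left; left; left.
  have [Vr|Vr] := ltP (rho ^+ 2) (sumsq V s); first by left; right.
  have [/hasP[i iW hi]|/hasPn hi] := boolP (has (fun i => rho < `|hf i s|) W).
    left; left; right; rewrite /A2 -bigcup_seq; by exists i.
  right; split => //; split => //=; rewrite /hsq.
  apply: (@le_trans _ _ (\sum_(i <- W) (2 * hn i s ^+ 2 + 2 * hf i s ^+ 2))).
    apply: ler_sum => i _; rewrite hE; have := sqr_ge0 (hn i s - hf i s); lra.
  rewrite big_split/= -!mulr_sumr /k1.
  have h1 : \sum_(i <- W) hn i s ^+ 2 <= K * rho ^+ 2.
    by apply: (le_trans (hn_le s)); rewrite ler_pM2l.
  have h2 : \sum_(i <- W) hf i s ^+ 2 <= (size W)%:R * rho ^+ 2.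
    have -> : (size W)%:R * rho ^+ 2 = \sum_(i <- W) rho ^+ 2.
      by rewrite big_const_seq count_predT iter_addr_0 -[RHS]mulr_natl.
    rewrite !big_seq; apply: ler_sum => i iW.
    have := hi _ iW; rewrite -leNgt => hir.
    by rewrite -[leLHS]real_normK ?num_real// ler_sqr ?nnegrE.
  lra.
have mU1 := measurableU _ _ mFA1 mA2; have mU2 := measurableU _ _ mU1 mA3.
have mU3 := measurableU _ _ mU2 mA4.
apply: (le_trans (le_prob mu (measurableI _ _ mF mD) mU3 cover)).
apply: (le_trans (probU_le mu mU2 mA4)); apply: lerD; last exact: shifted_far.
apply: (le_trans (probU_le mu mU1 mA3)); apply: lerD; last first.
  exact: (near_excess (sqr_ge0 rho)).
apply: (le_trans (probU_le mu mFA1 mA2)); apply: lerD.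
  have -> : prob mu (F `&` A1) = prob mu A1 * prob mu F.
    apply: EFin_inj; rewrite EFinM -!probE// setIC.
    apply: (measure_dep muP mA1 mF _ dF) => s s' ss'.
    rewrite /A1 /= (_ : sumsq W s = sumsq W s')// /sumsq !big_seq.
    by apply: eq_bigr => i /WJ Ji; rewrite ss'.
  rewrite mulrC ler_wpM2l ?prob_ge0//.
  apply: (le_trans (prob_sumsq_gt muP uW e00)).
  by rewrite /e0 [X in expR (- X)](_ : _ = rho ^+ 2 / (16 * K))//; field; rewrite gt_eqF.
apply: (le_trans (prob_bigU_le mu W mAi)).
have -> : (size W)%:R * (2 * expR (- (rho ^+ 2 / (2 * sf ^+ 2)))) =
    \sum_(i <- W) (2 * expR (- (rho ^+ 2 / (2 * sf ^+ 2)))).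
  by rewrite big_const_seq count_predT iter_addr_0 -[RHS]mulr_natl.
rewrite !big_seq; apply: ler_sum => i iW.
exact: (subgauss_tail sf0 rho0 (mhf i) (hfsub iW)).
Qed.

End anticlustering.

Section sums.
Context (R : realType).

(** Jensen's inequality, from the tangent to the exponential at the mean. *)
Lemma expR_sum_le (I : eqType) (s : seq I) (x : I -> R) : s != [::] ->
  expR (\sum_(r <- s) x r) <= (size s)%:R^-1 * \sum_(r <- s) expR ((size s)%:R * x r).
Proof.
move=> s0; have n0 : 0 < (size s)%:R :> R by rewrite ltr0n lt0n size_eq0.
set m := \sum_(r <- s) x r; rewrite ler_pdivlMl//.
have : \sum_(r <- s) (expR m * (1 + ((size s)%:R * x r - m))) <=
  \sum_(r <- s) expR ((size s)%:R * x r).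
  apply: ler_sum => r _.
  apply: (@le_trans _ _ (expR m * expR ((size s)%:R * x r - m))).
    by rewrite ler_pM2l ?expR_gt0// expR_ge1Dx.
  by rewrite -expRD addrC subrK.
rewrite -mulr_sumr big_split/= sumrB -mulr_sumr -/m.
rewrite !big_const_seq !count_predT !iter_addr_0 -(mulr_natl m).
by rewrite subrr addr0 mulrC.
Qed.

Lemma sqr_sum_le (I : Type) (s : seq I) (x : I -> R) :
  (\sum_(r <- s) x r) ^+ 2 <= (size s)%:R * \sum_(r <- s) x r ^+ 2.
Proof.
elim: s => [|a s IH]; first by rewrite !big_nil expr0n/= mul0r.
rewrite !big_cons /=; set S1 := \sum_(j <- s) x j; set S2 := \sum_(j <- s) _.
have : 2 * (x a * S1) <= (size s)%:R * x a ^+ 2 + S2.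
  rewrite /S1 /S2 mulr_sumr mulr_sumr.
  have -> : (size s)%:R * x a ^+ 2 = \sum_(r <- s) x a ^+ 2.
    by rewrite big_const_seq count_predT iter_addr_0 -[RHS]mulr_natl.
  rewrite -big_split /=; apply: ler_sum => r _.
  have := sqr_ge0 (x a - x r); lra.
move: IH; rewrite -/S1 -/S2 -addn1 natrD; lra.
Qed.

Lemma cauchy_schwarz (I : Type) (s : seq I) (a x : I -> R) :
  (\sum_(r <- s) a r * x r) ^+ 2 <=
  (\sum_(r <- s) a r ^+ 2) * \sum_(r <- s) x r ^+ 2.
Proof.
set A := \sum_(r <- s) a r ^+ 2; set C := \sum_(r <- s) x r ^+ 2.
set B := \sum_(r <- s) a r * x r.
have A0 : 0 <= A by apply: sumr_ge0 => r _; exact: sqr_ge0.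
have H y : 0 <= C - 2 * y * B + y ^+ 2 * A.
  have -> : C - 2 * y * B + y ^+ 2 * A = \sum_(r <- s) (x r - y * a r) ^+ 2.
    rewrite /A /B /C !mulr_sumr -sumrB -big_split/=; apply: eq_bigr => r _; ring.
  by apply: sumr_ge0 => r _; exact: sqr_ge0.
have [A00|A00] := eqVneq A 0.
  have [B0|B0] := eqVneq B 0; first by rewrite B0 A00 expr0n mul0r.
  (* With [A = 0] the quadratic is affine in [y], and this [y] makes it equal to -1. *)
  have := H ((C + 1) / (2 * B)); rewrite A00 mulr0 addr0.
  have -> : 2 * ((C + 1) / (2 * B)) * B = C + 1 by field.
  lra.
have Agt : 0 < A by rewrite lt_neqAle eq_sym A00.
have := H (B / A).
have -> : C - 2 * (B / A) * B + (B / A) ^+ 2 * A = C - B ^+ 2 / A by field.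
by rewrite subr_ge0 ler_pdivrMr// mulrC.
Qed.

End sums.

Section subgauss_lin.
Context d (T : measurableType d) (R : realType) (P : probability T R).

Lemma subgauss_le (s1 s2 : R) (Z : T -> R) : 0 <= s1 -> s1 <= s2 ->
  subgauss P s1 Z -> subgauss P s2 Z.
Proof.
move=> s10 s12 h t; apply: (le_trans (h t)); rewrite lee_fin ler_expR.
rewrite ler_pM2r ?invr_gt0// ler_wpM2l ?sqr_ge0// ler_sqr// nnegrE//.
exact: le_trans s12.
Qed.

(** Jensen replaces independence: the price is the factor [size s] on [sg], harmless since the sums
    range over windows of fixed size. *)
Lemma mgf_sum (I : eqType) (s : seq I) (Z : I -> T -> R) (a : I -> R) (sg : R) :
  (forall r, measurable_fun setT (Z r)) ->
  (forall r, r \in s -> subgauss P sg (Z r)) ->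
  (\int[P]_x (expR (\sum_(r <- s) a r * Z r x))%:E <=
   (expR (((size s)%:R * sg) ^+ 2 / 2 * \sum_(r <- s) a r ^+ 2))%:E)%E.
Proof.
move=> mZ hZ; have [->|s0] := eqVneq s [::].
  under eq_integral do rewrite big_nil expR0.
  by rewrite integral_cst//= mul1e probability_setT lee_fin -[leLHS]expR0 ler_expR big_nil mulr0.
have n0 : 0 < (size s)%:R :> R by rewrite ltr0n lt0n size_eq0.
have me r : measurable_fun setT (fun x => (expR ((size s)%:R * (a r * Z r x)))%:E).
  apply/measurable_EFinP; apply: measurableT_comp => //.
  by apply: measurable_funM => //; exact: measurable_funM.
have ms : measurable_fun setT (fun x => (\sum_(r <- s) (expR ((size s)%:R * (a r * Z r x)))%:E)%E).
  exact: emeasurable_sum.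
apply: (@le_trans _ _ (\int[P]_x ((size s)%:R^-1%:E *
    \sum_(r <- s) (expR ((size s)%:R * (a r * Z r x)))%:E))%E).
  apply: ge0_le_integralT => [x||| x].
  - by rewrite lee_fin expR_ge0.
  - apply/measurable_EFinP; apply: measurableT_comp => //; apply: measurable_sum => r.
    exact: measurable_funM.
  - exact: measurable_funeM.
  - by rewrite sumEFin -EFinM lee_fin expR_sum_le.
rewrite (@ge0_integralZl _ _ _ P _ measurableT _ ms); last 2 first.
- by move=> x _; apply: sume_ge0 => r _; rewrite lee_fin expR_ge0.
- by rewrite lee_fin invr_ge0 ltW.
rewrite ge0_integral_sum//.
set M := expR _.
apply: (@le_trans _ _ ((size s)%:R^-1%:E * \sum_(r <- s) M%:E)%E).
  apply: lee_wpmul2l; first by rewrite lee_fin invr_ge0 ltW.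
  rewrite !big_seq; apply: lee_sum => r rs.
  under eq_integral do rewrite mulrA.
  apply: (le_trans (hZ r rs _)); rewrite lee_fin /M ler_expR.
  have -> : ((size s)%:R * a r) ^+ 2 * sg ^+ 2 / 2 =
    ((size s)%:R * sg) ^+ 2 / 2 * a r ^+ 2 by ring.
  apply: ler_wpM2l; first by rewrite divr_ge0 ?sqr_ge0.
  rewrite (big_rem r)//= lerDl; apply: sumr_ge0 => j _; exact: sqr_ge0.
rewrite sumEFin big_const_seq count_predT iter_addr_0 -EFinM lee_fin.
by rewrite -(mulr_natl M) mulrA mulVf ?mul1r// gt_eqF.
Qed.

Lemma subgauss_sum (I : eqType) (s : seq I) (Z : I -> T -> R) (a : I -> R) (sg B : R) :
  (forall r, measurable_fun setT (Z r)) ->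
  (forall r, r \in s -> subgauss P sg (Z r)) ->
  (forall r, a r ^+ 2 <= B ^+ 2) ->
  subgauss P ((size s)%:R * sg * (size s)%:R * B) (fun x => \sum_(r <- s) a r * Z r x).
Proof.
move=> mZ hZ aB t.
under eq_integral do rewrite mulr_sumr; under eq_integral do under eq_bigr do rewrite mulrA.
apply: (le_trans (mgf_sum _ mZ hZ)); rewrite lee_fin ler_expR.
have n0 : 0 <= (size s)%:R :> R by rewrite ler0n.
have le1 : \sum_(r <- s) (t * a r) ^+ 2 <= t ^+ 2 * ((size s)%:R * B) ^+ 2.
  apply: (@le_trans _ _ (\sum_(r <- s) (t ^+ 2 * B ^+ 2))).
    by apply: ler_sum => r _; rewrite exprMn ler_wpM2l ?sqr_ge0.
  rewrite big_const_seq count_predT iter_addr_0 -[leLHS]mulr_natl mulrCA.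
  rewrite ler_wpM2l ?sqr_ge0// exprMn ler_wpM2r ?sqr_ge0// -natrX ler_nat.
  by case: (size s) => // n; rewrite -mulnn leq_pmulr.
have -> : t ^+ 2 * ((size s)%:R * sg * (size s)%:R * B) ^+ 2 / 2 =
  ((size s)%:R * sg) ^+ 2 / 2 * (t ^+ 2 * ((size s)%:R * B) ^+ 2) by ring.
by rewrite ler_wpM2l// divr_ge0 ?sqr_ge0.
Qed.

Lemma subgauss_lim (Zn : nat -> T -> R) (Z : T -> R) (sg : R) :
  (forall n, measurable_fun setT (Zn n)) -> measurable_fun setT Z ->
  (forall n, subgauss P sg (Zn n)) ->
  {ae P, forall x, Zn n x @[n --> \oo] --> Z x} -> subgauss P sg Z.
Proof.
move=> mZn mZ hZn cv t.
pose f n x := (expR (t * Zn n x))%:E.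
have mf n : measurable_fun setT (f n).
  by apply/measurable_EFinP; apply: measurableT_comp => //; exact: measurable_funM.
have mfl : measurable_fun setT (fun x => limn_einf (f ^~ x)).
  rewrite (_ : (fun x => _) = (fun x => - limn_esup (fun n => - f n x))%E); last first.
    by apply/funext => x; rewrite limn_esupN oppeK.
  apply: measurableT_comp => //; apply: measurable_fun_limn_esup => n.
  exact: measurableT_comp.
apply: (@le_trans _ _ (\int[P]_x limn_einf (f ^~ x))%E); last first.
  apply: le_trans (@fatou _ _ _ P setT measurableT f mf _) _.
    by move=> n x _; rewrite lee_fin expR_ge0.
  rewrite limn_einf_lim; apply: lime_le.
    exact: is_cvg_einfs.
  apply: nearW => n; apply: (@le_trans _ _ (\int[P]_x f n x)%E); last exact: hZn.
  by apply: ereal_inf_lbound; exists n => /=.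
rewrite le_eqVlt; apply/orP; left; apply/eqP; apply: ge0_ae_eq_integral => //.
- apply/measurable_EFinP; apply: measurableT_comp => //; exact: measurable_funM.
- move=> x _; rewrite limn_einf_lim; apply: lime_ge; first exact: is_cvg_einfs.
  apply: nearW => n; apply: le_ereal_inf_tmp => _ [m /= nm <-].
  by rewrite lee_fin expR_ge0.
move: cv; apply: filterS => x cvx _.
have := cvg_limn_einf_sup (u := f ^~ x) (l := (expR (t * Z x))%:E).
case=> //; apply: cvg_EFin; first by apply: nearW.
rewrite /f /comp /=.
apply: (@continuous_cvg _ _ _ _ _ _ (@expR R)); first exact: continuous_expR.
by apply: cvgMr; exact: cvx.
Qed.

End subgauss_lin.
(** * Linear processes *)

Section inverse_filter.
Context (R : realType) (d0 : nat) (Psi : nat -> 'M[R]_d0).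
Hypothesis Psi0 : Psi 0%N \in unitmx.

(* The power series inverse of [Psi], computed up to degree [n]. *)
Fixpoint inv_filter_upto (n : nat) : nat -> 'M[R]_d0 :=
  if n is n'.+1 then fun m =>
    if m == n then - (invmx (Psi 0%N) *m
      \sum_(l < n) Psi l.+1 *m inv_filter_upto n' (n' - l)%N)
    else inv_filter_upto n' m
  else fun=> invmx (Psi 0%N).

(** Course-of-values recursion: [inv_filter_upto n] is a table whose entries up to [n] are final,
    and the [n]-th one is read off here. *)
Definition inv_filter n := inv_filter_upto n n.

Lemma inv_filter_upto_le n m : (m <= n)%N -> inv_filter_upto n m = inv_filter m.
Proof.
elim: n => [|n IH]; first by rewrite leqn0 => /eqP ->.
by rewrite leq_eqVlt => /predU1P[->//|]; rewrite ltnS => mn /=; rewrite ltn_eqF ?ltnS// IH.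
Qed.

Lemma inv_filterP n :
  \sum_(l < n.+1) Psi l *m inv_filter (n - l) = (if n == 0%N then 1%:M else 0).
Proof.
rewrite big_ord_recl subn0; case: n => [|n] /=.
  by rewrite big_ord0 addr0 /inv_filter/= mulmxV.
rewrite {1}/inv_filter /= eqxx mulmxN mulmxA mulmxV// mul1mx.
rewrite addrC; apply/eqP; rewrite subr_eq0; apply/eqP; apply: eq_bigr => l _.
by rewrite /bump leq0n add1n subSS inv_filter_upto_le// leq_subr.
Qed.

End inverse_filter.

Section process.
Context (R : realType) (d0 : nat) (Psi : nat -> 'M[R]_d0).
Local Notation I := ((int * 'I_d0)%type : choiceType).
Local Notation S := (seqspace R I).

Definition innov (k : int) (s : S) : 'cV[R]_d0 := \col_j s (k, j).

Definition partial (k : int) (N : nat) (s : S) : 'cV[R]_d0 :=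
  \sum_(l < N) Psi l *m innov (k - l%:Z) s.

(* [limn_esup] makes [Xh] total and measurable; it is the limit when there is one. *)
Definition Xh (k : int) (s : S) : 'cV[R]_d0 :=
  \col_i fine (limn_esup (fun N => (partial k N s i 0)%:E)).

Definition converges (s : S) := forall k i, cvgn (fun N => partial k N s i 0).

Definition restr (J : pred I) (s : S) : S := fun c => if J c then s c else 0.

Lemma measurable_partial k N i : measurable_fun setT (fun s => partial k N s i 0).
Proof.
rewrite (_ : (fun s => _) = (fun s : S => \sum_(l < N) \sum_j Psi l i j * s (k - l%:Z, j))).
  apply: measurable_sum => l; apply: measurable_sum => j.
  by apply: measurable_funM => //; exact: measurable_coord.
apply/funext => s; rewrite /partial summxE; apply: eq_bigr => l _.
by rewrite mxE; apply: eq_bigr => j _; rewrite mxE.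
Qed.

Lemma measurable_Xh k i : measurable_fun setT (fun s => Xh k s i 0).
Proof.
rewrite (_ : (fun s => _) = (fun s => fine (limn_esup (fun N => (partial k N s i 0)%:E)))).
  apply: measurableT_comp => //; apply: measurable_fun_limn_esup => N.
  by apply/measurable_EFinP; exact: measurable_partial.
by apply/funext => s; rewrite mxE.
Qed.

Lemma measurable_restr J : measurable_fun setT (restr J).
Proof.
apply: measurable_seqspace => i; rewrite /restr; case: (J i) => //.
exact: measurable_coord.
Qed.

Lemma Xh_lim k s i (x : R) : partial k N s i 0 @[N --> \oo] --> x -> Xh k s i 0 = x.
Proof.
move=> cx; rewrite mxE.
have cE : (partial k N s i 0)%:E @[N --> \oo] --> x%:E.
  by apply: cvg_EFin; first exact: nearW.
by have [_ ->] := cvg_limn_einf_sup cE.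
Qed.

Lemma partialD k N s s' : partial k N (fun c => s c + s' c) = partial k N s + partial k N s'.
Proof.
rewrite -big_split; apply: eq_bigr => l _; rewrite /= -mulmxDr; congr (_ *m _).
by apply/matrixP => a b; rewrite !mxE.
Qed.

Lemma restrD J s : s = (fun c => restr J s c + restr (predC J) s c).
Proof. by apply/funext => c; rewrite /restr /=; case: (J c); rewrite ?addr0 ?add0r. Qed.

Lemma restr_restr J J' s : restr J (restr J' s) = restr (predI J J') s.
Proof. by apply/funext => c; rewrite /restr /=; case: (J c); case: (J' c). Qed.

Definition future (tau : int) : pred I := fun c => tau <= c.1.

(* Only finitely many lags see the innovations after time [tau]. *)
Lemma partial_future k tau N s : (`|k - tau| < N)%N ->
  partial k N (restr (future tau) s) = partial k (`|k - tau|).+1 (restr (future tau) s).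
Proof.
move=> /subnKC <-; elim: (N - _)%N => [|n IH]; first by rewrite addn0.
rewrite addnS {1}/partial big_ord_recr/= -/(partial _ _ _) IH.
rewrite [X in _ + _ *m X](_ : _ = 0) ?mulmx0 ?addr0//.
apply/matrixP => a b; rewrite !mxE /restr /future /=.
by case: ifPn => //; lia.
Qed.

Lemma cvg_future k tau s i :
  partial k N (restr (future tau) s) i 0 @[N --> \oo] -->
  partial k (`|k - tau|).+1 (restr (future tau) s) i 0.
Proof.
apply: cvg_near_cst; exists (`|k - tau|).+1 => // N /= hN.
by rewrite partial_future.
Qed.

Lemma cvg_past k tau s i : converges s ->
  cvgn (fun N => partial k N (restr (predC (future tau)) s) i 0).
Proof.
move=> cs.
have cD : cvgn (fun N => partial k N (fun c => restr (future tau) s c +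
    restr (predC (future tau)) s c) i 0) by rewrite -restrD; exact: cs.
rewrite (_ : (fun N => _) = (fun N => partial k N (fun c => restr (future tau) s c +
    restr (predC (future tau)) s c) i 0 - partial k N (restr (future tau) s) i 0)).
  apply: is_cvgB; first exact: cD.
  exact: (cvgP _ (@cvg_future k tau s i)).
by apply/funext => N; rewrite partialD mxE addrC addrK.
Qed.

Lemma XhD k s s' : (forall i, cvgn (fun N => partial k N s i 0)) ->
  (forall i, cvgn (fun N => partial k N s' i 0)) ->
  Xh k (fun c => s c + s' c) = Xh k s + Xh k s'.
Proof.
move=> c1 c2; apply/matrixP => i j; rewrite ord1 [RHS]mxE.
have /cvg_ex[x cx] := c1 i; have /cvg_ex[y cy] := c2 i.
rewrite (Xh_lim cx) (Xh_lim cy); apply: Xh_lim.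
under eq_fun do rewrite partialD mxE.
exact: cvgD.
Qed.

Lemma Xh_dep k s s' : (forall c, (c.1 <= k) -> s c = s' c) -> Xh k s = Xh k s'.
Proof.
move=> ss'; apply/matrixP => i j; rewrite !mxE; congr (fine (limn_esup _)).
apply/funext => N; congr (_%:E); congr ((_ : 'cV_d0) i 0); apply: eq_bigr => l _.
congr (_ *m _); apply/matrixP => a b; rewrite !mxE ss'//=; lia.
Qed.

End process.

Lemma prob_ae_eq d (T : measurableType d) (R : realType) (P : probability T R)
  (A B : set T) : measurable A -> measurable B ->
  {ae P, forall s, A s <-> B s} -> prob P A = prob P B.
Proof.
move=> mA mB [N [mN N0 sub]]; rewrite /prob; congr fine.
have PE C : measurable C -> P C = P (C `\` N).
  move=> mC; have mCN : measurable (C `\` N) by exact: measurableD.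
  have mC' : measurable (C `&` N) by exact: measurableI.
  have CN0 : (P (C `&` N) = 0)%E by apply: (subset_measure0 _ mN _ N0) => // ? [].
  have -> : P C = (P (C `&` N) + P (C `\` N))%E.
    rewrite -[LHS](_ : P ((C `&` N) `|` (C `\` N)) = _); last by rewrite setUIDK.
    by apply: measureU => //; rewrite setDE setIACA setICr setI0.
  by rewrite CN0 add0e.
rewrite (PE _ mA) (PE _ mB); congr (P _).
have H s : ~ N s -> (A s <-> B s).
  by move=> Ns; apply: contrapT => h; apply: Ns; apply: sub.
by apply/seteqP; split => s [h1 h2]; split => //; apply/(H _ h2).
Qed.

Section window_index.
Variable d0 : nat.
Local Notation I := ((int * 'I_d0)%type : choiceType).

Definition window (tau0 : int) (w : nat) : seq I :=
  [seq (tau0 + a%:Z, j) | a <- iota 0 w.+1, j <- enum 'I_d0].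

Lemma window_uniq tau0 w : uniq (window tau0 w).
Proof.
apply: allpairs_uniq; [exact: iota_uniq|exact: enum_uniq|].
by move=> [a j] [a' j'] _ _ [] /eqP; rewrite (inj_eq (addrI _)) => /eqP[->] ->.
Qed.

Lemma mem_window tau0 w c : (c \in window tau0 w) = (tau0 <= c.1 <= tau0 + w%:Z).
Proof.
apply/allpairsP/idP => [[[a j] [aw _ ->]]|].
  by move: aw; rewrite mem_iota /=; lia.
case: c => k j h; exists (`|k - tau0|%N, j); split.
- by move: h; rewrite mem_iota /=; lia.
- by rewrite mem_enum.
- by move: h => /= h; congr (_, _); lia.
Qed.

Lemma size_window tau0 w : size (window tau0 w) = (w.+1 * d0)%N.
Proof. by rewrite size_allpairs size_iota size_enum_ord. Qed.

End window_index.

(** * Displacing the path through the innovations of a window *)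

Section window.
Context (R : realType) (d0 : nat) (Psi : nat -> 'M[R]_d0).
Hypothesis Psi0 : Psi 0%N \in unitmx.
Local Notation I := ((int * 'I_d0)%type : choiceType).
Local Notation S := (seqspace R I).
Local Notation Phi := (inv_filter Psi).
Local Notation partial := (partial Psi).
Local Notation Xh := (Xh Psi).

(* Filtering the window innovations displaced by [refilter tau0 Z] with [Psi]
   adds exactly [Z a] to the process at time [tau0 + a]. *)
Definition refilter (tau0 : int) (Z : nat -> S -> 'cV[R]_d0) (c : I) (s : S) : R :=
  (\sum_(a < (`|c.1 - tau0|).+1) Phi (`|c.1 - tau0| - a)%N *m Z a s) c.2 0.

(** After interchanging the two sums, the coefficient of [Z a] is the convolution of [Psi] with its
    inverse at [b - a], which vanishes unless [a = b]. *)
Lemma partial_shift (tau tau0 : int) w (Z : nat -> S -> 'cV[R]_d0) (b N : nat) s :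
  tau <= tau0 -> (b <= w)%N -> (b < N)%N ->
  partial (tau0 + b%:Z) N (restr (future tau) (shift (window d0 tau0 w) (refilter tau0 Z) s)) =
  partial (tau0 + b%:Z) N (restr (future tau) s) + Z b s.
Proof.
move=> tt bw bN.
pose H (l : nat) : 'cV[R]_d0 := if (l <= b)%N then
  \sum_(a < (b - l).+1) Phi (b - l - a)%N *m Z a s else 0.
have innovE (l : nat) : innov (tau0 + b%:Z - l%:Z)
    (restr (future tau) (shift (window d0 tau0 w) (refilter tau0 Z) s)) =
    innov (tau0 + b%:Z - l%:Z) (restr (future tau) s) + H l.
  apply/matrixP => j z; rewrite ord1 !mxE /restr /future /=.
  rewrite /shift mem_window /= /H.
  case: (leqP l b) => lb.
    rewrite !ifT; [|lia..]; congr (_ + _).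
    rewrite /refilter /=.
    by have -> : absz (tau0 + b%:Z - l%:Z - tau0)%R = (b - l)%N by lia.
  rewrite mxE addr0; case: ifPn => // _; rewrite ifF//; lia.
rewrite /partial (eq_bigr (fun l : 'I_N => Psi l *m
  innov (tau0 + b%:Z - l%:Z) (restr (future tau) s) + Psi l *m H l)); last first.
  by move=> l _; rewrite innovE mulmxDr.
rewrite big_split /=; congr (_ + _).
rewrite -(subnKC bN) big_split_ord /= [X in _ + X]big1 ?addr0; last first.
  by move=> l _; rewrite /H ifF ?mulmx0//; lia.
transitivity (\sum_(l < b.+1) \sum_(a < b.+1 | (a + l <= b)%N)
    Psi l *m (Phi (b - l - a)%N *m Z a s)).
  apply: eq_bigr => l _; rewrite /H ifT; last by have := ltn_ord l; lia.
  rewrite mulmx_sumr.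
  rewrite (big_ord_widen_cond b.+1 xpredT (fun a => Psi l *m (Phi (b - l - a)%N *m Z a s))); last first.
    by rewrite ltnS leq_subr.
  by apply: eq_bigl => a /=; have := ltn_ord l; lia.
rewrite (exchange_big_dep xpredT)//=.
transitivity (\sum_(a < b.+1) (if a == b :> nat then 1%:M else 0) *m Z a s).
  apply: eq_bigr => a _.
  have := inv_filterP Psi0 (b - a); rewrite subn_eq0.
  have -> : (b <= a)%N = (a == b :> nat) by have := ltn_ord a; lia.
  move=> <-; rewrite mulmx_suml.
  rewrite (big_ord_widen_cond b.+1 xpredT (fun l => Psi l *m Phi (b - a - l)%N *m Z a s)); last first.
    by rewrite ltnS leq_subr.
  apply: eq_big => [l|l _]; first by have := ltn_ord a; lia.
  by rewrite mulmxA subnAC.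
rewrite (bigD1 ord_max)//= eqxx mul1mx big1 ?addr0// => a /eqP ab.
rewrite ifF ?mul0mx//; apply/eqP => e; apply: ab; exact: val_inj.
Qed.

Lemma Xh_shift (tau tau0 : int) w (Z : nat -> S -> 'cV[R]_d0) (b : nat) s :
  tau <= tau0 -> (b <= w)%N ->
  Xh (tau0 + b%:Z) (restr (future tau) (shift (window d0 tau0 w) (refilter tau0 Z) s)) =
  Xh (tau0 + b%:Z) (restr (future tau) s) + Z b s.
Proof.
move=> tt bw; apply/matrixP => i j; rewrite ord1 [RHS]mxE.
set k := tau0 + _; rewrite (Xh_lim (@cvg_future _ _ Psi k tau _ i)).
rewrite (Xh_lim (@cvg_future _ _ Psi k tau _ i)) partial_shift ?mxE//.
rewrite /k; lia.
Qed.

Definition Xpath (s : S) : S := fun c => Xh c.1 s c.2 0.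

Lemma measurable_Xpath : measurable_fun setT Xpath.
Proof. by apply: measurable_seqspace => -[k j]; exact: measurable_Xh. Qed.

Definition recent_event tau (A : set S) : set S := [set s | A (Xpath (restr (future tau) s))].

Lemma measurable_recent_event tau A : measurable A -> measurable (recent_event tau A).
Proof.
move=> mA; rewrite -[X in measurable X]setTI.
have := measurableT_comp measurable_Xpath (measurable_restr (R := R) (future tau)).
exact.
Qed.

Lemma dep_recent_event tau A : dep (future tau) (recent_event tau A).
Proof.
move=> s s' ss'; rewrite /recent_event /= (_ : restr _ s = restr (future tau) s')//.
by apply/funext => c; rewrite /restr; case: ifPn => // /ss'.
Qed.

(** Over the window the path is the part due to innovations from [tau] on plus the part [Z] due to
    older ones. [recent_event] sees only the former, and the displacement by [refilter tau0 Z]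
    restores the latter. *)
Lemma shifted_window (tau tau0 : int) w (Z : nat -> S -> 'cV[R]_d0) (A : set S) s :
  tau <= tau0 -> converges Psi s ->
  dep (fun c => tau0 <= c.1 <= tau0 + w%:Z) A ->
  (forall b, (b <= w)%N -> Z b s = Xh (tau0 + b%:Z) (restr (predC (future tau)) s)) ->
  shifted (window d0 tau0 w) (refilter tau0 Z) (recent_event tau A) s <-> A (Xpath s).
Proof.
move=> tt cs dA ZE; rewrite /shifted /recent_event /=.
suff -> : A (Xpath (restr (future tau) (shift (window d0 tau0 w) (refilter tau0 Z) s)))
  = A (Xpath s) by [].
apply: dA => -[k j] /= kw; rewrite /Xpath /=.
have [b bw ->] : exists2 b : nat, (b <= w)%N & k = tau0 + b%:Z.
  by exists `|k - tau0|%N; lia.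
rewrite Xh_shift// ZE// -XhD -?restrD//.
- by move=> i; exact: (cvgP _ (@cvg_future _ _ Psi _ _ _ i)).
- by move=> i; exact: cvg_past.
Qed.

End window.

Lemma ler_sum_sub (R : realType) (T : eqType) (s1 s2 : seq T) (F : T -> R) :
  uniq s1 -> {subset s1 <= s2} -> (forall x, 0 <= F x) ->
  \sum_(x <- s1) F x <= \sum_(x <- s2) F x.
Proof.
move=> + + F0; elim: s1 s2 => [|a s1 IH] s2.
  by move=> _ _; rewrite big_nil sumr_ge0.
move=> /andP[as1 us1] sub; rewrite big_cons [leRHS](big_rem a) ?sub ?mem_head//= lerD2l.
apply: IH => // x xs1; have as2 : a \in s2 by rewrite sub ?mem_head.
have : x \in s2 by apply: sub; rewrite inE xs1 orbT.
rewrite (perm_mem (perm_to_rem as2)) inE => /predU1P[xa|//].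
by rewrite -xa xs1 in as1.
Qed.

Section lags.
Context (R : realType) (d0 : nat) (Psi : nat -> 'M[R]_d0).
Local Notation I := ((int * 'I_d0)%type : choiceType).

Definition lags (k : int) (N : nat) : seq I :=
  [seq (k - l%:Z, j) | l <- iota 0 N, j <- enum 'I_d0].

Lemma lags_uniq k N : uniq (lags k N).
Proof.
apply: allpairs_uniq; [exact: iota_uniq|exact: enum_uniq|].
move=> [a j] [a' j'] _ _ [] e ->; congr (_, _); move: e; lia.
Qed.

Lemma sum_lags k N (F : I -> R) :
  \sum_(c <- lags k N) F c = \sum_(l < N) \sum_j F (k - l%:Z, j).
Proof.
rewrite big_allpairs_dep -[RHS](big_mkord xpredT (fun l => \sum_j F (k - l%:Z, j))) /index_iota subn0.
by apply: eq_bigr => l _; rewrite big_enum.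
Qed.

Definition lagcoef (k : int) (i : 'I_d0) (c : I) : R := Psi `|k - c.1| i c.2.

Lemma partialE k N s i : partial Psi k N s i 0 = \sum_(c <- lags k N) lagcoef k i c * s c.
Proof.
rewrite sum_lags /partial summxE; apply: eq_bigr => l _.
rewrite mxE; apply: eq_bigr => j _; rewrite mxE /lagcoef /=.
by congr (Psi _ _ _ * _); lia.
Qed.

End lags.

(** * Variance bounds for the displacement *)

Section estimates.
Context (R : realType) (d0 : nat) (Psi : nat -> 'M[R]_d0).
Local Notation I := ((int * 'I_d0)%type : choiceType).
Local Notation S := (seqspace R I).
Variable mu : probability S R.
Hypothesis muP : iid_gauss mu.
Hypothesis Hcv : {ae mu, forall s, converges Psi s}.
Local Notation Phi := (inv_filter Psi).
Local Notation partial := (partial Psi).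
Local Notation Xh := (Xh Psi).
Local Notation past tau := (predC (@future d0 tau)).

Definition tailsq (L N : nat) (i : 'I_d0) : R :=
  \sum_(l < N | (L <= l)%N) \sum_j Psi l i j ^+ 2.

(** Partial sums are Gaussian combinations of variance at most [tailsq L N i], because an innovation
    before [tau] has lag at least [k - tau + 1]. [Z] need only agree almost surely, so that it may
    be given as a near part plus a far part. *)
Lemma subgauss_past (tau k : int) (L : nat) (sg : R) i (Z : S -> R) :
  L%:Z <= k - tau + 1 -> (forall N, tailsq L N i <= sg ^+ 2) ->
  measurable_fun setT Z ->
  {ae mu, forall s, Z s = Xh k (restr (past tau) s) i 0} ->
  subgauss mu sg Z.
Proof.
move=> Lk tL mZ aeZ.
apply: (@subgauss_lim _ _ _ mu (fun N s => partial k N (restr (past tau) s) i 0)) => //.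
- move=> N; exact: (measurableT_comp (@measurable_partial _ _ Psi k N i) (measurable_restr (R := R) _)).
- move=> N t.
  pose a (c : I) := if past tau c then t * lagcoef Psi k i c else 0.
  have aE s : t * partial k N (restr (past tau) s) i 0 = \sum_(c <- lags d0 k N) a c * s c.
    rewrite partialE mulr_sumr; apply: eq_bigr => c _; rewrite /a /restr.
    by case: ifP; rewrite ?mulr0 ?mul0r// mulrA.
  under eq_integral do rewrite aE.
  rewrite (integral_expR_lin muP _ (lags_uniq _ _ _)) lee_fin ler_expR -mulr_suml.
  rewrite ler_pM2r ?invr_gt0//; apply: (@le_trans _ _ (t ^+ 2 * tailsq L N i)); last first.
    by rewrite ler_wpM2l ?sqr_ge0.
  rewrite sum_lags /tailsq mulr_sumr [leRHS]big_mkcond/=; apply: ler_sum => l _.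
  rewrite /a /future /=; case: ifPn => Ll.
    rewrite mulr_sumr; apply: ler_sum => j _.
    case: ifPn => _; last by rewrite expr0n/= mulr_ge0 ?sqr_ge0.
    rewrite exprMn /lagcoef /=; have -> : absz (k - (k - (l : nat)%:Z))%R = l by lia.
    exact: lexx.
  rewrite big1// => j _; rewrite ifF ?expr0n//.
  by apply/negbTE; rewrite negbK; move: Ll Lk; lia.
apply: filterS2 aeZ Hcv => s -> cs.
have /cvg_ex[x cx] := @cvg_past _ _ Psi k tau s i cs.
by rewrite (Xh_lim cx).
Qed.

(** The summand 1 makes the bound at least 1, so that its square dominates it and hence every
    squared coefficient. *)
Definition phi_bound (w : nat) : R := 1 + \sum_(n < w.+1) \sum_i \sum_j Phi n i j ^+ 2.

Lemma phi_bound_ge1 w : 1 <= phi_bound w.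
Proof. by rewrite lerDl; do 3 (apply: sumr_ge0 => ? _); exact: sqr_ge0. Qed.

Lemma phi_le w n i j : (n <= w)%N -> Phi n i j ^+ 2 <= phi_bound w ^+ 2.
Proof.
move=> nw; apply: (@le_trans _ _ (phi_bound w)); last first.
  by rewrite expr2 ler_peMl ?phi_bound_ge1// (le_trans _ (phi_bound_ge1 w)).
have H (U : finType) (F : U -> R) x : (forall y, 0 <= F y) -> F x <= \sum_y F y.
  by move=> F0; rewrite (bigD1 x)//= lerDl sumr_ge0.
have nw' : (n < w.+1)%N by rewrite ltnS.
apply: (@le_trans _ _ (\sum_(n < w.+1) \sum_i \sum_j Phi n i j ^+ 2)); last by rewrite lerDr.
apply: le_trans (H _ _ (Ordinal nw') _); last first.
  by move=> y; do 2 (apply: sumr_ge0 => ? _); exact: sqr_ge0.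
apply: le_trans (H _ _ i _); last by move=> y; apply: sumr_ge0 => ? _; exact: sqr_ge0.
by apply: (H _ (fun j => Phi n i j ^+ 2)) => y; exact: sqr_ge0.
Qed.

Definition wbox (w : nat) : seq (nat * 'I_d0) :=
  [seq (a, j) | a <- iota 0 w.+1, j <- enum 'I_d0].

Lemma size_wbox w : size (wbox w) = (w.+1 * d0)%N.
Proof. by rewrite size_allpairs size_iota size_enum_ord. Qed.

Definition refcoef (tau0 : int) (c : I) (r : nat * 'I_d0) : R :=
  if (r.1 <= `|c.1 - tau0|)%N then Phi (`|c.1 - tau0| - r.1) c.2 r.2 else 0.

Lemma refilterE tau0 w (Z : nat -> S -> 'cV[R]_d0) c s : c \in window d0 tau0 w ->
  refilter Psi tau0 Z c s =
  \sum_(r <- wbox w) refcoef tau0 c r * Z r.1 s r.2 0.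
Proof.
rewrite mem_window => cw; rewrite /refilter /wbox big_allpairs_dep.
set b := `|c.1 - tau0|%N; have bw : (b.+1 <= w.+1)%N by rewrite /b; lia.
transitivity (\sum_(a < w.+1) \sum_j refcoef tau0 c (a : nat, j) * Z a s j 0); last first.
  rewrite -(big_mkord xpredT (fun a => \sum_j refcoef tau0 c (a, j) * Z a s j 0)).
  by rewrite /index_iota subn0; apply: eq_bigr => a _; rewrite big_enum.
rewrite summxE (big_ord_widen_cond w.+1 xpredT (fun a => (Phi (b - a)%N *m Z a s) c.2 0))//.
rewrite big_mkcond /=; apply: eq_bigr => a _; rewrite ltnS.
case: ifPn => ab; last by rewrite big1// => j _; rewrite /refcoef /= -/b (negbTE ab) mul0r.
by rewrite mxE; apply: eq_bigr => j _; rewrite /refcoef /= -/b ab.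
Qed.

Lemma measurable_refilter tau0 (Z : nat -> S -> 'cV[R]_d0) c :
  (forall a j, measurable_fun setT (fun s => Z a s j 0)) ->
  measurable_fun setT (refilter Psi tau0 Z c).
Proof.
move=> mZ; rewrite (_ : refilter _ _ _ _ = fun s => \sum_(a < (`|c.1 - tau0|).+1)
   \sum_j Phi (`|c.1 - tau0| - a)%N c.2 j * Z a s j 0).
  by apply: measurable_sum => a; apply: measurable_sum => j; exact: measurable_funM.
by apply/funext => s; rewrite /refilter summxE; apply: eq_bigr => a _; rewrite mxE.
Qed.

Lemma dep_refilter (J : pred I) tau0 (Z : nat -> S -> 'cV[R]_d0) c :
  (forall a, dep J (Z a)) -> dep J (refilter Psi tau0 Z c).
Proof.
move=> dZ s s' ss'; rewrite /refilter; congr ((_ : 'cV_d0) _ _).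
by apply: eq_bigr => a _; rewrite (dZ a _ _ ss').
Qed.

Lemma refcoef_le tau0 w c r : c \in window d0 tau0 w ->
  refcoef tau0 c r ^+ 2 <= phi_bound w ^+ 2.
Proof.
rewrite mem_window => cw; rewrite /refcoef; case: ifPn => _.
  by apply: phi_le; lia.
by rewrite expr0n sqr_ge0.
Qed.

Lemma subgauss_refilter tau0 w (Z : nat -> S -> 'cV[R]_d0) c sg :
  c \in window d0 tau0 w ->
  (forall a j, measurable_fun setT (fun s => Z a s j 0)) ->
  (forall a j, (a <= w)%N -> subgauss mu sg (fun s => Z a s j 0)) ->
  subgauss mu ((w.+1 * d0)%:R * sg * (w.+1 * d0)%:R * phi_bound w) (refilter Psi tau0 Z c).
Proof.
move=> cw mZ hZ; rewrite -{1 2}(size_wbox w).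
rewrite (_ : refilter _ _ _ _ = fun s => \sum_(r <- wbox w) refcoef tau0 c r * Z r.1 s r.2 0).
  apply: (@subgauss_sum _ _ _ mu _ _ (fun r s => Z r.1 s r.2 0)) => //.
  - move=> [a j] /allpairsP[[a' j'] [aw _ [-> ->]]]; apply: hZ.
    by move: aw; rewrite mem_iota.
  - by move=> r; exact: refcoef_le.
by apply/funext => s; exact: refilterE.
Qed.

Hypothesis Psi0 : Psi 0%N \in unitmx.

(** The parenthesis bounds one coordinate of the displacement; the outer factor is that of [mgf_sum]
    for the joint exponential moments over the window. *)
Definition mix_scale (w : nat) : R :=
  (w.+1 * d0)%:R * ((w.+1 * d0)%:R * (w.+1 * d0)%:R * phi_bound w).

Lemma process_mixing (tau tau0 : int) (w L : nat) (sg r : R) (A C : set S) :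
  (0 < d0)%N -> tau <= tau0 -> L%:Z <= tau0 - tau + 1 -> 0 < sg ->
  (forall N i, tailsq L N i <= sg ^+ 2) ->
  measurable A -> dep (fun c => tau0 <= c.1 <= tau0 + w%:Z) A ->
  measurable C -> dep (past tau) C -> 0 < r ->
  let sg' := mix_scale w * sg in
  let kap := weight_defect (window d0 tau0 w) sg' r in
  let tl := sumsq_tail (window d0 tau0 w) r in
  let p := prob mu (Xpath Psi @^-1` A) in
  sg' ^+ 2 <= 1 / 4 -> kap <= 1 / 2 ->
  `|prob mu (C `&` Xpath Psi @^-1` A) - prob mu C * p| <=
  (kap + (expR (sg' ^+ 2 * r ^+ 2 / 2) - 1)) * (2 * p + 2 * tl) + 2 * tl.
Proof.
move=> d00 tt Lt sg0 tL mA dA mC dC r0 sg' kap tl p sg4 k2.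
pose q : R := (w.+1 * d0)%:R.
have q1 : 1 <= q by rewrite /q ler1n muln_gt0 d00.
have q0 : 0 < q := lt_le_trans ltr01 q1.
pose Z a s := Xh (tau0 + a%:Z) (restr (past tau) s).
pose h := refilter Psi tau0 Z.
have mZ a j : measurable_fun setT (fun s => Z a s j 0).
  exact: (measurableT_comp (@measurable_Xh _ _ Psi _ j) (measurable_restr (R := R) _)).
have mh c : measurable_fun setT (h c) := measurable_refilter tau0 c mZ.
have dZ a : dep (past tau) (Z a).
  move=> s s' ss'; rewrite /Z; congr (Xh _ _); apply/funext => c.
  by rewrite /restr; case: ifPn => // /ss'.
have dh c : dep (past tau) (h c) by exact: dep_refilter.
pose sh := q * sg * q * phi_bound w.
have B1 := phi_bound_ge1 w; have B0 : 0 < phi_bound w := lt_le_trans ltr01 B1.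
have sh0 : 0 < sh by rewrite !mulr_gt0.
have hsub0 c : c \in window d0 tau0 w -> subgauss mu sh (h c).
  move=> cw; apply: subgauss_refilter => // a j aw.
  apply: (@subgauss_past tau (tau0 + a%:Z) L _ j).
  - by clear - Lt; lia.
  - by move=> N; exact: tL.
  - exact: mZ.
  - by apply: aeW => s.
have sg'E : sg' = q * sh by rewrite /sg' /mix_scale -/q /sh; ring.
have sg'0 : 0 < sg' by rewrite sg'E mulr_gt0.
pose D := shifted (window d0 tau0 w) h (recent_event Psi tau A).
have mD0 := @measurable_recent_event R d0 Psi tau A mA.
have mD : measurable D by exact: measurable_shifted.
have mXA : measurable (Xpath Psi @^-1` A).
  rewrite -[X in measurable X]setTI; exact: measurable_Xpath.
have ae : {ae mu, forall s, D s <-> (Xpath Psi @^-1` A) s}.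
  move: Hcv; apply: filterS => s cs.
  exact: (shifted_window Psi0 tt cs dA).
have pE : prob mu D = p by exact: prob_ae_eq.
have pCE : prob mu (C `&` D) = prob mu (C `&` Xpath Psi @^-1` A).
  apply: prob_ae_eq; [exact: measurableI|exact: measurableI|].
  by move: ae; apply: filterS => s [h1 h2]; split => -[? ?]; split; auto.
rewrite -pCE -pE.
apply: (shifted_mixing muP (J := future tau)) => //.
- exact: window_uniq.
- by move=> c; rewrite mem_window /future; clear - tt; lia.
- exact: dep_recent_event.
- move=> a; have := mgf_sum a mh hsub0; rewrite size_window -/q -sg'E; exact.
- move=> c cw; apply: subgauss_le (hsub0 c cw); first exact: ltW.
  by rewrite sg'E ler_peMl// ltW.
Qed.

End estimates.

(** * Anticlustering for the process *)

Section anticluster.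
Context (R : realType) (d0 : nat) (Psi : nat -> 'M[R]_d0).
Hypothesis Psi0 : Psi 0%N \in unitmx.
Local Notation I := ((int * 'I_d0)%type : choiceType).
Local Notation S := (seqspace R I).
Variable mu : probability S R.
Hypothesis muP : iid_gauss mu.
Hypothesis Hcv : {ae mu, forall s, converges Psi s}.
Local Notation Phi := (inv_filter Psi).
Local Notation partial := (partial Psi).
Local Notation Xh := (Xh Psi).
Local Notation past tau := (predC (@future d0 tau)).
Local Notation tailsq := (tailsq Psi).

Definition near_index (tau0 : int) (n : nat) : pred I :=
  predI (@future d0 (tau0 - n.+1%:Z)) (past tau0).

Lemma near_indexE tau0 n c : near_index tau0 n c = (c \in window d0 (tau0 - n.+1%:Z) n).
Proof. by rewrite mem_window /near_index /future /=; lia. Qed.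

(** A finite sum covering every lag that reaches the near innovations. It is linear for all [s],
    convergent or not, as the dilation identity and Cauchy-Schwarz require. *)
Definition Znear (tau0 : int) (n : nat) (a : nat) (s : S) : 'cV[R]_d0 :=
  partial (tau0 + a%:Z) (absz (tau0 + a%:Z - (tau0 - n.+1%:Z))%R).+1 (restr (near_index tau0 n) s).

Definition Zfar (tau0 : int) (n : nat) (a : nat) (s : S) : 'cV[R]_d0 :=
  Xh (tau0 + a%:Z) (restr (past (tau0 - n.+1%:Z)) s).

Lemma restr_dep (J : pred I) (s s' : S) : (forall c, J c -> s c = s' c) ->
  restr J s = restr J s'.
Proof. by move=> h; apply/funext => c; rewrite /restr; case: ifPn => // /h. Qed.

Lemma measurable_Znear tau0 n a j : measurable_fun setT (fun s => Znear tau0 n a s j 0).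
Proof.
exact: (measurableT_comp (@measurable_partial _ _ Psi _ _ j) (measurable_restr (R := R) _)).
Qed.

Lemma measurable_Zfar tau0 n a j : measurable_fun setT (fun s => Zfar tau0 n a s j 0).
Proof.
exact: (measurableT_comp (@measurable_Xh _ _ Psi _ j) (measurable_restr (R := R) _)).
Qed.

Lemma dep_Znear tau0 n a : dep (past tau0) (Znear tau0 n a).
Proof.
by move=> s s' ss'; rewrite /Znear (restr_dep (s' := s'))// => c /andP[_]; exact: ss'.
Qed.

Lemma dep_Zfar tau0 n a : dep (past tau0) (Zfar tau0 n a).
Proof.
move=> s s' ss'; rewrite /Zfar (restr_dep (s' := s'))// => c h; apply: ss'.
by move: h; rewrite /future /=; lia.
Qed.

Lemma Znear_dilate tau0 n a c (s : S) :
  Znear tau0 n a (dilate (window d0 (tau0 - n.+1%:Z) n) c s) = c *: Znear tau0 n a s.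
Proof.
rewrite /Znear /partial scaler_sumr; apply: eq_bigr => l _; rewrite scalemxAr.
congr (_ *m _); apply/matrixP => x y; rewrite !mxE /restr /dilate -near_indexE.
by case: (near_index _ _ _); rewrite ?mulr0.
Qed.

Lemma Zfar_dilate tau0 n a c (s : S) :
  Zfar tau0 n a (dilate (window d0 (tau0 - n.+1%:Z) n) c s) = Zfar tau0 n a s.
Proof.
rewrite /Zfar (restr_dep (s' := s))// => e h; rewrite /dilate -near_indexE.
rewrite ifF//; apply/negbTE; rewrite /near_index /= negb_and.
by apply/orP; left; exact: h.
Qed.

Lemma Znear_far tau0 n a s : converges Psi s ->
  Znear tau0 n a s + Zfar tau0 n a s = Xh (tau0 + a%:Z) (restr (past tau0) s).
Proof.
move=> cs; pose k := tau0 + a%:Z; pose tau1 := tau0 - n.+1%:Z.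
have E1 : restr (near_index tau0 n) s = restr (@future d0 tau1) (restr (past tau0) s).
  by rewrite restr_restr.
have E2 : restr (past tau1) s = restr (past tau1) (restr (past tau0) s).
  rewrite restr_restr; apply/funext => c; rewrite /restr /tau1 /future /=.
  by congr (if _ then _ else _); lia.
rewrite [in RHS](restrD (@future d0 tau1) (restr (past tau0) s)) XhD.
- rewrite -E2; congr (_ + _); apply/matrixP => i j; rewrite ord1.
  by rewrite (Xh_lim (@cvg_future _ _ Psi k tau1 _ i)) -E1.
- by move=> i; exact: (cvgP _ (@cvg_future _ _ Psi _ _ _ i)).
- by move=> i; rewrite -E2; exact: cvg_past.
Qed.

Lemma refilterD tau0 (Z Z' : nat -> S -> 'cV[R]_d0) c s :
  refilter Psi tau0 (fun a s => Z a s + Z' a s) c s =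
  refilter Psi tau0 Z c s + refilter Psi tau0 Z' c s.
Proof.
rewrite /refilter; under eq_bigr do rewrite mulmxDr.
by rewrite big_split /= mxE.
Qed.

Lemma Znear_le tau0 n a i (T : R) s : (forall N, tailsq 0 N i <= T) ->
  Znear tau0 n a s i 0 ^+ 2 <= T * sumsq (window d0 (tau0 - n.+1%:Z) n) s.
Proof.
move=> hT; rewrite /Znear partialE; pose k := tau0 + a%:Z.
pose N := (absz (tau0 + a%:Z - (tau0 - n.+1%:Z))%R).+1; rewrite -/N -/k.
apply: (le_trans (cauchy_schwarz _ _ _)); apply: ler_pM.
- by apply: sumr_ge0 => c _; exact: sqr_ge0.
- by apply: sumr_ge0 => c _; exact: sqr_ge0.
- apply: le_trans (hT N); rewrite sum_lags /tailsq; apply: ler_sum => l _.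
  apply: ler_sum => j _; rewrite /lagcoef /=.
  by have -> : absz (k - (k - (l : nat)%:Z))%R = l by lia.
rewrite /restr (bigID (near_index tau0 n)) /= [X in _ + X]big1 ?addr0; last first.
  by move=> c /negbTE ->; rewrite expr0n.
have -> : \sum_(c <- lags d0 k N | near_index tau0 n c)
    (if near_index tau0 n c then s c else 0) ^+ 2 =
  \sum_(c <- [seq c <- lags d0 k N | near_index tau0 n c]) s c ^+ 2.
  by rewrite big_filter; apply: eq_bigr => c ->.
apply: ler_sum_sub.
- by rewrite filter_uniq// lags_uniq.
- by move=> c; rewrite mem_filter => /andP[+ _]; rewrite near_indexE.
- by move=> c; exact: sqr_ge0.
Qed.

Section rate.
Variables (w : nat) (T : R).
Hypothesis d00 : (0 < d0)%N.
Hypothesis T0 : 0 < T.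
Hypothesis hT : forall N i, tailsq 0 N i <= T ^+ 2.
Hypothesis htail : forall e : R, 0 < e -> exists L, forall N i, tailsq L N i <= e ^+ 2.

Let q : R := (w.+1 * d0)%:R.
Let q1 : 1 <= q. Proof. by rewrite /q ler1n muln_gt0 d00. Qed.
Let B := phi_bound Psi w.
Let B1 : 1 <= B := phi_bound_ge1 Psi w.
(** [T ^+ 2] comes from Cauchy-Schwarz on the lags and [B ^+ 2] from the inverse filter; the factors
    [q] come from squaring a sum of [q] terms, from the number of these terms, and from summing over
    the window. *)
Let K : R := 1 + q * (q * (B ^+ 2 * (q * T ^+ 2))).
Let K1 : 1 <= K.
Proof.
rewrite lerDl; have q0 : 0 <= q := le_trans ler01 q1.
apply: mulr_ge0 => //; apply: mulr_ge0 => //.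
by apply: mulr_ge0; [exact: sqr_ge0|apply: mulr_ge0 => //; exact: sqr_ge0].
Qed.

Lemma anticluster_bound (tau0 : int) (n : nat) (sf rho : R) (A F : set S) :
  0 < sf -> (forall N i, tailsq n.+1 N i <= sf ^+ 2) -> 0 <= rho ->
  measurable A -> dep (fun c => tau0 <= c.1 <= tau0 + w%:Z) A ->
  measurable F -> dep (past tau0) F ->
  prob mu (F `&` Xpath Psi @^-1` A) <=
    prob mu F * (2 ^+ (w.+1 * d0) * expR (- (rho ^+ 2 / (16 * K))))
  + q * (2 * expR (- (rho ^+ 2 / (2 * (q * sf * q * B) ^+ 2))))
  + ((1 - (2 * (K + 1))^-1) ^+ (n.+1 * d0))^-1 *
      expR (- ((2 * (K + 1))^-1 * rho ^+ 2 / 4)) * prob mu (Xpath Psi @^-1` A)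
  + 2 * expR (2 * q * (8 * expR (1 / 2)) * (q * T * q * B) ^+ 2 + 1 +
      2 * (rho ^+ 2 / (4 * K) + 2 * (K + q) * rho ^+ 2)) * prob mu F * prob mu (Xpath Psi @^-1` A).
Proof.
move=> sf0 hsf rho0 mA dA mF dF; set p := prob mu (_ @^-1` A).
have q0 : 0 < q := lt_le_trans ltr01 q1.
have B0 : 0 < B := lt_le_trans ltr01 B1.
pose V := window d0 (tau0 - n.+1%:Z) n; pose W := window d0 tau0 w.
pose hn := refilter Psi tau0 (Znear tau0 n).
pose hf := refilter Psi tau0 (Zfar tau0 n).
pose Z a s := Znear tau0 n a s + Zfar tau0 n a s.
pose h := refilter Psi tau0 Z.
have mZ a j : measurable_fun setT (fun s => Z a s j 0).
  rewrite (_ : (fun s => _) = (fun s => Znear tau0 n a s j 0 + Zfar tau0 n a s j 0)).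
    by apply: measurable_funD; [exact: measurable_Znear|exact: measurable_Zfar].
  by apply/funext => s; rewrite mxE.
have dZ a : dep (past tau0) (Z a).
  by move=> s s' ss'; congr (_ + _); [exact: dep_Znear|exact: dep_Zfar].
have hsub c : c \in W -> subgauss mu (q * T * q * B) (h c).
  move=> cW; apply: subgauss_refilter => // a j aw.
  apply: (@subgauss_past _ _ Psi _ muP Hcv tau0 (tau0 + a%:Z) 0%N _ j).
  - by clear; lia.
  - by move=> N; exact: hT.
  - exact: mZ.
  - by move: Hcv; apply: filterS => s cs; rewrite /Z Znear_far.
have hfsub c : c \in W -> subgauss mu (q * sf * q * B) (hf c).
  move=> cW; apply: subgauss_refilter => //; first exact: measurable_Zfar.
  move=> a j aw.
  apply: (@subgauss_past _ _ Psi _ muP Hcv (tau0 - n.+1%:Z) (tau0 + a%:Z) n.+1 _ j).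
  - by clear; lia.
  - by move=> N; exact: hsf.
  - exact: measurable_Zfar.
  - by apply: aeW => s.
have hn_le s : \sum_(c <- W) hn c s ^+ 2 <= K * sumsq V s.
  have V0 : 0 <= sumsq V s := sumsq_ge0 V s.
  apply: (@le_trans _ _ (\sum_(c <- W) q * (B ^+ 2 * (q * (T ^+ 2 * sumsq V s))))).
    rewrite !big_seq; apply: ler_sum => c cW.
    rewrite /hn (refilterE Psi (Znear tau0 n) s cW).
    apply: (le_trans (sqr_sum_le _ _)); rewrite size_wbox -/q ler_pM2l//.
    apply: (@le_trans _ _ (\sum_(r <- wbox d0 w) B ^+ 2 * (T ^+ 2 * sumsq V s))).
      apply: ler_sum => r _; rewrite exprMn; apply: ler_pM; rewrite ?sqr_ge0//.
        by apply: refcoef_le; exact: cW.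
      by apply: Znear_le => N; exact: hT.
    rewrite -mulr_sumr big_const_seq count_predT iter_addr_0 size_wbox.
    by rewrite -[X in _ * X <= _]mulr_natl.
  rewrite big_const_seq count_predT iter_addr_0 size_window -[leLHS]mulr_natl -/q.
  rewrite /K mulrDl mul1r -!mulrA lerDr//.
have mXA : measurable (Xpath Psi @^-1` A).
  rewrite -[X in measurable X]setTI; exact: measurable_Xpath.
have mD0 := @measurable_recent_event R d0 Psi tau0 A mA.
have mh c : measurable_fun setT (h c) := measurable_refilter Psi tau0 c mZ.
pose D := shifted W h (recent_event Psi tau0 A).
have mD : measurable D by exact: measurable_shifted.
have ae : {ae mu, forall s, D s <-> (Xpath Psi @^-1` A) s}.
  move: Hcv; apply: filterS => s cs.
  by apply: (shifted_window Psi0 (lexx _) cs dA) => b bw; rewrite /Z Znear_far.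
have pE : prob mu D = p by exact: prob_ae_eq.
have pFE : prob mu (F `&` D) = prob mu (F `&` Xpath Psi @^-1` A).
  apply: prob_ae_eq; [exact: measurableI|exact: measurableI|].
  by move: ae; apply: filterS => s [h1 h2]; split => -[? ?]; split; auto.
rewrite -pFE -pE.
have := @shifted_anticluster R I mu muP W (@future d0 tau0) h (recent_event Psi tau0 A)
  (window_uniq _ _ _) _ mh _ mD0 (dep_recent_event _ _) V hn hf K (q * T * q * B)
  (q * sf * q * B) (window_uniq _ _ _).
rewrite /hsq_bound !size_window -/q => H; apply: H => //.
- by move=> c; rewrite mem_window /future; clear; lia.
- by move=> c; exact: dep_refilter.
- by move=> c; rewrite mem_window /future; clear; lia.
- by move=> c; apply: measurable_refilter; exact: measurable_Znear.
- by move=> c; apply: dep_refilter => a; exact: dep_Znear.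
- by move=> c; apply: measurable_refilter; exact: measurable_Zfar.
- by move=> c s; exact: refilterD.
- move=> c a s; rewrite /hn /refilter; under eq_bigr do rewrite Znear_dilate -scalemxAr.
  by rewrite -scaler_sumr mxE.
- by move=> c a s; rewrite /hf /refilter; under eq_bigr do rewrite Zfar_dilate.
- by rewrite !mulr_gt0.
- by rewrite !mulr_gt0.
Qed.

Lemma tailsq_le L L' N i : (L <= L')%N -> tailsq L' N i <= tailsq L N i.
Proof.
move=> LL; rewrite /tailsq big_mkcond [leRHS]big_mkcond /=; apply: ler_sum => l _.
case: ifPn => h; first by rewrite (leq_trans LL h).
by case: ifP => // _; apply: sumr_ge0 => j _; exact: sqr_ge0.
Qed.

(** With [rho ^+ 2 = theta * y], proportional to the exponent of the probabilities, every term of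
    [anticluster_bound] is an exponential in [y]; the constants are tuned so that each decays
    strictly faster than [expR (- y)]. *)
Lemma anticluster_rate : exists eta C : R, [/\ 0 < eta, 0 < C &
  forall (tau0 : int) (A F : set S) (y : R), 0 <= y ->
  measurable A -> dep (fun c => tau0 <= c.1 <= tau0 + w%:Z) A ->
  measurable F -> dep (past tau0) F ->
  prob mu F <= expR (- y) -> prob mu (Xpath Psi @^-1` A) <= expR (- y) ->
  prob mu (F `&` Xpath Psi @^-1` A) <= C * expR (- ((1 + eta) * y))].
Proof.
have q0 : 0 < q := lt_le_trans ltr01 q1.
have B0 : 0 < B := lt_le_trans ltr01 B1.
have K0 : 0 < K := lt_le_trans ltr01 K1.
pose c4 := 2 * (1 / (4 * K) + 2 * (K + q)).
have c40 : 0 < c4.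
  apply: mulr_gt0 => //; apply: addr_gt0; last by apply: mulr_gt0 => //; exact: addr_gt0.
  by apply: divr_gt0 => //; exact: mulr_gt0.
(* The exponential factor of the last term then grows only like [expR (y / 2)], against the product
   of two probabilities bounded by [expR (- y)]. *)
pose theta := (2 * c4)^-1.
have th0 : 0 < theta by rewrite invr_gt0 mulr_gt0.
(* With this far deviation the second term is of order [expR (- (2 * y))]. It determines the extent
   [n] of the near past, which therefore does not depend on [y]. *)
pose sf := Num.sqrt theta / (2 * q * q * B).
have sf0 : 0 < sf by rewrite divr_gt0 ?sqrtr_gt0 ?mulr_gt0.
have [n hn] := htail sf0.
have hn1 N i : tailsq n.+1 N i <= sf ^+ 2.
  by apply: le_trans (hn N i); exact: tailsq_le.
pose t := (2 * (K + 1))^-1.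
have K10 : 0 < 2 * (K + 1) by have := K0; lra.
have t0 : 0 < t by rewrite invr_gt0.
have t1 : 0 < 1 - t by rewrite subr_gt0 (invf_lt1 K10); have := K1; lra.
pose hb := 2 * q * (8 * expR (1 / 2)) * (q * T * q * B) ^+ 2 + 1.
pose C1 : R := 2 ^+ (w.+1 * d0).
pose C3 : R := ((1 - t) ^+ (n.+1 * d0))^-1.
have C10 : 0 < C1 by rewrite exprn_gt0.
have C30 : 0 < C3 by rewrite /C3 invr_gt0; apply: exprn_gt0.
pose eta := Num.min (theta / (16 * K)) (Num.min (t * theta / 4) (1 / 2)).
have e1 : eta <= theta / (16 * K) by rewrite /eta ge_min lexx.
have e2 : eta <= t * theta / 4 by rewrite /eta !ge_min lexx orbT.
have e3 : eta <= 1 / 2 by rewrite /eta !ge_min lexx !orbT.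
exists eta, (C1 + q * 2 + C3 + 2 * expR hb); split.
- rewrite !lt_min; apply/and3P; split.
  + by apply: divr_gt0 => //; exact: mulr_gt0.
  + by apply: divr_gt0 => //; exact: mulr_gt0.
  + by rewrite divr_gt0.
- have := expR_gt0 hb; have : 0 < q * 2 by rewrite mulr_gt0.
  by move: C10 C30; lra.
move=> tau0 A F y y0 mA dA mF dF pF pA.
pose rho := Num.sqrt (theta * y).
have rho2 : rho ^+ 2 = theta * y by rewrite sqr_sqrtr// mulr_ge0// ltW.
have := anticluster_bound sf0 hn1 (sqrtr_ge0 _ : 0 <= rho) mA dA mF dF.
move=> /le_trans; apply; rewrite rho2 -/t -/C1 -/C3 -/hb.
have pF0 := prob_ge0 mu F; have pA0 := prob_ge0 mu (Xpath Psi @^-1` A).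
rewrite (_ : (_ + _ + _ + _) * expR _ = C1 * expR (- ((1 + eta) * y)) +
  q * 2 * expR (- ((1 + eta) * y)) + C3 * expR (- ((1 + eta) * y)) +
  2 * expR hb * expR (- ((1 + eta) * y))); last by ring.
rewrite [(1 + eta) * y]mulrDl [1 * y]mul1r; apply: lerD; [apply: lerD; [apply: lerD|]|].
- rewrite mulrCA ler_pM2l//.
  apply: (@le_trans _ _ (expR (- y) * expR (- (theta * y / (16 * K))))).
    by rewrite ler_wpM2r ?expR_ge0.
  rewrite -expRD ler_expR.
  have := ler_wpM2r y0 e1.
  have -> : theta / (16 * K) * y = theta * y / (16 * K) by ring.
  lra.
- rewrite mulrA ler_pM2l ?mulr_gt0// ler_expR.
  have -> : (q * sf * q * B) ^+ 2 = theta / 4.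
    rewrite /sf; have -> : q * (Num.sqrt theta / (2 * q * q * B)) * q * B = Num.sqrt theta / 2.
      have gen (x b z : R) : 0 < x -> 0 < b -> x * (z / (2 * x * x * b)) * x * b = z / 2.
        by move=> x0 b0; field; rewrite !gt_eqF.
      exact: gen.
    by rewrite expr_div_n sqr_sqrtr ?ltW//; congr (_ / _); ring.
  have -> : theta * y / (2 * (theta / 4)) = 2 * y by field; rewrite gt_eqF.
  by have := ler_wpM2r y0 e3; lra.
- rewrite -mulrA ler_pM2l//.
  apply: (@le_trans _ _ (expR (- (t * (theta * y) / 4)) * expR (- y))).
    by rewrite ler_wpM2l ?expR_ge0.
  rewrite -expRD ler_expR; have := ler_wpM2r y0 e2; lra.
- have -> : 2 * (theta * y / (4 * K) + 2 * (K + q) * (theta * y)) = y / 2.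
    have c4t : c4 * theta = 1 / 2.
      by rewrite /theta; have gen (x : R) : 0 < x -> x * (2 * x)^-1 = 1 / 2;
        [by move=> x0; field; rewrite gt_eqF | exact: gen].
    have -> : y / 2 = c4 * theta * y by rewrite c4t; ring.
    by rewrite /c4 div1r; ring.
  rewrite -!mulrA ler_pM2l//.
  apply: (@le_trans _ _ (expR (hb + y / 2) * (expR (- y) * expR (- y)))).
    apply: ler_pM; rewrite ?expR_ge0 ?mulr_ge0//; last by apply: ler_pM.
  rewrite -!expRD ler_expR; have := ler_wpM2r y0 e3; lra.
Qed.

End rate.
End anticluster.
(** * Block method *)

Section bonferroni.
Context d (T : measurableType d) (R : realType) (P : probability T R).

Lemma probU A B : measurable A -> measurable B ->
  prob P (A `|` B) = prob P A + prob P B - prob P (A `&` B).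
Proof.
move=> mA mB.
have mU : measurable (A `|` B) by exact: measurableU.
have h1 := probD_I P mA mU; have h2 := probD_I P mA mB.
have e1 : A `&` (A `|` B) = A by rewrite setIUr setIid; apply/setUidPl => ? [].
have e2 : ~` A `&` (A `|` B) = ~` A `&` B by rewrite setIUr setICl set0U.
by move: h1; rewrite e1 e2; lra.
Qed.

(** Second-order Bonferroni inequality: each new event meets the earlier union in at most the sum of
    its pairwise intersections. *)
Lemma bonferroni (n : nat) (A : nat -> set T) : (forall i, measurable (A i)) ->
  \sum_(i < n) prob P (A i) <=
  prob P (\big[setU/set0]_(i < n) A i) +
  \sum_(j < n) \sum_(i < j) prob P (A i `&` A j).
Proof.
move=> mA; elim: n => [|n IH]; first by rewrite !big_ord0 addr0 prob_ge0.
rewrite !big_ord_recr /=.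
have mB : measurable (\big[setU/set0]_(i < n) A i) by exact: bigsetU_measurable.
rewrite probU//.
have : prob P ((\big[setU/set0]_(i < n) A i) `&` A n) <= \sum_(i < n) prob P (A i `&` A n).
  have -> : (\big[setU/set0]_(i < n) A i) `&` A n = \big[setU/set0]_(i < n) (A i `&` A n).
    by rewrite big_distrl.
  by apply: (prob_bigU_le P _ (A := fun i : 'I_n => A i `&` A n)) => i; exact: measurableI.
lra.
Qed.

End bonferroni.

Section blocks.
Context d (T : measurableType d) (R : realType) (P : probability T R).
Variables (E : nat -> set T) (m L : nat) (p q pi delta : R).
Hypothesis mE : forall k, measurable (E k).

Definition no_exceed (j k : nat) : set T := [set s | forall i, (j < i <= k)%N -> ~ E i s].

(* At most one time among [m + 1] consecutive ones qualifies, and ending the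
   cluster forward in time produces [theta_m]. *)
Definition last_of_cluster (k : nat) : set T := E k `&` no_exceed k (k + m)%N.

Lemma measurable_no_exceed j k : measurable (no_exceed j k).
Proof.
have -> : no_exceed j k = \bigcap_i (if (j < i <= k)%N then ~` E i else setT).
  apply/seteqP; split => s h i; first by move=> _; case: ifP => // ji; exact: h.
  by move=> ji; have := h i I; rewrite ji.
by apply: bigcapT_measurable => i; case: ifP => // _; exact: measurableC.
Qed.

Lemma measurable_last_of_cluster k : measurable (last_of_cluster k).
Proof. by apply: measurableI => //; exact: measurable_no_exceed. Qed.

Hypothesis Ep : forall k, prob P (E k) <= p.
Hypothesis Dq : forall k, prob P (last_of_cluster k) = q.
Hypothesis pi0 : 0 <= pi.
Hypothesis delta0 : 0 <= delta.
Hypothesis Epair : forall k k', (k + m < k')%N -> prob P (E k `&` E k') <= pi.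
Hypothesis mix : forall j k, (j + L < k)%N ->
  `|prob P (no_exceed 0 j `&` last_of_cluster k) - prob P (no_exceed 0 j) * q| <= delta.

Let mC := measurable_no_exceed.
Let mL := measurable_last_of_cluster.
Let p0 : 0 <= p. Proof. exact: le_trans (prob_ge0 P _) (Ep 0). Qed.
Let q0 : 0 <= q. Proof. by rewrite -(Dq 0) prob_ge0. Qed.
Let qp : q <= p.
Proof. by rewrite -(Dq 0) (le_trans _ (Ep 0))// le_prob// => ? []. Qed.

(* Losing the [L] first and the [m] last times of a block, its exceedances are
   counted by the ends of clusters, each nearly independent of the past; the
   double counting is controlled by [pi]. *)
Lemma block_step (j b : nat) : (L <= b)%N ->
  `|prob P (no_exceed 0 (j + b)) - prob P (no_exceed 0 j) * (1 - b%:R * q)| <=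
  (2 * L%:R + m%:R) * p + b%:R ^+ 2 * pi + b%:R * delta.
Proof.
move=> Lb; set C := no_exceed 0 j.
pose U := \big[setU/set0]_(i < b) E (j + i.+1)%N.
have mU : measurable U by exact: bigsetU_measurable.
have US s : U s <-> exists2 i, (i < b)%N & E (j + i.+1)%N s.
  rewrite /U -(bigcup_mkord b (fun i => E (j + i.+1)%N)); split.
    by move=> [i /= ib Es]; exists i.
  by move=> [i ib Es]; exists i.
have E1 : prob P (no_exceed 0 (j + b)) = prob P C - prob P (C `&` U).
  have := probD_I P mU (mC 0 j); rewrite -/C.
  have -> : ~` U `&` C = no_exceed 0 (j + b).
    apply/seteqP; split => s.
      move=> [nU Cs] i /andP[i0 ijb].
      have [ij|ij] := leqP i j; first by apply: Cs; rewrite i0.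
      move=> Es; apply: nU; apply/US; exists (i - j).-1; first by lia.
      by have -> : (j + (i - j).-1.+1 = i)%N by lia.
    move=> h; split.
      by move=> /US[i ib]; apply: h; lia.
    by move=> i /andP[i0 ij]; apply: h; lia.
  by rewrite setIC; lra.
(* Ends of cluster after a gap of [L] times, so that each is nearly independent of [C]. *)
pose A k := C `&` last_of_cluster (j + L + k.+1)%N.
have mA k : measurable (A k) by apply: measurableI => //; exact: mC.
pose n := (b - L)%N.
pose SA := \sum_(i < n) prob P (A i).
have nb : n%:R <= b%:R :> R by rewrite ler_nat leq_subr.
have lower : SA <= prob P (C `&` U) + b%:R ^+ 2 * pi.
  apply: (le_trans (bonferroni P n mA)); apply: lerD.
    apply: le_prob; [exact: bigsetU_measurable|by apply: measurableI => //; exact: mC|].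
    move=> s; rewrite -bigcup_mkord => -[k /= kn [Cs [Es _]]]; split => //; apply/US.
    by exists (L + k)%N; [by move: kn; rewrite /n; lia|have -> : (j + (L + k).+1 = j + L + k.+1)%N by lia].
  apply: (@le_trans _ _ (\sum_(k < n) \sum_(i < k) pi)).
    apply: ler_sum => k _; apply: ler_sum => i _.
    (* Two ends of cluster at distance at most [m] exclude each other; only remoter pairs are
       charged [pi]. *)
    have [h|h] := leqP (j + L + k.+1) (j + L + i.+1 + m).
      rewrite (_ : A i `&` A k = set0) ?/prob ?measure0//.
      apply/seteqP; split => s //= [[_ [_ h1]] [_ [h2 _]]].
      by apply: (h1 (j + L + k.+1)%N) => //; have := ltn_ord i; lia.
    apply: le_trans (Epair h); apply: le_prob; [exact: measurableI|exact: measurableI|].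
    by move=> s [[_ [h1 _]] [_ [h2 _]]].
  apply: (@le_trans _ _ (\sum_(k < n) n%:R * pi)).
    apply: ler_sum => k _; rewrite sumr_const card_ord -[leLHS]mulr_natl.
    by apply: ler_wpM2r => //; rewrite ler_nat ltnW.
  rewrite sumr_const card_ord -[leLHS]mulr_natl mulrA -expr2; apply: ler_wpM2r => //.
  by rewrite ler_sqr ?nnegrE.
have upper : prob P (C `&` U) <= (L%:R + m%:R) * p + SA.
  pose B1 := \big[setU/set0]_(i < L) E (j + i.+1)%N.
  pose B2 := \big[setU/set0]_(i < m) E (j + b - i)%N.
  pose B3 := \big[setU/set0]_(i < n) A i.
  have mB1 : measurable B1 by exact: bigsetU_measurable.
  have mB2 : measurable B2 by exact: bigsetU_measurable.
  have mB3 : measurable B3 by exact: bigsetU_measurable.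
  apply: (@le_trans _ _ (prob P (B1 `|` B2 `|` B3))).
    apply: le_prob; [by apply: measurableI => //; exact: mC|by do 2 apply: measurableU => //|].
    move=> s [Cs /US[i0 i0b Ei0]].
    (* The last exceedance of the block lies among its first [L] times, or at distance less than [m]
       from its end, or else it ends a cluster. *)
    pose Q i := (j < i <= j + b)%N && `[< E i s >].
    have exQ : exists i, Q i.
      by exists (j + i0.+1)%N; apply/andP; split; [lia|exact/asboolP].
    have ubQ i : Q i -> (i <= j + b)%N by move=> /andP[/andP[]].
    case: (ex_maxnP exQ ubQ) => k /andP[/andP[jk kb] /asboolP Ek] maxk.
    have [kL|kL] := leqP k (j + L).
      left; left; rewrite /B1 -(bigcup_mkord L (fun i => E (j + i.+1)%N)).
      exists (k - j).-1 => /=; first by lia.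
      by have -> : (j + (k - j).-1.+1 = k)%N by lia.
    have [km|km] := ltnP (j + b) (k + m).
      left; right; rewrite /B2 -(bigcup_mkord m (fun i => E (j + b - i)%N)).
      exists (j + b - k)%N => /=; first by lia.
      by have -> : (j + b - (j + b - k) = k)%N by lia.
    right; rewrite /B3 -bigcup_mkord.
    exists (k - (j + L)).-1 => /=; first by rewrite /n; lia.
    rewrite /A; have -> : (j + L + (k - (j + L)).-1.+1 = k)%N by lia.
    split => //; split => // i /andP[ki ikm] Ei.
    have : (i <= k)%N by apply: maxk; apply/andP; split; [lia|exact/asboolP].
    by rewrite leqNgt ki.
  apply: (le_trans (probU_le P _ mB3)); first exact: measurableU.
  apply: lerD; last exact: (prob_bigU_le P _ (A := fun i : 'I_n => A i)).
  apply: (le_trans (probU_le P mB1 mB2)); rewrite mulrDl; apply: lerD.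
    apply: (le_trans (prob_bigU_le P _ (A := fun i : 'I_L => E (j + i.+1)%N) _)) => //.
    apply: (@le_trans _ _ (\sum_(i < L) p)); first exact: ler_sum.
    by rewrite sumr_const card_ord -[leLHS]mulr_natl.
  apply: (le_trans (prob_bigU_le P _ (A := fun i : 'I_m => E (j + b - i)%N) _)) => //.
  apply: (@le_trans _ _ (\sum_(i < m) p)); first exact: ler_sum.
  by rewrite sumr_const card_ord -[leLHS]mulr_natl.
have SAq : `|SA - n%:R * (prob P C * q)| <= b%:R * delta.
  have -> : n%:R * (prob P C * q) = \sum_(i < n) prob P C * q.
    by rewrite sumr_const card_ord -[RHS]mulr_natl.
  rewrite /SA -sumrB; apply: (le_trans (ler_norm_sum _ _ _)).
  apply: (@le_trans _ _ (\sum_(i < n) delta)).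
    by apply: ler_sum => i _; apply: mix; lia.
  by rewrite sumr_const card_ord -[leLHS]mulr_natl ler_wpM2r.
(* Replacing the [n = b - L] counted times by [b] costs the second [L * p] in the error. *)
have nbL : n%:R = b%:R - L%:R :> R by rewrite /n natrB.
have cq : 0 <= L%:R * (prob P C * q) <= L%:R * p.
  have c1 : prob P C <= 1 by apply: prob_le1; exact: mC.
  have c0 := prob_ge0 P C.
  apply/andP; split; first by rewrite !mulr_ge0.
  apply: ler_wpM2l => //; apply: le_trans qp; exact: ler_piMl.
have Lp : 0 <= L%:R * p by rewrite mulr_ge0.
have mp : 0 <= m%:R * p by rewrite mulr_ge0.
have bpi : 0 <= b%:R ^+ 2 * pi by rewrite mulr_ge0.
move: SAq cq; rewrite E1 nbL !ler_norml => /andP[s1 s2] /andP[c1 c2].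
by apply/andP; split; lra.
Qed.

(** Errors of successive blocks add up without amplification because [1 - b%:R * q] lies between 0
    and 1. *)
Lemma blocks (b N : nat) : (L <= b)%N -> b%:R * q <= 1 ->
  `|prob P (no_exceed 0 (N * b)) - (1 - b%:R * q) ^+ N| <=
  N%:R * ((2 * L%:R + m%:R) * p + b%:R ^+ 2 * pi + b%:R * delta).
Proof.
move=> Lb bq; set err := (_ + _ + _).
have bq0 : 0 <= b%:R * q by rewrite mulr_ge0.
elim: N => [|N IH].
  rewrite mul0n expr0 mul0r (_ : no_exceed 0 0 = setT) ?probT ?subrr ?normr0//.
  by apply/seteqP; split => // s _ i; lia.
have := block_step (N * b) Lb; rewrite -/err => step.
rewrite mulSn addnC; set a1 := prob P _ in step *.
have -> : a1 - (1 - b%:R * q) ^+ N.+1 = (a1 - prob P (no_exceed 0 (N * b)) * (1 - b%:R * q))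
   + (prob P (no_exceed 0 (N * b)) - (1 - b%:R * q) ^+ N) * (1 - b%:R * q).
  by rewrite exprSr; ring.
have -> : N.+1%:R * err = err + N%:R * err by rewrite -natr1; ring.
apply: (le_trans (ler_normD _ _)); apply: lerD; first exact: step.
rewrite normrM; apply: le_trans IH; rewrite ler_piMr// ger0_norm; lra.
Qed.

End blocks.
(** * Decay of the filter and choice of the gaps *)

Section decay.
Context (R : realType).

(* The derivative of [- 1 / ln] is [1 / (x ln^2 x)]. *)
Lemma inv_xln2_le (l : nat) : (2 < l)%N ->
  (l%:R * ln l%:R ^+ 2)^-1 <= (ln l.-1%:R)^-1 - (ln l%:R)^-1 :> R.
Proof.
move=> l2.
have l0 : 0 < l%:R :> R by rewrite ltr0n; lia.
have k1 : 1 < l.-1%:R :> R by rewrite ltr1n; lia.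
have k0 : 0 < l.-1%:R :> R := lt_trans ltr01 k1.
have lk : l.-1%:R = l%:R - 1 :> R by rewrite -subn1 natrB//; lia.
have lnk : 0 < ln l.-1%:R :> R by exact: ln_gt0.
have lnkl : ln l.-1%:R <= ln l%:R :> R by rewrite ler_ln ?posrE// ler_nat; lia.
have lnl : 0 < ln l%:R :> R := lt_le_trans lnk lnkl.
have gap : l%:R^-1 <= ln l%:R - ln l.-1%:R :> R.
  have -> : ln l.-1%:R = ln (1 + - l%:R^-1) + ln l%:R :> R.
    rewrite -lnM ?posrE ?subr_gt0 ?invf_lt1// ?ltr1n; last by lia.
    by congr ln; rewrite mulrDl mul1r mulNr mulVf ?gt_eqF// lk.
  have l1 : -1 < - l%:R^-1 :> R by rewrite ltrN2 invf_lt1// ltr1n; lia.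
  by have := le_ln1Dx l1; lra.
rewrite invfM -[(ln l.-1%:R)^-1]mul1r -[(ln l%:R)^-1]mul1r.
have -> : 1 / ln l.-1%:R - 1 / ln l%:R = (ln l%:R - ln l.-1%:R) * (ln l%:R * ln l.-1%:R)^-1 :> R.
  by field; rewrite !gt_eqF.
apply: ler_pM; rewrite ?invr_ge0 ?sqr_ge0// ?ler0n//.
by rewrite lef_pV2 ?posrE ?exprn_gt0 ?mulr_gt0// expr2 ler_pM2l.
Qed.

Lemma sum_inv_xln2_le (L N : nat) : (2 < L)%N ->
  \sum_(l < N | (L <= l)%N) (l%:R * ln l%:R ^+ 2)^-1 <= (ln L.-1%:R)^-1 :> R.
Proof.
move=> L2.
suff : \sum_(l < N | (L <= l)%N) (l%:R * ln l%:R ^+ 2)^-1 <=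
       (ln L.-1%:R)^-1 - (ln (maxn L N).-1%:R)^-1 :> R.
  have : 0 <= (ln (maxn L N).-1%:R)^-1 :> R by rewrite invr_ge0 ln_ge0// ler1n; lia.
  by lra.
elim: N => [|N IH]; first by rewrite big_ord0 maxn0 subrr.
rewrite big_mkcond big_ord_recr -big_mkcond /=.
have [LN|LN] := leqP L N; last first.
  by rewrite addr0; move: IH; have -> : maxn L N.+1 = maxn L N by lia.
have := @inv_xln2_le N; rewrite (leq_trans L2 LN) => /(_ isT).
move: IH; have -> : maxn L N = N by lia.
have -> : (maxn L N.+1).-1 = N by lia.
lra.
Qed.

Lemma tailsq_decay (d0 : nat) (Psi : nat -> 'M[R]_d0) :
  (forall i j : 'I_d0, (fun l : nat => Psi l i j) =o_\oo
       (fun l : nat => (Num.sqrt l%:R)^-1 * (ln l%:R)^-1)) ->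
  forall e : R, 0 < e ->
  \forall L \near \oo, forall N i, tailsq Psi L N i * ln L%:R <= e.
Proof.
move=> dec e e0.
(* The [d0] columns and the factor 2 between [ln L] and [ln L.-1] enter the bound; [d0.+1] avoids a
   zero denominator. *)
pose e1 := Num.sqrt (e / (2 * d0.+1%:R)).
have e10 : 0 < e1 by rewrite sqrtr_gt0 divr_gt0// mulr_gt0.
have [L0 HL0] : exists L0 : nat, forall l, (L0 <= l)%N -> forall i j,
    `|Psi l i j| <= e1 * `|(Num.sqrt l%:R)^-1 * (ln l%:R)^-1|.
  have H i j : \forall l \near \oo, `|Psi l i j| <= e1 * `|(Num.sqrt l%:R)^-1 * (ln l%:R)^-1|.
    by move/eqoP : (dec i j) => /(_ e1 e10).
  have : \forall l \near \oo, forall i j, `|Psi l i j| <= e1 * `|(Num.sqrt l%:R)^-1 * (ln l%:R)^-1|.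
    by apply: filter_forall => i; apply: filter_forall => j; exact: H.
  by move=> [L0 _ h]; exists L0 => l L0l; exact: h.
exists (maxn L0 3) => // L /= L0L N i.
have L3 : (2 < L)%N by lia.
have L0' : (L0 <= L)%N by lia.
clear L0L.
have lnL : 0 < ln L%:R :> R by rewrite ln_gt0// ltr1n; lia.
have lnL1 : 0 < ln L.-1%:R :> R by rewrite ln_gt0// ltr1n; lia.
have b1 : tailsq Psi L N i <= \sum_(l < N | (L <= l)%N) d0%:R * (e1 ^+ 2 * (l%:R * ln l%:R ^+ 2)^-1).
  apply: ler_sum => l Ll.
  apply: (@le_trans _ _ (\sum_(j < d0) e1 ^+ 2 * (l%:R * ln l%:R ^+ 2)^-1)); last first.
    by rewrite sumr_const card_ord -[leLHS]mulr_natl.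
  apply: ler_sum => j _.
  have := HL0 _ (leq_trans L0' Ll) i j.
  have v0 : 0 <= e1 * `|(Num.sqrt l%:R)^-1 * (ln l%:R)^-1| by rewrite mulr_ge0// ltW.
  move=> h; have := lerXn2r 2 (normr_ge0 (Psi l i j)) v0 h.
  rewrite real_normK ?num_real// exprMn real_normK ?num_real//.
  by rewrite [in X in _ <= X -> _]exprMn !exprVn (sqr_sqrtr (ler0n R l)) -invfM.
(* Because [L] is at most the square of [L.-1] once [L >= 3]. *)
have lnL2 : ln L%:R <= 2 * ln L.-1%:R :> R.
  rewrite mulr_natl -lnXn ?ltr0n ?ler_ln ?posrE ?exprn_gt0 ?ltr0n//; [|lia..].
  by rewrite -natrX ler_nat; nia.
have b2 : tailsq Psi L N i <= d0%:R * e1 ^+ 2 * (ln L.-1%:R)^-1.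
  apply: (le_trans b1); rewrite -mulr_sumr -mulr_sumr mulrA.
  by apply: ler_wpM2l; [rewrite mulr_ge0 ?ler0n ?sqr_ge0|exact: sum_inv_xln2_le].
apply: (@le_trans _ _ (d0%:R * e1 ^+ 2 * (ln L.-1%:R)^-1 * (2 * ln L.-1%:R))).
  apply: ler_pM => //; [|exact: ltW].
  by apply: sumr_ge0 => l _; apply: sumr_ge0 => j _; exact: sqr_ge0.
have -> : d0%:R * e1 ^+ 2 * (ln L.-1%:R)^-1 * (2 * ln L.-1%:R) = 2 * d0%:R * e1 ^+ 2.
  by field; rewrite gt_eqF.
have d1 : 0 < 2 * d0.+1%:R :> R by rewrite mulr_gt0.
rewrite sqr_sqrtr; last by apply: ltW; rewrite divr_gt0.
rewrite [leLHS]mulrA ler_pdivrMr// [leLHS]mulrC ler_pM2l// ler_pM2l// ler_nat; lia.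
Qed.

End decay.

Section small_mixing.
Context (R : realType).

Lemma expR_sub1_le (y : R) : 0 <= y -> y <= 1 / 2 -> expR y - 1 <= 2 * y.
Proof.
move=> y0 y1.
have e1 : expR y * expR (- y) = 1 by rewrite -expRD subrr expR0.
have e2 : 1 - y <= expR (- y) by exact: expR_ge1Dx.
have e3 := expR_gt0 y; nra.
Qed.

Lemma half_le_ln (n : nat) : (2 <= n)%N -> 1 / 2 <= ln n%:R :> R.
Proof.
move=> n2; have n0 : 0 < n%:R :> R by rewrite ltr0n; lia.
have h : n%:R^-1 <= 1 / 2 :> R.
  by rewrite div1r lef_pV2 ?posrE// ler_nat.
have i0 : 0 < n%:R^-1 :> R by rewrite invr_gt0.
have i1 : -1 < n%:R^-1 - 1 :> R by lra.
by have := le_ln1Dx i1; rewrite addrCA subrr addr0 lnV ?posrE//; lra.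
Qed.

(** Everything is controlled by the product [sg * r]: as [r >= 1], [sg] itself is at most that
    product, so fixing it at a small [x] bounds each term by a multiple of [x]. *)
Lemma small_defect (I : choiceType) (W : seq I) (e : R) : 0 < e ->
  exists2 x : R, 0 < x & forall sg r, 0 < sg -> 1 <= r -> sg * r = x ->
    [/\ sg ^+ 2 <= 1 / 4, weight_defect W sg r <= 1 / 2 &
        weight_defect W sg r + (expR (sg ^+ 2 * r ^+ 2 / 2) - 1) <= e].
Proof.
move=> e0; pose a : R := (size W)%:R * (8 * expR (1 / 2)).
have a0 : 0 <= a by rewrite !mulr_ge0 ?expR_ge0.
pose D := 2 * a + 2; have D0 : 0 < D by rewrite /D; lra.
pose c := Num.min e (1 / 2).
have c0 : 0 < c by rewrite lt_min e0/=; lra.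
have ce : c <= e by rewrite ge_min lexx.
have c1 : c <= 1 / 2 by rewrite ge_min lexx orbT.
exists (c / D); first exact: divr_gt0.
move=> sg r sg0 r1 sr; set x := c / D in sr.
have x0 : 0 < x by exact: divr_gt0.
have xD : x * D = c by rewrite /x mulfVK ?gt_eqF.
have D2 : 2 <= D by rewrite /D; lra.
have x4 : x <= 1 / 4 by have : x * 2 <= x * D; [rewrite ler_pM2l|lra].
have sx : sg <= x by rewrite -sr ler_peMr// ltW.
have sx2 : sg ^+ 2 <= x ^+ 2 by rewrite lerXn2r ?nnegrE// ltW.
have x2x : x ^+ 2 <= x * (1 / 4) by rewrite expr2 ler_pM2l.
have sq : sg ^+ 2 <= x by lra.
have wd : weight_defect W sg r <= (2 * a + 1) * x.
  rewrite /weight_defect -/a sr.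
  have : a * (x + sg ^+ 2) <= a * (x + x) by apply: ler_wpM2l => //; lra.
  lra.
have ex : expR (sg ^+ 2 * r ^+ 2 / 2) - 1 <= x.
  have -> : sg ^+ 2 * r ^+ 2 = x ^+ 2 by rewrite -exprMn sr.
  have x20 : 0 <= x ^+ 2 by exact: sqr_ge0.
  apply: (le_trans (@expR_sub1_le (x ^+ 2 / 2) _ _)); lra.
have ax : 0 <= a * x by rewrite mulr_ge0// ltW.
move: xD; rewrite /D => xD; split; lra.
Qed.

End small_mixing.

Section process_small.
Context (R : realType) (d0 : nat) (Psi : nat -> 'M[R]_d0).
Hypothesis Psi0 : Psi 0%N \in unitmx.
Local Notation I := ((int * 'I_d0)%type : choiceType).
Local Notation S := (seqspace R I).
Variable mu : probability S R.
Hypothesis muP : iid_gauss mu.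
Hypothesis Hcv : {ae mu, forall s, converges Psi s}.
Local Notation past tau := (predC (@future d0 tau)).
Hypothesis d00 : (0 < d0)%N.
Hypothesis decay : forall e : R, 0 < e ->
  \forall L \near \oo, forall N i, tailsq Psi L N i * ln L%:R <= e.

(* The gap [L] is at least of the order of a power of [n], so [ln n / ln L]
   stays bounded and the truncation radius [4 sqrt (ln n)] is affordable. *)
Lemma process_mixing_small (w kappa : nat) (e : R) : 0 < e ->
  exists n0 : nat, forall n L : nat, (n0 <= n)%N -> (n < (2 * L) ^ kappa)%N ->
  forall (tau tau0 : int) (A C : set S),
  tau <= tau0 -> L%:Z <= tau0 - tau + 1 ->
  measurable A -> dep (fun c => tau0 <= c.1 <= tau0 + w%:Z) A ->
  measurable C -> dep (past tau) C ->
  `|prob mu (C `&` Xpath Psi @^-1` A) - prob mu C * prob mu (Xpath Psi @^-1` A)|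
    <= e * (prob mu (Xpath Psi @^-1` A) + n%:R^-1).
Proof.
move=> e0; have e80 : 0 < Num.min e 1 / 8 by rewrite divr_gt0// lt_min e0/=.
have e8e : Num.min e 1 / 8 <= e / 8 by rewrite ler_pM2r// ge_min lexx.
have e81 : Num.min e 1 / 8 <= 1 / 8 by rewrite ler_pM2r// ge_min lexx orbT.
have [x x0 hx] := small_defect (window d0 0 w) e80.
pose M := mix_scale Psi w.
have M0 : 0 < M.
  have p1 := phi_bound_ge1 Psi w.
  by rewrite /M /mix_scale !mulr_gt0 ?ltr0n ?muln_gt0//; apply: lt_le_trans p1.
(* With [r ^+ 2 = 16 * ln n] and [ln n <= kappa.+1 * (2 * ln L)], this level makes the tail variance
   at most [sg ^+ 2] for [sg = x / (M * r)]. *)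
pose e2 := x ^+ 2 / (32 * M ^+ 2 * kappa.+1%:R).
have den0 : 0 < 32 * M ^+ 2 * kappa.+1%:R by do 2 apply: mulr_gt0 => //; exact: exprn_gt0.
have e20 : 0 < e2 by rewrite divr_gt0// exprn_gt0.
have [L0 _ HL0] := decay e20.
pose K : R := 2 ^+ (w.+1 * d0).
have K0 : 0 < K by rewrite exprn_gt0.
(* The middle entry forces [L] to be large through [n < (2 * L) ^ kappa]; the last one absorbs the
   constant [K] of the Gaussian tail into a small multiple of 1/n. *)
exists (maxn 4 (maxn ((2 * maxn L0 2) ^ kappa) (Num.truncn (3 * K / e)).+1)).
move=> n L hn nL tau tau0 A C tt Lt mA dA mC dC.
have n4 : (4 <= n)%N by apply: leq_trans hn; rewrite leq_max.
have kap0 : (0 < kappa)%N by case: kappa nL {e2 den0 e20 HL0 hn} => //; rewrite expn0; lia.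
have [L0L L2] : (L0 <= L /\ 2 <= L)%N.
  have : ((2 * maxn L0 2) ^ kappa < (2 * L) ^ kappa)%N.
    by apply: leq_ltn_trans nL; apply: leq_trans hn; rewrite !leq_max leqnn orbT.
  by rewrite ltn_exp2r// ltn_mul2l /= gtn_max => /andP[/ltnW -> /ltnW ->].
have nK : 3 * K / e <= n%:R.
  apply: ltW; apply: (lt_le_trans (truncnS_gt (3 * K / e))); rewrite ler_nat.
  by apply: leq_trans hn; rewrite !leq_max leqnn !orbT.
have n2 : (2 <= n)%N by exact: leq_trans n4.
have n0 : 0 < n%:R :> R by rewrite ltr0n ltnW.
have L0r : 0 < L%:R :> R by rewrite ltr0n ltnW.
have lnn : 1 / 2 <= ln n%:R :> R by exact: half_le_ln.
have lnL : 1 / 2 <= ln L%:R :> R by exact: half_le_ln.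
have L2L : (2 * L <= L ^ 2)%N by rewrite -mulnn leq_mul2r L2 orbT.
have L20 : (0 < 2 * L)%N by rewrite muln_gt0 (ltnW L2).
have lnnL : ln n%:R <= kappa.+1%:R * (2 * ln L%:R) :> R.
  apply: (@le_trans _ _ (kappa%:R * ln (2 * L)%:R)).
    rewrite mulr_natl -lnXn ?ltr0n// -natrX ler_ln ?posrE ?ltr0n ?expn_gt0 ?L20//.
    by rewrite ler_nat ltnW.
    exact: ltnW.
  apply: ler_pM => //; [by rewrite ln_ge0// ler1n|by rewrite ler_nat|].
  rewrite mulr_natl -lnXn// ler_ln ?posrE ?exprn_gt0//; last by rewrite ltr0n.
  by rewrite -natrX ler_nat.
(* For this radius [expR (- (r ^+ 2 / 4))] is the fourth power of 1/n. *)
pose r := 4 * Num.sqrt (ln n%:R : R).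
have ln0 : 0 <= ln n%:R :> R by lra.
have r2 : r ^+ 2 = 16 * ln n%:R by rewrite /r exprMn sqr_sqrtr//; ring.
have r0 : 0 <= r by rewrite mulr_ge0// sqrtr_ge0.
have r1 : 1 <= r by rewrite -(@ler_pXn2r _ 2)// ?nnegrE// expr1n r2; lra.
have rp : 0 < r by lra.
pose sg := x / (M * r).
have sg0 : 0 < sg by rewrite divr_gt0// mulr_gt0.
have sgr : M * sg * r = x by rewrite /sg; field; rewrite !gt_eqF.
have tl : forall N i, tailsq Psi L N i <= sg ^+ 2.
  move=> N i; have t0 : 0 <= tailsq Psi L N i.
    by apply: sumr_ge0 => l _; apply: sumr_ge0 => j _; exact: sqr_ge0.
  have hL := HL0 L L0L N i.
  have Mr2 : 0 < (M * r) ^+ 2 by apply: exprn_gt0; exact: mulr_gt0.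
  rewrite /sg expr_div_n (ler_pdivlMr _ _ Mr2).
  rewrite [(M * r) ^+ 2]exprMn r2.
  have e2E : e2 * (32 * M ^+ 2 * kappa.+1%:R) = x ^+ 2 by rewrite /e2 mulfVK// gt_eqF.
  rewrite -e2E.
  apply: (@le_trans _ _ (tailsq Psi L N i * ln L%:R * (32 * M ^+ 2 * kappa.+1%:R))).
    have -> : tailsq Psi L N i * ln L%:R * (32 * M ^+ 2 * kappa.+1%:R) =
              tailsq Psi L N i * (M ^+ 2 * (16 * (kappa.+1%:R * (2 * ln L%:R)))) by ring.
    by do 3 (apply: ler_wpM2l => //; rewrite ?sqr_ge0//).
  by apply: ler_wpM2r hL; exact: ltW.
have Msg : 0 < M * sg by exact: mulr_gt0.
have [h1 h2 h3] := hx (M * sg) r Msg r1 sgr.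
have wdE : weight_defect (window d0 tau0 w) (M * sg) r =
           weight_defect (window d0 0 w) (M * sg) r.
  by rewrite /weight_defect !size_window.
have := @process_mixing R d0 Psi mu muP Hcv Psi0 tau tau0 w L sg r A C
  d00 tt Lt sg0 tl mA dA mC dC rp.
rewrite /= -/M wdE => /(_ h1 h2) /le_trans; apply.
set p := prob mu (Xpath Psi @^-1` A).
have p0 : 0 <= p := prob_ge0 _ _.
have tlE : sumsq_tail (window d0 tau0 w) r = K * (n%:R^-1) ^+ 4.
  rewrite /sumsq_tail size_window r2 -/K; congr (_ * _).
  have -> : 16 * ln n%:R / 4 = 4%:R * ln n%:R :> R by field.
  by rewrite expRN expRM_natl lnK ?posrE// exprVn.
set y : R := n%:R^-1 in tlE *.
have y0 : 0 < y by rewrite invr_gt0.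
have y1 : y <= 1 by rewrite invf_le1// ler1n ltnW.
have tlb : 3 * (K * y ^+ 4) <= e * y.
  have Ky : 3 * K * y <= e by rewrite /y ler_pdivrMr// [leRHS]mulrC -ler_pdivrMr.
  have -> : 3 * (K * y ^+ 4) = (3 * K * y) * y * (y ^+ 2) by ring.
  have y2 : y ^+ 2 <= 1 by rewrite exprn_ile1// ltW.
  apply: (@le_trans _ _ ((3 * K * y) * y)); last by rewrite ler_pM2r.
  by rewrite ler_piMr// !mulr_ge0// ltW.
rewrite tlE; have Ky0 : 0 <= K * y ^+ 4 by rewrite mulr_ge0 ?exprn_ge0// ltW.
set t := K * y ^+ 4 in tlb Ky0 *.
set dd := _ + (_ - 1) in h3 *.
have dd0 : dd * (2 * p + 2 * t) <= Num.min e 1 / 8 * (2 * p + 2 * t).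
  by apply: ler_wpM2r => //; lra.
set c := Num.min e 1 / 8 in e8e e81 dd0 *.
have c1 : c * p <= e / 8 * p by exact: ler_wpM2r.
have c2 : c * t <= 1 / 8 * t by exact: ler_wpM2r.
have ep : 0 <= e * p by rewrite mulr_ge0// ltW.
lra.
Qed.

End process_small.

Section scale.

(* A power of two [L] with [L ^ kappa <= n < (2 L) ^ kappa]. *)
Definition log_root (kappa n : nat) : nat := (2 ^ (trunc_log 2 n %/ kappa))%N.

Lemma log_root_le kappa n : (0 < n)%N -> (log_root kappa n ^ kappa <= n)%N.
Proof.
move=> n0; apply: leq_trans (trunc_logP (isT : (1 < 2)%N) n0).
by rewrite /log_root -expnM leq_exp2l// leq_trunc_div.
Qed.

Lemma log_root_gt kappa n : (0 < kappa)%N -> (n < (2 * log_root kappa n) ^ kappa)%N.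
Proof.
move=> k0; apply: (leq_trans (trunc_log_ltn n (isT : (1 < 2)%N))).
by rewrite /log_root -expnS -expnM leq_exp2l// -ltn_divLR//.
Qed.

Lemma log_root_gt0 kappa n : (0 < log_root kappa n)%N.
Proof. by rewrite expn_gt0. Qed.

Lemma log_root_large kappa (A n : nat) : (0 < kappa)%N -> ((2 * A) ^ kappa <= n)%N ->
  (A < log_root kappa n)%N.
Proof.
move=> k0 An; have := leq_ltn_trans An (log_root_gt n k0).
by rewrite ltn_exp2r// ltn_mul2l.
Qed.

End scale.

Section exponential_limit.
Context (R : realType).

Lemma onem_ge_exp (x : R) : 0 <= x -> x <= 1 / 2 -> expR (- (x + 2 * x ^+ 2)) <= 1 - x.
Proof.
move=> x0 x1; have x2 : 0 < 1 - x by lra.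
rewrite expRN -[leRHS]invrK lef_pV2 ?posrE ?expR_gt0 ?invr_gt0//.
apply: le_trans (expR_ge1Dx _).
rewrite -[leLHS]mul1r ler_pdivrMr//.
have -> : (1 + (x + 2 * x ^+ 2)) * (1 - x) = 1 + x ^+ 2 * (1 - 2 * x) by ring.
by rewrite lerDl mulr_ge0 ?sqr_ge0//; lra.
Qed.

Lemma cvg_expR (f : nat -> R) (l : R) : f n @[n --> \oo] --> l ->
  expR (f n) @[n --> \oo] --> expR l.
Proof. by move=> fl; apply: (cvg_comp f expR fl); exact: continuous_expR. Qed.

Lemma cvg_onem_exp (x : nat -> R) (N : nat -> nat) (c : R) :
  (\forall n \near \oo, 0 <= x n) -> x n @[n --> \oo] --> 0 ->
  (N n)%:R * x n @[n --> \oo] --> c ->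
  (1 - x n) ^+ N n @[n --> \oo] --> expR (- c).
Proof.
move=> x0 xl Nx.
have x12 : \forall n \near \oo, x n <= 1 / 2.
  have h12 : 0 < 1 / 2 :> R by lra.
  move/cvgrPdist_le: xl => /(_ _ h12); apply: filterS => n.
  by rewrite sub0r normrN ler_norml => /andP[].
apply: (@squeeze_cvgr _ _ _ _
  (fun n => expR (- ((N n)%:R * x n + 2 * ((N n)%:R * x n) * x n)))
  (fun n => expR (- ((N n)%:R * x n)))).
- apply: filterS2 x0 x12 => n xn0 xn1; apply/andP; split.
    have -> : (N n)%:R * x n + 2 * ((N n)%:R * x n) * x n = (N n)%:R * (x n + 2 * x n ^+ 2) by ring.
    rewrite -mulrN expRM_natl; apply: lerXn2r; rewrite ?nnegrE ?expR_ge0//; first by lra.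
    exact: onem_ge_exp.
  rewrite -mulrN expRM_natl; apply: lerXn2r; rewrite ?nnegrE ?expR_ge0//; first by lra.
  exact: expR_ge1Dx.
- apply: cvg_expR; apply: cvgN; rewrite -[X in _ --> X]addr0 -(mulr0 (2 * c)); apply: cvgD => //.
  by apply: cvgM => //; apply: cvgM => //; exact: cvg_cst.
- by apply: cvg_expR; exact: cvgN.
Qed.

End exponential_limit.

(** * Limit of the probability of no exceedance *)

Section extremes.
Context d (T : measurableType d) (R : realType) (P : probability T R).
Variables (E : nat -> nat -> set T) (m : nat) (p q : nat -> R) (c b : R) (eta C : R).
Hypothesis mE : forall n k, measurable (E n k).
Hypothesis Ep : forall n k, prob P (E n k) = p n.
Hypothesis Eq : forall n k, prob P (last_of_cluster (E n) m k) = q n.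
Hypothesis p_cvg : n%:R * p n @[n --> \oo] --> c.
Hypothesis q_cvg : n%:R * q n @[n --> \oo] --> b.
Hypothesis eta0 : 0 < eta.
Hypothesis C0 : 0 < C.
Hypothesis pair : forall n k k' y, (k + m < k')%N -> 0 <= y -> p n <= expR (- y) ->
  prob P (E n k `&` E n k') <= C * expR (- ((1 + eta) * y)).
Hypothesis mixing : forall kappa e, 0 < e -> exists n0 : nat, forall n L : nat,
  (n0 <= n)%N -> (n < (2 * L) ^ kappa)%N -> forall j k, (j + L + m < k)%N ->
  `|prob P (no_exceed (E n) 0 j `&` last_of_cluster (E n) m k) -
    prob P (no_exceed (E n) 0 j) * q n| <= e * (p n + n%:R^-1).

Let p0 n : 0 <= p n. Proof. by rewrite -(Ep n 0) prob_ge0. Qed.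
Let q0 n : 0 <= q n. Proof. by rewrite -(Eq n 0) prob_ge0. Qed.
Let qp n : q n <= p n.
Proof.
rewrite -(Eq n 0) -(Ep n 0) le_prob//; last by move=> ? [].
exact: measurable_last_of_cluster.
Qed.

Let c0 : 0 <= c.
Proof.
apply: (cvgr_to_ge p_cvg).
by apply: nearW => n; rewrite mulr_ge0.
Qed.

Lemma no_exceed_remainder n j k : (j <= k)%N ->
  `|prob P (no_exceed (E n) 0 k) - prob P (no_exceed (E n) 0 j)| <= (k - j)%:R * p n.
Proof.
move=> jk; have mN i := measurable_no_exceed (mE n) 0 i.
have le1 : prob P (no_exceed (E n) 0 k) <= prob P (no_exceed (E n) 0 j).
  by apply: le_prob => // s h i /andP[i0 ij]; apply: h; rewrite i0 (leq_trans ij jk).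
pose U := \big[setU/set0]_(i < k - j) E n (j + i.+1)%N.
have mU : measurable U by exact: bigsetU_measurable.
have : prob P (no_exceed (E n) 0 j) <= prob P (no_exceed (E n) 0 k `|` U).
  apply: le_prob => //; first exact: measurableU.
  move=> s h; have [Us|nU] := pselect (U s); [by right|left => i /andP[i0 ik] Ei].
  have [ij|ij] := leqP i j; first by apply: (h i) => //; rewrite i0.
  apply: nU; rewrite /U -(bigcup_mkord (k - j) (fun i => E n (j + i.+1)%N)).
  exists (i - j).-1 => /=; first by lia.
  by have -> : (j + (i - j).-1.+1 = i)%N by lia.
have := probU_le P (mN k) mU.
have : prob P U <= (k - j)%:R * p n.
  apply: (le_trans (prob_bigU_le P _ (A := fun i : 'I_(k - j) => E n (j + i.+1)%N) _)) => //.
  by under eq_bigr do rewrite Ep; rewrite sumr_const card_ord -[leLHS]mulr_natl.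
by rewrite ler_norml => h1 h2 h3; apply/andP; split; lra.
Qed.

(** [kappa >= 3] gives [L ^ 3 <= n], so that a block of length [L ^ 2] contains an exceedance with
    probability of order 1/L; [kappa >= 4 / eta] gives [L ^ 3 <= n ^ eta], so that pairs within
    blocks are negligible. *)
Let kappa := (Num.truncn (4 / eta) + 3)%N.
Let L n := log_root kappa n.
Let bl n := (L n ^ 2)%N.
Let N n := (n %/ bl n)%N.

Let kappa0 : (0 < kappa)%N. Proof. by rewrite /kappa addn3. Qed.
Let L0 n : 0 < (L n)%:R :> R. Proof. by rewrite ltr0n log_root_gt0. Qed.
Let Linv0 n : 0 < (L n)%:R^-1 :> R. Proof. by rewrite invr_gt0. Qed.
Let blE n : (bl n)%:R = (L n)%:R ^+ 2 :> R. Proof. by rewrite /bl natrX. Qed.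
Let N_le n : (N n)%:R * (bl n)%:R <= n%:R :> R.
Proof. by rewrite -natrM ler_nat leq_trunc_div. Qed.

Let L_large A : \forall n \near \oo, (A <= L n)%N.
Proof.
exists ((2 * A) ^ kappa)%N => // n /= An; apply: ltnW; exact: log_root_large.
Qed.

Let Linv_cvg : (L n)%:R^-1 @[n --> \oo] --> (0 : R).
Proof.
apply/cvgrPdist_le => e e0.
apply: filterS (L_large (Num.truncn e^-1).+1) => n nL.
rewrite sub0r normrN ger0_norm; last exact: ltW.
rewrite -[leRHS]invrK lef_pV2 ?posrE ?invr_gt0//.
by apply: ltW; apply: (lt_le_trans (truncnS_gt e^-1)); rewrite ler_nat.
Qed.

Let L3 n : (0 < n)%N -> (L n)%:R ^+ 3 <= n%:R :> R.
Proof.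
move=> n0; rewrite -natrX ler_nat; apply: leq_trans (log_root_le kappa n0).
by rewrite leq_pexp2l// ?log_root_gt0// /kappa leq_addl.
Qed.

Let L_exp n : (0 < n)%N -> (L n)%:R ^+ 3 <= expR (eta * ln n%:R).
Proof.
move=> n0.
have nr0 : 0 < n%:R :> R by rewrite ltr0n.
have lnn : 0 <= ln n%:R :> R by rewrite ln_ge0// ler1n.
have lnL : 0 <= ln (L n)%:R :> R by rewrite ln_ge0// ler1n log_root_gt0.
have h : kappa%:R * ln (L n)%:R <= ln n%:R :> R.
  rewrite mulr_natl -lnXn// ler_ln ?posrE ?exprn_gt0//.
  by rewrite -natrX ler_nat; exact: log_root_le.
have k4 : 4 / eta <= kappa%:R.
  apply: ltW; apply: (lt_le_trans (truncnS_gt (4 / eta))); by rewrite ler_nat /kappa addn3 ltnS ltnW.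
have h4 : 4 * ln (L n)%:R <= eta * ln n%:R :> R.
  apply: (@le_trans _ _ (eta * (kappa%:R * ln (L n)%:R))); last by rewrite ler_pM2l.
  by rewrite mulrA; apply: ler_wpM2r => //; rewrite mulrC -ler_pdivrMr.
have -> : (L n)%:R ^+ 3 = expR (3%:R * ln (L n)%:R) :> R by rewrite expRM_natl lnK ?posrE.
by rewrite ler_expR; lra.
Qed.

Let K := ln (c + 1).
Let expK : expR K = c + 1. Proof. by rewrite lnK// posrE; have := c0; lra. Qed.

Let np_bound : \forall n \near \oo, n%:R * p n <= c + 1.
Proof.
move/cvgrPdist_le : p_cvg => /(_ _ ltr01); apply: filterS => n.
by rewrite ler_norml => /andP[h1 h2]; lra.
Qed.

(** Coefficients of 1/L in the error, in order: gaps and ends of blocks, pairs counted twice, and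
    the incomplete last block. *)
Let Kb := (2 + 3 * m%:R) * (c + 1) + C * expR ((1 + eta) * K) + (c + 1).

Let block_bound (e : R) : 0 < e -> \forall n \near \oo,
  `|prob P (no_exceed (E n) 0 n) - (1 - (bl n)%:R * q n) ^+ N n|
  <= Kb * (L n)%:R^-1 + e * (c + 2).
Proof.
move=> e0; have [n0 mix0] := mixing kappa e0.
have near_n0 : \forall n \near \oo, (maxn n0 (maxn 1 (Num.truncn (c + 1)).+1) <= n)%N by exists (maxn n0 (maxn 1 (Num.truncn (c + 1)).+1)).
apply: filterS3 near_n0 np_bound (L_large (maxn (m + 2) (Num.truncn (c + 1)).+1)) => n hn np Lm.
have n0n : (n0 <= n)%N by apply: leq_trans hn; rewrite leq_max leqnn.
have n_gt0 : (0 < n)%N by apply: leq_trans hn; rewrite !leq_max orbT.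
have nc : c + 1 <= n%:R.
  apply: ltW; apply: (lt_le_trans (truncnS_gt (c + 1))); rewrite ler_nat.
  by apply: leq_trans hn; rewrite !leq_max leqnn !orbT.
have nr0 : 0 < n%:R :> R by rewrite ltr0n.
pose l : R := (L n)%:R; have l0 : 0 < l by exact: L0.
have l1 : 1 <= l by rewrite ler1n log_root_gt0.
have li0 : 0 < l^-1 by rewrite invr_gt0.
(* Chosen so that [expR (- y) = (c + 1) / n], an upper bound for [p n]. *)
pose y : R := ln n%:R - K.
have y0 : 0 <= y by rewrite subr_ge0 ler_ln ?posrE//; have := c0; lra.
have expy : expR (- y) = (c + 1) / n%:R.
  by rewrite /y opprB expRD expK expRN lnK ?posrE.
have py : p n <= expR (- y) by rewrite expy ler_pdivlMr// mulrC.
pose pi := C * expR (- ((1 + eta) * y)).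
have pi0 : 0 <= pi by rewrite mulr_ge0 ?expR_ge0 ?ltW.
pose delta := e * (p n + n%:R^-1).
have delta0 : 0 <= delta by apply: mulr_ge0; [exact: ltW|apply: addr_ge0 => //; rewrite invr_ge0].
have npi : n%:R * l ^+ 3 * pi <= C * expR ((1 + eta) * K).
  have -> : C * expR ((1 + eta) * K) = n%:R * expR (eta * ln n%:R) * pi.
    rewrite /pi mulrCA; congr (_ * _).
    rewrite -{1}(@lnK _ n%:R) ?posrE// -!expRD; congr expR; rewrite /y; ring.
  by apply: ler_wpM2r => //; rewrite ler_pM2l//; exact: L_exp.
have lp : l ^+ 2 * p n <= (c + 1) * l^-1.
  apply: (@le_trans _ _ (l ^+ 2 * ((c + 1) / n%:R))).
    by apply: ler_wpM2l; [exact: sqr_ge0|rewrite -expy].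
  have -> : l ^+ 2 * ((c + 1) / n%:R) = (c + 1) * (l ^+ 2 / n%:R) by ring.
  apply: ler_wpM2l; first by have := c0; lra.
  rewrite ler_pdivrMr// -ler_pdivrMl ?invr_gt0// invrK.
  by have := L3 n_gt0; rewrite exprS.
(* The gap passed to [blocks] is [L + m], the separation that [mixing] demands. *)
have LB : (L n + m <= bl n)%N.
  have : (m + 2 <= L n)%N by apply: leq_trans Lm; rewrite leq_max leqnn.
  by rewrite /bl -mulnn; move: (L n); clear => k; nia.
have cl : (c + 1) * l^-1 <= 1.
  rewrite ler_pdivrMr// mul1r; apply: ltW; apply: (lt_le_trans (truncnS_gt (c + 1))).
  by rewrite ler_nat; apply: leq_trans Lm; rewrite !leq_max leqnn !orbT.
have bp : (bl n)%:R * p n <= (c + 1) * l^-1 by rewrite blE.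
have bq1 : (bl n)%:R * q n <= 1.
  by apply: le_trans cl; apply: le_trans bp; apply: ler_wpM2l.
have Epair k k' : (k + m < k')%N -> prob P (E n k `&` E n k') <= pi.
  by move=> kk; exact: pair.
have mix j k : (j + (L n + m) < k)%N ->
    `|prob P (no_exceed (E n) 0 j `&` last_of_cluster (E n) m k) -
      prob P (no_exceed (E n) 0 j) * q n| <= delta.
  move=> jk; apply: mix0 => //; first exact: log_root_gt.
  by rewrite -addnA.
have Ep' k : prob P (E n k) <= p n by rewrite Ep.
have := blocks (mE n) Ep' (Eq n) pi0 delta0 Epair mix (N n) LB bq1.
have Nb_n : (N n * bl n <= n)%N by exact: leq_trunc_div.
have := no_exceed_remainder n Nb_n.
have rem : (n - N n * bl n)%:R * p n <= (c + 1) * l^-1.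
  apply: le_trans bp; apply: ler_wpM2r => //; rewrite ler_nat.
  rewrite /N leq_subLR {1}(divn_eq n (bl n)) leq_add2l.
  by apply: ltnW; rewrite ltn_mod expn_gt0 log_root_gt0.
have Nl : (N n)%:R * l ^+ 2 <= n%:R by rewrite -blE.
have Nn0 : 0 <= (N n)%:R :> R by [].
have t1 : (N n)%:R * ((2 * (L n + m)%:R + m%:R) * p n) <= (2 + 3 * m%:R) * (c + 1) * l^-1.
  have -> : (2 + 3 * m%:R) * (c + 1) * l^-1 = (2 * l + 3 * m%:R * l) * (c + 1) * (l ^- 2).
    by field; rewrite gt_eqF.
  apply: (@le_trans _ _ ((2 * l + 3 * m%:R * l) * ((N n)%:R * p n))).
    rewrite mulrCA; apply: ler_wpM2r; first by rewrite mulr_ge0.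
    rewrite natrD -/l; have : m%:R * 1 <= m%:R * l by apply: ler_wpM2l.
    lra.
  rewrite -[leRHS]mulrA; apply: ler_wpM2l.
    have l0w : 0 <= l := ltW l0.
    by apply: addr_ge0; apply: mulr_ge0 => //; exact: mulr_ge0.
  rewrite ler_pdivlMr ?exprn_gt0//; apply: le_trans np.
  have -> : (N n)%:R * p n * l ^+ 2 = (N n)%:R * l ^+ 2 * p n by ring.
  exact: ler_wpM2r.
have t2 : (N n)%:R * ((bl n)%:R ^+ 2 * pi) <= C * expR ((1 + eta) * K) * l^-1.
  apply: (@le_trans _ _ (n%:R * l ^+ 2 * pi)).
    have -> : (N n)%:R * ((bl n)%:R ^+ 2 * pi) = (N n)%:R * l ^+ 2 * (l ^+ 2 * pi).
      by rewrite blE -/l; ring.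
    rewrite -[leRHS]mulrA; apply: ler_wpM2r => //; exact: mulr_ge0 (sqr_ge0 _) pi0.
  rewrite ler_pdivlMr//; apply: le_trans npi; rewrite le_eqVlt; apply/orP; left; apply/eqP; ring.
have t3 : (N n)%:R * ((bl n)%:R * delta) <= e * (c + 2).
  rewrite mulrA blE; apply: (@le_trans _ _ (n%:R * delta)); first exact: ler_wpM2r.
  rewrite /delta mulrCA; apply: ler_wpM2l; first exact: ltW.
  by rewrite mulrDr mulfV ?gt_eqF//; lra.
move=> hrem hblocks; rewrite -(subrKA (prob P (no_exceed (E n) 0 (N n * bl n)))).
apply: (le_trans (ler_normD _ _)).
have h1 := le_trans hrem rem.
have h2 : `|prob P (no_exceed (E n) 0 (N n * bl n)) - (1 - (bl n)%:R * q n) ^+ N n| <=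
   (2 + 3 * m%:R) * (c + 1) * l^-1 + C * expR ((1 + eta) * K) * l^-1 + e * (c + 2).
  apply: (le_trans hblocks); rewrite [leLHS]mulrDr [X in X + _ <= _]mulrDr.
  by apply: lerD => //; exact: lerD.
apply: (le_trans (lerD h1 h2)); rewrite /Kb -/l !mulrDl; lra.
Qed.

(** [N] blocks of length [bl] cover all but less than one block, so the block product tends to
    [expR (- b)]. The error is made small by choosing [e] first and [n] afterwards. *)
Lemma no_exceed_cvg : prob P (no_exceed (E n) 0 n) @[n --> \oo] --> expR (- b).
Proof.
have q_bl : \forall n \near \oo, (bl n)%:R * q n <= (c + 1) * (L n)%:R^-1.
  have n1 : \forall n \near \oo, (0 < n)%N by exists 1%N.
  apply: filterS2 n1 np_bound => n n0 np.
  have nr0 : 0 < n%:R :> R by rewrite ltr0n.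
  have pn : p n <= (c + 1) / n%:R by rewrite ler_pdivlMr// mulrC.
  apply: (@le_trans _ _ ((bl n)%:R * ((c + 1) / n%:R))).
    by apply: ler_wpM2l => //; exact: le_trans pn.
  have -> : (bl n)%:R * ((c + 1) / n%:R) = (c + 1) * ((bl n)%:R / n%:R) by ring.
  apply: ler_wpM2l; first by have := c0; lra.
  rewrite ler_pdivrMr// -ler_pdivrMl ?invr_gt0// invrK blE.
  by have := L3 n0; rewrite exprS.
have x0 n : 0 <= (bl n)%:R * q n by rewrite mulr_ge0.
have xl : (bl n)%:R * q n @[n --> \oo] --> (0 : R).
  apply: (@squeeze_cvgr _ _ _ _ (fun=> 0) (fun n => (c + 1) * (L n)%:R^-1)).
  - by apply: filterS q_bl => n ->; rewrite x0.
  - exact: cvg_cst.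
  - by rewrite -(mulr0 (c + 1)); apply: cvgM => //; exact: cvg_cst.
have Nx : (N n)%:R * ((bl n)%:R * q n) @[n --> \oo] --> b.
  apply: (@squeeze_cvgr _ _ _ _ (fun n => n%:R * q n - (bl n)%:R * q n) (fun n => n%:R * q n)).
  - apply: nearW => n; rewrite -mulrBl mulrA; apply/andP; split; apply: ler_wpM2r => //.
    rewrite lerBlDr -natrM -natrD ler_nat /N {1}(divn_eq n (bl n)) leq_add2l.
    by apply: ltnW; rewrite ltn_mod expn_gt0 log_root_gt0.
  - by rewrite -[X in _ --> X]subr0; exact: cvgB.
  - exact: q_cvg.
have x0' : \forall n \near \oo, 0 <= (bl n)%:R * q n by exact: nearW.
have lim := cvg_onem_exp x0' xl Nx.
have diff : prob P (no_exceed (E n) 0 n) - (1 - (bl n)%:R * q n) ^+ N n @[n --> \oo] --> (0 : R).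
  apply/cvgrPdist_le => e e0.
  have c2 : 0 < c + 2 by have := c0; lra.
  have e1 : 0 < e / 2 / (c + 2) by rewrite !divr_gt0.
  have KL : Kb * (L n)%:R^-1 @[n --> \oo] --> (0 : R).
    by rewrite -(mulr0 Kb); apply: cvgM => //; exact: cvg_cst.
  have e2 : 0 < e / 2 by rewrite divr_gt0.
  move/cvgrPdist_le : KL => /(_ _ e2) KL.
  apply: filterS2 KL (block_bound e1) => n; rewrite sub0r normrN => k1 k2.
  rewrite sub0r normrN; apply: (le_trans k2); rewrite mulfVK ?gt_eqF//.
  by have := ler_norm (Kb * (L n)%:R^-1); lra.
exact: (cvg_sub0 diff lim).
Qed.

End extremes.
(** * Law of the innovations *)

Section gauss_combination.
Local Open Scope ereal_scope.
Context {R : realType}.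
Local Notation leb := (@lebesgue_measure R).
Local Notation gamma := (@normal_prob R 0 1).
Implicit Types (f : R -> \bar R) (a b : R).

Lemma lebesgue_opp f : measurable_fun setT f -> (forall x, 0 <= f x) ->
  \int[leb]_x f x = \int[leb]_x f (- x)%R.
Proof.
move=> mf f0; pose phi := fun x : R => (- x)%R.
have mphi : measurable_fun setT (phi : R -> measurableTypeR R) by exact: oppr_measurable.
have -> : \int[leb]_x f (- x)%R = \int[pushforward leb (phi : R -> measurableTypeR R)]_x f x.
  by rewrite ge0_integral_pushforward// preimage_setT.
apply: eq_measure_integral => A mA _.
apply: lebesgue_measure_unique => // _ [[a b] _ <-].
rewrite [RHS](_ : _ = leb (phi @^-1` `]a, b]%classic))//.
have -> : phi @^-1` `]a, b]%classic = `[(- b)%R, (- a)%R[%classic.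
  by apply/seteqP; split => x; rewrite /phi /= !in_itv/= => /andP[x1 x2]; apply/andP; split; lra.
by rewrite !lebesgue_measure_itv/= !lte_fin ltrN2 -!EFinB opprK [(- a + b)%R]addrC.
Qed.

Lemma gauss_opp f : measurable_fun setT f -> (forall x, 0 <= f x) ->
  \int[gamma]_x f (- x)%R = \int[gamma]_x f x.
Proof.
move=> mf f0.
have mfo : measurable_fun setT (fun x : R => f (- x)%R).
  by apply: (measurableT_comp mf); exact: oppr_measurable.
have f0' x : 0 <= f (- x)%R by exact: f0.
apply: etrans (integral_normal_prob 0 1 mfo f0') _.
apply: etrans (esym (integral_normal_prob 0 1 mf f0)).
have mg : measurable_fun setT (fun x : R => f (- x)%R * (normal_pdf 0 1 x)%:E).
  by apply: emeasurable_funM => //; apply/measurable_EFinP; exact: measurable_normal_pdf.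
have g0 x : 0 <= f (- x)%R * (normal_pdf 0 1 x)%:E.
  by rewrite mule_ge0// lee_fin normal_pdf_ge0.
apply: etrans (lebesgue_opp mg g0) _; apply: eq_integral => x _.
by rewrite opprK !normal_pdfE ?oner_eq0// /normal_fun !subr0 sqrrN.
Qed.

Lemma measurable_lin a b : measurable_fun setT (fun z : R * R => (a * z.1 + b * z.2)%R).
Proof.
by apply: measurable_funD; apply: measurableT_comp => //; exact: mulrl_measurable.
Qed.

(** Both sides are the joint density of two standard normal variables with correlation [a], which is
    symmetric in its arguments. *)
Lemma normal_pdf_rotate a b (x u : R) : (0 < b)%R -> (a ^+ 2 + b ^+ 2 = 1)%R ->
  (normal_pdf (a * x) b u * normal_pdf 0 1 x = normal_pdf (a * u) b x * normal_pdf 0 1 u)%R.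
Proof.
move=> b0 ab; rewrite !normal_pdfE ?gt_eqF// /normal_fun.
rewrite mulrACA [RHS]mulrACA -!expRD; congr (_ * expR _)%R.
have bE : (a ^+ 2 = 1 - b ^+ 2)%R by lra.
rewrite !subr0 expr1n.
have e (p q : R) : ((p - a * q) ^+ 2 = p ^+ 2 - 2 * a * p * q + (1 - b ^+ 2) * q ^+ 2)%R.
  by rewrite -bE; ring.
by rewrite !e; field; rewrite gt_eqF.
Qed.

(* Completing the square in the joint density and integrating [x] out first. *)
Lemma gauss_rotate f a b : (0 < b)%R -> (a ^+ 2 + b ^+ 2 = 1)%R ->
  measurable_fun setT f -> (forall x, 0 <= f x) ->
  \int[gamma]_x \int[gamma]_y f (a * x + b * y)%R = \int[gamma]_x f x.
Proof.
move=> b0 ab mf f0.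
have bn : (`|b| = b)%R by rewrite gtr0_norm.
have mp (m s : R) := @measurable_normal_pdf R m s.
have mF : measurable_fun setT (fun z : R * R => f (a * z.1 + b * z.2)%R).
  exact: (measurableT_comp mf (measurable_lin a b)).
have mpdf : measurable_fun setT (fun z : R * R => normal_pdf (a * z.1) b z.2).
  rewrite (_ : (fun z : R * R => _) = (fun z => normal_peak b * expR (- (z.2 - a * z.1) ^+ 2 / (b ^+ 2 *+ 2)))%R).
    apply: measurable_funM => //; apply: measurableT_comp => //; apply: measurable_funM => //.
    apply: measurableT_comp => //; apply: measurable_funX; apply: measurable_funB => //.
    by apply: measurableT_comp => //; exact: mulrl_measurable.
  by apply/funext => z; rewrite normal_pdfE ?gt_eqF.
transitivity (\int[leb]_x \int[leb]_u (f u * (normal_pdf (a * x) b u * normal_pdf 0 1 x)%:E)).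
  have mI := @measurable_fun_fubini_tonelli_F _ _ _ _ _ gamma _ mF (fun z => f0 _).
  have I0 x : 0 <= \int[gamma]_y f (a * x + b * y)%R by exact: integral_ge0.
  apply: etrans (integral_normal_prob 0 1 mI I0) _.
  apply: eq_integral => x _; rewrite /fubini_F /=.
  have -> : \int[gamma]_y f (a * x + b * y)%R = \int[normal_prob (a * x)%R b]_y f y.
    apply/esym; apply: etrans (integral_normal_probE _ _ _ _) _ => //; first by rewrite gt_eqF.
    by apply: eq_integral => y _; rewrite bn addrC.
  rewrite (integral_normal_prob _ _ mf f0) -ge0_integralZr//; last 3 first.
  - by apply: emeasurable_funM => //; apply/measurable_EFinP; exact: mp.
  - by move=> u _; rewrite mule_ge0// lee_fin normal_pdf_ge0.
  - by rewrite lee_fin normal_pdf_ge0.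
  by apply: eq_integral => u _; rewrite -muleA.
apply: etrans (esym (integral_normal_prob 0 1 mf f0)).
have mH : measurable_fun setT (fun z : R * R =>
    f z.2 * (normal_pdf (a * z.1) b z.2 * normal_pdf 0 1 z.1)%:E).
  apply: emeasurable_funM; first exact: measurableT_comp.
  by apply/measurable_EFinP/measurable_funM => //; apply: measurableT_comp.
rewrite (@fubini_tonelli _ _ _ _ _ leb leb _ mH); last first.
  by move=> z; rewrite mule_ge0// lee_fin mulr_ge0// normal_pdf_ge0.
apply: eq_integral => u _ /=.
transitivity (\int[leb]_x ((f u * (normal_pdf 0 1 u)%:E) * (normal_pdf (a * u) b x)%:E)).
  by apply: eq_integral => x _; rewrite normal_pdf_rotate// -muleA -EFinM [(_ * normal_pdf 0 1 u)%R]mulrC.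
rewrite ge0_integralZl//; last 3 first.
- by apply/measurable_EFinP; exact: mp.
- by move=> x _; rewrite lee_fin normal_pdf_ge0.
- by rewrite mule_ge0// lee_fin normal_pdf_ge0.
by rewrite integral_normal_pdf mule1.
Qed.

(** Dividing [a] and [b] by the square root reduces to [gauss_rotate]; a negative [b] is handled by
    symmetry of the law. *)
Lemma gauss_sum f a b : measurable_fun setT f -> (forall x, 0 <= f x) ->
  \int[gamma]_x \int[gamma]_y f (a * x + b * y)%R =
  \int[gamma]_x f (Num.sqrt (a ^+ 2 + b ^+ 2) * x)%R.
Proof.
move=> mf f0.
have mfa (c h : R) : measurable_fun setT (fun x : R => f (c * x + h)%R).
  by apply: (measurableT_comp mf); apply: measurable_funD => //; exact: mulrl_measurable.
wlog b0 : b / (0 <= b)%R.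
  move=> H; have [|b0] := leP 0%R b; first exact: H.
  have := H (- b)%R; rewrite oppr_ge0 ltW// => /(_ isT); rewrite sqrrN => <-.
  apply: eq_integral => x _; rewrite -gauss_opp//; last first.
    by under eq_fun do rewrite addrC; exact: mfa.
  by apply: eq_integral => y _; rewrite mulrN mulNr.
have [->|bn0] := eqVneq b 0%R.
  rewrite expr0n addr0 sqrtr_sqr.
  transitivity (\int[gamma]_x f (a * x)%R).
    apply: eq_integral => x _; under eq_integral do rewrite mul0r addr0.
    by rewrite integral_cst//= probability_setT mule1.
  have [a0|a0] := leP 0%R a; first by rewrite ger0_norm.
  rewrite ltr0_norm// -gauss_opp//.
    by apply: eq_integral => x _; rewrite mulrN mulNr.
  by have := mfa a 0%R; under eq_fun do rewrite addr0.
have bp : (0 < b)%R by rewrite lt0r bn0.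
set r := Num.sqrt _.
have r20 : (0 < a ^+ 2 + b ^+ 2)%R by rewrite ltr_wpDl ?sqr_ge0// exprn_gt0.
have r0 : (0 < r)%R by rewrite sqrtr_gt0.
have r2 : (r ^+ 2 = a ^+ 2 + b ^+ 2)%R by rewrite sqr_sqrtr// ltW.
have br0 : (0 < b / r)%R by exact: divr_gt0.
have abr : ((a / r) ^+ 2 + (b / r) ^+ 2 = 1)%R.
  by rewrite !expr_div_n -mulrDl r2 divff// -r2 gt_eqF// exprn_gt0.
have mr : measurable_fun setT (fun x : R => f (r * x)%R).
  by have := mfa r 0%R; under eq_fun do rewrite addr0.
have rf0 (x : R) : 0 <= f (r * x)%R by exact: f0.
apply: etrans (gauss_rotate br0 abr mr rf0).
apply: eq_integral => x _; apply: eq_integral => y _; congr f.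
by field; rewrite gt_eqF.
Qed.

End gauss_combination.

Section combination_law.
Local Open Scope ereal_scope.
Context (R : realType) (I : choiceType).
Local Notation S := (seqspace R I).
Variable (nu : probability S R).
Hypothesis nuP : iid_gauss nu.
Local Notation gamma := (@normal_prob R 0 1).

Lemma measurable_combination (l : seq I) (a : I -> R) :
  measurable_fun setT (fun s : S => \sum_(i <- l) a i * s i)%R.
Proof.
apply: measurable_sum => i; apply: measurableT_comp; first exact: mulrl_measurable.
exact: measurable_coord.
Qed.

Lemma combination_law (l : seq I) (a : I -> R) (f : R -> \bar R) : uniq l ->
  measurable_fun setT f -> (forall x, 0 <= f x) ->
  \int[nu]_s f (\sum_(i <- l) a i * s i)%R =
  \int[gamma]_x f (Num.sqrt (\sum_(i <- l) a i ^+ 2) * x)%R.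
Proof.
elim: l f => [|c l IH] f.
  move=> _ mf f0; rewrite big_nil sqrtr0.
  under eq_integral do rewrite big_nil.
  under [RHS]eq_integral do rewrite mul0r.
  by rewrite !integral_cst//= !probability_setT.
move=> /andP[cl ul] mf f0.
rewrite (integral_upd nuP c); last 2 first.
- by apply: (measurableT_comp mf); exact: measurable_combination.
- by move=> s; exact: f0.
have mF : measurable_fun setT (fun z : R * R => f (z.1 + a c * z.2)%R).
  apply: (measurableT_comp mf); apply: measurable_funD => //.
  by apply: measurableT_comp => //; exact: mulrl_measurable.
pose g z := \int[gamma]_x f (z + a c * x)%R.
have mg : measurable_fun setT g.
  exact: (@measurable_fun_fubini_tonelli_F _ _ _ _ _ gamma _ mF (fun z => f0 _)).
transitivity (\int[nu]_s g (\sum_(i <- l) a i * s i)%R).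
  apply: eq_integral => s _; apply: eq_integral => x _; congr f.
  rewrite big_cons /upd eqxx addrC; congr (_ + _)%R.
  apply: eq_big_seq => i il; case: eqP => // ic; by rewrite -ic il in cl.
rewrite IH//; last by move=> z; exact: integral_ge0.
rewrite /g (gauss_sum (f := f))//; congr integral; apply/funext => x.
by rewrite sqr_sqrtr ?sumr_ge0// => [|i _]; rewrite ?sqr_ge0// big_cons addrC.
Qed.

End combination_law.

(** * Approximating indicators of half-lines *)

Section threshold.
Context (R : realType).
Implicit Types y : R.

Lemma onem_exp_bernoulli (z : R) K : 0 <= z <= 1 -> 1 - K%:R * z <= (1 - z) ^+ K.
Proof.
move=> /andP[z0 z1]; elim: K => [|K IH]; first by rewrite mul0r subr0 expr0.
rewrite exprS; apply: (@le_trans _ _ ((1 - z) * (1 - K%:R * z))).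
  have : 0 <= K%:R * z ^+ 2 by rewrite mulr_ge0 ?sqr_ge0.
  by rewrite -natr1; lra.
by apply: ler_wpM2l => //; lra.
Qed.

(** With [x = r ^+ 2], the factor [k%:R * r ^+ k] is bounded by a geometric sum, and the remaining
    [r ^+ k] tends to 0. *)
Lemma natr_exp_cvg0 (x : R) : 0 <= x < 1 -> k%:R * x ^+ k @[k --> \oo] --> 0.
Proof.
move=> /andP[x0 x1]; pose r := Num.sqrt x.
have r0 : 0 <= r by exact: sqrtr_ge0.
have r2 : r ^+ 2 = x by rewrite sqr_sqrtr.
have r1 : r < 1 by rewrite -(@ltr_pXn2r _ 2)// ?nnegrE// expr1n r2.
have kr (k : nat) : k%:R * r ^+ k <= (1 - r)^-1.
  have h : k%:R * r ^+ k <= \sum_(j < k) r ^+ j.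
    rewrite -[X in X%:R](card_ord k) -sum1_card natr_sum mulr_suml; apply: ler_sum => j _.
    by rewrite mul1r; apply: ler_wiXn2l => //; [exact: ltW|exact: ltnW].
  apply: (le_trans h); rewrite -[leRHS]mul1r ler_pdivlMr ?subr_gt0// mulrC.
  have := subrX1 r k; have := exprn_ge0 k r0; lra.
apply: (@squeeze_cvgr _ _ _ _ (fun=> 0) (fun k => (1 - r)^-1 * r ^+ k)).
- apply: nearW => k; rewrite mulr_ge0 ?exprn_ge0//=.
  by rewrite -r2 -exprM mulnC exprM expr2 mulrA; apply: ler_wpM2r; rewrite ?exprn_ge0.
- exact: cvg_cst.
- rewrite -(mulr0 (1 - r)^-1); apply: cvgM; first exact: cvg_cst.
  by apply: cvg_expr; rewrite ger0_norm.
Qed.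

(* Any exponent between [2^k] and [(2 - e)^k] separates [y < 1/2] from
   [y > 1/2]; the extra factor [k] decides the boundary case [y = 1/2]. *)
Definition threshold_poly (k : nat) y := (1 - y ^+ k) ^+ (k * 2 ^ k).

Lemma threshold_poly_itv k y : 0 <= y <= 1 -> 0 <= threshold_poly k y <= 1.
Proof.
move=> /andP[y0 y1].
have : 0 <= y ^+ k <= 1 by rewrite exprn_ge0// exprn_ile1.
by move=> /andP[z0 z1]; rewrite /threshold_poly exprn_ge0 ?exprn_ile1 ?subr_ge0//; lra.
Qed.

(** Bernoulli's inequality gives the lower bound [1 - k%:R * (2 * y) ^+ k]; when [2 * y >= 1],
    [1 - z <= expR (- z)] gives the upper bound [expR (-1) ^+ k]. *)
Lemma threshold_poly_cvg y : 0 <= y <= 1 ->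
  threshold_poly k y @[k --> \oo] --> ((y < 1 / 2)%R%:R : R).
Proof.
move=> y01; have /andP[y0 y1] := y01.
have zE (k : nat) : (k * 2 ^ k)%N%:R * y ^+ k = k%:R * (2 * y) ^+ k :> R.
  by rewrite natrM natrX exprMn mulrA.
have z01 (k : nat) : 0 <= y ^+ k <= 1 by rewrite exprn_ge0// exprn_ile1.
have [yl|yg] := ltP y (1 / 2).
  apply: (@squeeze_cvgr _ _ _ _ (fun k => 1 - k%:R * (2 * y) ^+ k) (fun=> 1)).
  - apply: nearW => k; have /andP[_ ->] := threshold_poly_itv k y01; rewrite andbT.
    by rewrite -zE; exact: onem_exp_bernoulli.
  - rewrite -[X in _ --> X]subr0; apply: cvgB; first exact: cvg_cst.
    by apply: natr_exp_cvg0; apply/andP; split; lra.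
  - exact: cvg_cst.
apply: (@squeeze_cvgr _ _ _ _ (fun=> 0) (fun k => expR (-1) ^+ k)).
- apply: nearW => k; have /andP[-> _] := threshold_poly_itv k y01 => /=.
  apply: (@le_trans _ _ (expR (- (y ^+ k)) ^+ (k * 2 ^ k))).
    apply: lerXn2r; rewrite ?nnegrE ?expR_ge0//; last exact: expR_ge1Dx.
    by have /andP[_ h] := z01 k; rewrite subr_ge0.
  rewrite -!expRM_natl ler_expR mulrN zE mulrN1 lerN2 ler_peMr// exprn_ege1//; lra.
- exact: cvg_cst.
- apply: cvg_expr; rewrite ger0_norm ?expR_ge0// -[ltRHS]expR0 ltr_expR; lra.
Qed.

(** Once [N] exceeds the distance from [x] to [c], the argument lies strictly between -1 and 1,
    where the sine has its sign. The scaling pushes the other zeros of the sine to infinity. *)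
Lemma sin_scaled_neg (x c : R) :
  \forall N \near \oo, (sin ((x - c) / N.+1%:R) < 0) = (x < c).
Proof.
exists (Num.truncn `|x - c|).+1 => // N /= hN.
have N0 : 0 < N.+1%:R :> R by [].
have b : `|x - c| < N.+1%:R.
  by apply: (lt_trans (truncnS_gt _)); rewrite ltr_nat ltnS.
have pi1 : 1 < pi :> R by have := @pi_ge2 R; lra.
have bb : `|x - c| / N.+1%:R < 1 by rewrite ltr_pdivrMr// mul1r.
have [xc|xc] := ltP x c.
  have h : `|x - c| = c - x by rewrite ltr0_norm; lra.
  have -> : (x - c) / N.+1%:R = - ((c - x) / N.+1%:R) by ring.
  rewrite sinN oppr_lt0; apply: sin_gt0_pi; rewrite h in bb; apply/andP; split.
    by rewrite divr_gt0// subr_gt0.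
  exact: lt_trans bb pi1.
have h : `|x - c| = x - c by rewrite ger0_norm; lra.
apply/negbTE; rewrite -leNgt; apply: sin_ge0_pi; rewrite h in bb; apply/andP; split.
  by rewrite divr_ge0// subr_ge0.
exact: ltW (lt_trans bb pi1).
Qed.

End threshold.

(** * Laws determined by linear forms *)

Section cramer_wold.
Context (R : realType) (n : nat).
Local Notation S := (seqspace R 'I_n).
Variables m1 m2 : probability S R.

Hypothesis lin_eq : forall (a : 'I_n -> R) (f : R -> \bar R), measurable_fun setT f ->
  (forall x, 0 <= f x)%E ->
  (\int[m1]_s f (\sum_i a i * s i)%R = \int[m2]_s f (\sum_i a i * s i)%R)%E.

Definition same_mean (F : S -> R) := [/\ measurable_fun setT F,
  exists M : R, forall s, `|F s| <= M &
  (\int[m1]_s (F s)%:E = \int[m2]_s (F s)%:E)%E].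

Lemma integrable_bounded (m : probability S R) (F : S -> R) (M : R) :
  measurable_fun setT F -> (forall s, `|F s| <= M) -> m.-integrable setT (EFin \o F).
Proof.
move=> mF FM; apply: measurable_bounded_integrable => //; first by apply: (le_lt_trans (probability_le1 m measurableT)); exact: ltry.
by exists M; split => [|y My s _ /=]; [exact: num_real|exact: le_trans (ltW My)].
Qed.

Lemma same_mean_lin (c c' : R) F G : same_mean F -> same_mean G ->
  same_mean (fun s => c * F s + c' * G s).
Proof.
move=> [mF [M FM] FE] [mG [M' GM] GE].
have mcF : measurable_fun setT (fun s => c * F s).
  by apply: measurableT_comp => //; exact: mulrl_measurable.
have mcG : measurable_fun setT (fun s => c' * G s).
  by apply: measurableT_comp => //; exact: mulrl_measurable.
split; first exact: measurable_funD.
  exists (`|c| * M + `|c'| * M') => s; apply: (le_trans (ler_normD _ _)).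
  by rewrite !normrM lerD// ler_wpM2l.
have E (m : probability S R) : (\int[m]_s (c * F s + c' * G s)%:E =
    c%:E * \int[m]_s (F s)%:E + c'%:E * \int[m]_s (G s)%:E)%E.
  have iF := integrable_bounded m mF FM; have iG := integrable_bounded m mG GM.
  under eq_integral do rewrite EFinD !EFinM.
  rewrite integralD//; [|exact: integrableZl..].
  by rewrite !integralZl.
by rewrite !E FE GE.
Qed.

Lemma same_mean_lim (F_ : nat -> S -> R) (F : S -> R) : (forall k, same_mean (F_ k)) ->
  (forall k s, `|F_ k s| <= 1) -> (forall s, `|F s| <= 1) ->
  (forall s, F_ k s @[k --> \oo] --> F s) -> same_mean F.
Proof.
move=> FE F1 F1' lim.
have mF : measurable_fun setT F.
  apply: (measurable_fun_cvg (h := F_)) => [k|s _]; first by have [] := FE k.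
  exact: lim.
split => //; first by exists 1.
have conv (m : probability S R) :
    (\int[m]_s (F_ k s)%:E @[k --> \oo] --> \int[m]_s (F s)%:E)%E.
  have [] := @dominated_convergence _ _ _ m setT measurableT
    (fun k s => (F_ k s)%:E) (fun s => (F s)%:E) (cst 1%E).
  - by move=> k; apply/measurable_EFinP; have [] := FE k.
  - exact/measurable_EFinP.
  - by apply: aeW => s _; apply: cvg_EFin; [exact: nearW|exact: lim].
  - by apply: (@integrable_bounded m (fun=> 1) 1) => // s; rewrite normr1.
  - by apply: aeW => s k _; rewrite lee_fin.
  by [].
rewrite -(cvg_lim _ (conv m1))// -(cvg_lim _ (conv m2))//.
by apply: congr_lim; apply/funext => k; have [] := FE k.
Qed.

(* Products of cosines of linear forms are again combinations of such cosines,
   and the mean of each is determined by the law of a single linear form. *)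
Inductive trig : (S -> R) -> Prop :=
| trig_cos (a : 'I_n -> R) (p : R) : trig (fun s => cos (\sum_i a i * s i + p))
| trig_lin (c c' : R) F G : trig F -> trig G -> trig (fun s => c * F s + c' * G s).

Lemma trig_same_mean F : trig F -> same_mean F.
Proof.
elim=> [a p|c c' {}F G _ hF _ hG]; last exact: same_mean_lin.
have mc : measurable_fun setT (fun x : R => cos (x + p)).
  apply: measurableT_comp; first by apply: continuous_measurable_fun; exact: continuous_cos.
  exact: measurable_funD.
have ml : measurable_fun setT (fun s : S => \sum_i a i * s i).
  apply: measurable_sum => i; apply: measurableT_comp; first exact: mulrl_measurable.
  exact: measurable_coord.
have m1c : measurable_fun setT (fun x : R => 1 + cos (x + p)) by exact: measurable_funD.
(* [lin_eq] concerns nonnegative functions, hence the added 1, subtracted afterwards by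
   linearity. *)
have h : same_mean (fun s => 1 + cos (\sum_i a i * s i + p)).
  split; first exact: (measurableT_comp m1c ml).
    by exists (1 + 1) => s; apply: (le_trans (ler_normD _ _)); rewrite normr1 lerD2l cos_max.
  apply: (lin_eq a (f := fun x => (1 + cos (x + p))%:E)); first exact/measurable_EFinP.
  by move=> x; rewrite lee_fin; have := cos_max (x + p); rewrite ler_norml => /andP[]; lra.
have h1 : same_mean (fun=> 1).
  by split => //; [exists 1 => s; rewrite normr1|rewrite !integral_cst//= !probability_setT].
have := same_mean_lin 1 (-1) h h1.
by congr same_mean; apply/funext => s; ring.
Qed.

Lemma trig_cst (c : R) : trig (fun=> c).
Proof.
have := trig_lin c 0 (trig_cos (fun=> 0) 0) (trig_cos (fun=> 0) 0).
congr trig; apply/funext => s; rewrite big1 ?addr0 ?cos0 => [|i _]; ring.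
Qed.

Lemma trigM F G : trig F -> trig G -> trig (fun s => F s * G s).
Proof.
move=> hF hG; elim: hF => [a p|c c' F1 F2 _ h1 _ h2]; last first.
  have := trig_lin c c' h1 h2; congr trig; apply/funext => s; ring.
elim: hG => [b q|c c' G1 G2 _ h1 _ h2]; last first.
  have := trig_lin c c' h1 h2; congr trig; apply/funext => s; ring.
have := trig_lin (1 / 2) (1 / 2) (trig_cos (fun i => a i + b i) (p + q))
  (trig_cos (fun i => a i - b i) (p - q)).
congr trig; apply/funext => s.
set x := \sum_i a i * s i + p; set y := \sum_i b i * s i + q.
have -> : \sum_i (a i + b i) * s i + (p + q) = x + y.
  by rewrite addrACA -big_split; congr (_ + _); apply: eq_bigr => i _; rewrite mulrDl.
have -> : \sum_i (a i - b i) * s i + (p - q) = x - y.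
  by rewrite opprD addrACA -sumrB; congr (_ + _); apply: eq_bigr => i _; rewrite mulrBl.
by rewrite cosD cosB; field.
Qed.

Lemma trigX F k : trig F -> trig (fun s => F s ^+ k).
Proof.
move=> hF; elim: k => [|k IH]; first exact: trig_cst.
by have := trigM hF IH; congr trig; apply/funext => s; rewrite exprS.
Qed.

Lemma trig_prod (l : seq 'I_n) (F : 'I_n -> S -> R) : (forall i, trig (F i)) ->
  trig (fun s => \prod_(i <- l) F i s).
Proof.
move=> hF; elim: l => [|i l IH].
  by have := trig_cst 1; congr trig; apply/funext => s; rewrite big_nil.
by have := trigM (hF i) IH; congr trig; apply/funext => s; rewrite big_cons.
Qed.

Definition half_sin (c : R) (N : nat) (x : R) := (1 + sin ((x - c) / N.+1%:R)) / 2.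

Lemma half_sin_itv c N x : 0 <= half_sin c N x <= 1.
Proof.
have := sin_max ((x - c) / N.+1%:R); rewrite ler_norml /half_sin => /andP[h1 h2].
by apply/andP; split; lra.
Qed.

Lemma trig_half_sin c N i : trig (fun s => half_sin c N (s i)).
Proof.
have := trig_lin (1 / 2) (1 / 2) (trig_cst 1)
  (trig_cos (fun j => if j == i then N.+1%:R^-1 else 0) (- c / N.+1%:R - pi / 2)).
congr trig; apply/funext => s.
rewrite (bigD1 i)//= eqxx big1 ?addr0 => [|j ji]; last by rewrite (negbTE ji) mul0r.
rewrite addrA cosBpihalf /half_sin.
have -> : N.+1%:R^-1 * s i + - c / N.+1%:R = (s i - c) / N.+1%:R by ring.
by field.
Qed.

Lemma trig_threshold c N i k : trig (fun s => threshold_poly k (half_sin c N (s i))).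
Proof.
apply: trigX.
have := trig_lin 1 (-1) (trig_cst 1) (trigX k (trig_half_sin c N i)).
by congr trig; apply/funext => s; ring.
Qed.

Lemma prod_cvg (r : seq 'I_n) (f : 'I_n -> nat -> R) (l : 'I_n -> R) :
  (forall i, f i k @[k --> \oo] --> l i) ->
  \prod_(i <- r) f i k @[k --> \oo] --> \prod_(i <- r) l i.
Proof. by move=> h; apply: cvg_big => //; exact: mul_continuous. Qed.

Lemma prod_norm_le1 (r : seq 'I_n) (f : 'I_n -> R) : (forall i, 0 <= f i <= 1) ->
  `|\prod_(i <- r) f i| <= 1.
Proof.
move=> h; rewrite normr_prod; elim: r => [|i r IH]; first by rewrite big_nil.
rewrite big_cons mulr_ile1//; first by apply: prodr_ge0.
by have /andP[h1 h2] := h i; rewrite ger0_norm.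
Qed.

(** Two successive dominated limits: [k] to infinity turns trigonometric polynomials into indicators
    of [half_sin < 1 / 2], then [N] to infinity turns these into indicators of half-lines. *)
Lemma box_same_mean (c : 'I_n -> R) :
  same_mean (fun s => \prod_i ((s i < c i)%R%:R : R)).
Proof.
have b01 (b : bool) : 0 <= (b%:R : R) <= 1 by case: b; rewrite ?lexx ler01.
apply: (same_mean_lim (F_ := fun N s => \prod_i ((half_sin (c i) N (s i) < 1 / 2)%R%:R : R))).
- move=> N; apply: (same_mean_lim
    (F_ := fun k s => \prod_i threshold_poly k (half_sin (c i) N (s i)))).
  + by move=> k; apply: trig_same_mean; apply: trig_prod => i; exact: trig_threshold.
  + by move=> k s; apply: prod_norm_le1 => i; apply: threshold_poly_itv; exact: half_sin_itv.
  + by move=> s; exact: prod_norm_le1.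
  + by move=> s; apply: prod_cvg => i; apply: threshold_poly_cvg; exact: half_sin_itv.
- by move=> N s; exact: prod_norm_le1.
- by move=> s; exact: prod_norm_le1.
- move=> s; apply: prod_cvg => i; apply: cvg_near_cst.
  apply: filterS (sin_scaled_neg (s i) (c i)) => N <-; congr (nat_of_bool _)%:R.
  by rewrite /half_sin; apply/idP/idP; lra.
Qed.

Definition box (c : 'I_n -> R) : set S := [set s | forall i, s i < c i].

Lemma measurable_box c : measurable (box c).
Proof.
rewrite (_ : box c = cylinder (enum 'I_n) (fun i => `]-oo, c i[%classic)).
  by apply: measurable_cylinder => i; exact: measurable_itv.
apply/seteqP; split => s h i; first by rewrite /= in_itv /= h.
by have := h i; rewrite mem_enum => /(_ isT); rewrite /= in_itv.
Qed.

Lemma box_eq c : m1 (box c) = m2 (box c).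
Proof.
have [_ _] := box_same_mean c.
have E (m : probability S R) : (\int[m]_s (\prod_i ((s i < c i)%R%:R : R))%:E = m (box c))%E.
  rewrite -[in RHS](setIT (box c)) -integral_indic//; last exact: measurable_box.
  apply: eq_integral => s _; congr EFin; rewrite indicE.
  have [h|h] := boolP (s \in box c).
    by rewrite big1// => i _; move: h; rewrite inE => /(_ i) ->.
  apply/eqP; rewrite prodf_seq_eq0; apply/hasP.
  have [i hi] : exists i, ~~ (s i < c i).
    by apply: contrapT => H; move/negP: h; apply; rewrite inE => i; apply: contrapT => /negP h; apply: H; exists i.
  by exists i; rewrite ?mem_index_enum//= (negbTE hi).
by rewrite !E.
Qed.

Definition boxes : set (set S) := range box.

(** A half-line in one coordinate is the countable union of the boxes whose other sides are [k]. *)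
Lemma measurable_boxes : (measurable : set (set S)) = <<s boxes >>.
Proof.
apply/seteqP; split; last first.
  apply: smallest_sub; first exact: sigma_algebra_measurable.
  by move=> _ [c _ <-]; exact: measurable_box.
apply: smallest_sub; first exact: smallest_sigma_algebra.
pose TG := g_sigma_algebraType boxes.
have mcoord i : measurable_fun (setT : set TG) (fun s : TG => (s : S) i : measurableTypeR R).
  apply: (measurability _ (RGenInftyO.measurableE R)).
  move=> _ [_ [x ->] <-]; rewrite setTI.
  rewrite (_ : _ @^-1` _ = \bigcup_k box (fun j => if j == i then x else k%:R)).
    by apply: bigcupT_measurable => k; apply: sub_sigma_algebra; exists (fun j => if j == i then x else k%:R).
  apply/seteqP; split => s /=; rewrite in_itv /=.
    move=> sx; exists (Num.truncn (\sum_j `|s j|)).+1 => // j.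
    case: eqP => [->//|_]; apply: le_lt_trans (truncnS_gt _).
    by apply: (le_trans (ler_norm _)); rewrite (bigD1 j)//= lerDl sumr_ge0.
  by move=> [k _ /(_ i)]; rewrite eqxx.
move=> _ [l [A [mA ->]]].
have : measurable (cylinder l A : set TG).
  elim: l => [|i l IH].
    by rewrite (_ : cylinder _ _ = setT)//; apply/seteqP; split.
  rewrite (_ : cylinder _ _ = (fun s : TG => (s : S) i) @^-1` A i `&` cylinder l A).
    by apply: measurableI => //; rewrite -[X in measurable X]setTI; apply: mcoord => //; exact: mA.
  apply/seteqP; split => s /=.
    move=> h; split; first by apply: h; rewrite mem_head.
    by move=> j jl; apply: h; rewrite inE jl orbT.
  by move=> [h1 h2] j; rewrite inE => /predU1P[->//|]; exact: h2.
by [].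
Qed.

Lemma cramer_wold E : measurable E -> m1 E = m2 E.
Proof.
apply: (@measure_unique _ R S boxes (fun k => box (fun=> k%:R))).
- exact: measurable_boxes.
- move=> _ _ [c _ <-] [c' _ <-]; exists (fun i => Num.min (c i) (c' i)) => //.
  apply/seteqP; split => s /=.
    by move=> h; split => i; have := h i; rewrite lt_min => /andP[].
  by move=> [h1 h2] i; rewrite lt_min h1 h2.
- by move=> k; exists (fun=> k%:R).
- apply/seteqP; split => // s _; exists (Num.truncn (\sum_j `|s j|)).+1 => // j.
  apply: le_lt_trans (truncnS_gt _).
  by apply: (le_trans (ler_norm _)); rewrite (bigD1 j)//= lerDl sumr_ge0.
- by move=> _ [c _ <-]; exact: box_eq.
- move=> k; apply: (le_lt_trans (probability_le1 m1 (measurable_box _))); exact: ltry.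
Qed.

End cramer_wold.

Section law.
Context d (T : measurableType d) d' (S : measurableType d') (R : realType)
  (P : probability T R).

Definition law (f : T -> S) (mf : measurable_fun setT f) : probability S R :=
  distribution P (mfun_Sub (mem_set mf)).

Lemma lawE f (mf : measurable_fun setT f) A : law mf A = P (f @^-1` A).
Proof. by []. Qed.

Lemma integral_law f (mf : measurable_fun setT f) (g : S -> \bar R) :
  measurable_fun setT g -> (forall s, 0 <= g s)%E ->
  (\int[law mf]_s g s = \int[P]_w g (f w))%E.
Proof. by move=> mg g0; rewrite ge0_integral_distribution. Qed.

End law.

(** * Second moments and the law of one innovation vector *)

Section second_moment.
Context (R : realType).
Local Notation gamma := (@normal_prob R 0 1).

(** Left in the extended reals: that it is positive and finite is deduced in [gauss_var_fin] from
    the existence of a Gaussian vector with unit covariance. *)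
Definition gauss_var : \bar R := \int[gamma]_x (x ^+ 2)%:E.

(** Averaging over [x] and [- x] removes the cross term while all integrands stay nonnegative, which
    is legitimate before any moment is known to be finite. *)
Lemma gauss_second_moment (s c : R) :
  (\int[gamma]_x ((s * x + c) ^+ 2)%:E = (s ^+ 2)%:E * gauss_var + (c ^+ 2)%:E)%E.
Proof.
have mlin (a b : R) : measurable_fun setT (fun x : R => (a * x + b) ^+ 2).
  apply: measurable_funX; apply: measurable_funD => //; exact: mulrl_measurable.
have mE (a b : R) : measurable_fun setT (fun x : R => ((a * x + b) ^+ 2)%:E).
  exact/measurable_EFinP.
have p0 (a b x : R) : (0 <= ((a * x + b) ^+ 2)%:E)%E by rewrite lee_fin sqr_ge0.
have h2 : 0 <= 1 / 2 :> R by lra.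
have opp : (\int[gamma]_x ((- s * x + c) ^+ 2)%:E = \int[gamma]_x ((s * x + c) ^+ 2)%:E)%E.
  rewrite -(gauss_opp (mE s c) (p0 s c)); apply: eq_integral => x _.
  by rewrite mulrN mulNr.
have lin := ge0_integral_lin2 gamma h2 h2 (mE s c) (mE (- s) c) (p0 _ _) (p0 _ _).
have m2 : measurable_fun setT (fun x : R => (x ^+ 2)%:E) by exact/measurable_EFinP/measurable_funX.
have p2 (x : R) : (0 <= (x ^+ 2)%:E)%E by rewrite lee_fin sqr_ge0.
have p1 (x : R) : (0 <= 1%:E :> \bar R)%E by [].
have lin' := ge0_integral_lin2 gamma (sqr_ge0 s) (sqr_ge0 c) m2 (@measurable_cst _ _ _ _ setT 1%:E) p2 p1.
move: lin'; rewrite integral_cst//= [gamma setT]probability_setT !mule1 => <-.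
transitivity (\int[gamma]_x ((1 / 2)%:E * ((s * x + c) ^+ 2)%:E + (1 / 2)%:E * ((- s * x + c) ^+ 2)%:E))%E; last first.
  by apply: eq_integral => x _; rewrite -!EFinM -!EFinD; congr EFin; field.
rewrite lin opp -ge0_muleDl ?lee_fin// -EFinD (_ : 1 / 2 + 1 / 2 = 1) ?mul1e//.
by field.
Qed.

Lemma gauss_var_ge0 : (0 <= gauss_var)%E.
Proof. by apply: integral_ge0 => x _; rewrite lee_fin sqr_ge0. Qed.

End second_moment.

Section gaussian_vector.
Context d (T : measurableType d) (R : realType) (P : probability T R) (n : nat).
Variable X : {RV P >-> n.-tuple R}.
Hypothesis Xg : gaussian_vector P X.
Hypothesis X0 : centered P X.
Hypothesis X1 : identity_covariance P X.
Local Notation gamma := (@normal_prob R 0 1).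
Local Notation x i := (fun w => tnth (X w) i).

Lemma measurable_tnth_comp i : measurable_fun setT (x i).
Proof. by apply: (measurableT_comp (measurable_tnth i)). Qed.

Lemma fin_num_integrable (f : T -> R) : measurable_fun setT f ->
  (\int[P]_w (f w)%:E)%E \is a fin_num -> P.-integrable setT (EFin \o f).
Proof.
move=> mf; have mE : measurable_fun setT (EFin \o f) by exact/measurable_EFinP.
rewrite integralE fin_numB => /andP[h1 h2]; apply/integrableP; split => //.
have e : (fun w => `|(EFin \o f) w|)%E = ((EFin \o f)^\+ \+ (EFin \o f)^\-)%E by rewrite -fune_abse.
rewrite e /=.
rewrite ge0_integralD//; [|exact: measurable_funepos|exact: measurable_funeneg].
by rewrite ltey_eq fin_numD h1 h2.
Qed.

Lemma mean0 i : (\int[P]_w (x i w)%:E = 0)%E.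
Proof. by have := X0 i; rewrite unlock. Qed.

Lemma cov1 i j : (\int[P]_w (x i w * x j w)%:E = ((i == j)%:R)%:E)%E.
Proof.
have := X1 i j; rewrite unlock !X0 /= unlock => <-; apply: eq_integral => w _.
by rewrite /= !fctE /= !subr0.
Qed.

(** The constant 1 is adjoined as an extra coordinate: centring and unit covariance together say
    that the extended vector is orthonormal, and [- h] becomes an ordinary coefficient. *)
Let ext (h : R) (w : T) (r : 'I_n.+1) : R := if unlift ord0 r is Some i then x i w else 1.

Let ext_gram h r s : (\int[P]_w (ext h w r * ext h w s)%:E = ((r == s)%:R)%:E)%E.
Proof.
rewrite /ext; case: unliftP => [i|] ->; case: unliftP => [j|] ->.
- by rewrite cov1 (inj_eq (@lift_inj _ _)).
- by under eq_integral do rewrite mulr1; rewrite mean0 eq_sym (negbTE (neq_lift _ _)).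
- by under eq_integral do rewrite mul1r; rewrite mean0 (negbTE (neq_lift _ _)).
- under eq_integral do rewrite mulr1.
  by rewrite integral_cst//= probability_setT mule1.
Qed.

Let mext h r : measurable_fun setT (fun w => ext h w r).
Proof. by rewrite /ext; case: unlift => [i|//]; exact: measurable_tnth_comp. Qed.

Lemma combination_second_moment (a : 'I_n -> R) (h : R) :
  (\int[P]_w ((\sum_i a i * x i w - h) ^+ 2)%:E = (\sum_i a i ^+ 2 + h ^+ 2)%:E)%E.
Proof.
pose b r : R := if unlift ord0 r is Some i then a i else - h.
have intE r s : P.-integrable setT (fun w => (b r * b s)%:E * (ext h w r * ext h w s)%:E)%E.
  apply: integrableZl => //; apply: fin_num_integrable; first exact: measurable_funM.
  by rewrite ext_gram.
transitivity (\int[P]_w (\sum_r \sum_s (b r * b s)%:E * (ext h w r * ext h w s)%:E))%E.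
  apply: eq_integral => w _.
  have -> : \sum_i a i * x i w - h = \sum_r b r * ext h w r.
    rewrite big_ord_recl /b /ext unlift_none mulr1 addrC; congr (_ + _).
    by apply: eq_bigr => i _; rewrite liftK.
  rewrite expr2 mulr_suml -sumEFin; apply: eq_bigr => r _.
  rewrite mulr_sumr -sumEFin; apply: eq_bigr => s _.
  by rewrite -EFinM mulrACA.
rewrite integral_sum//; last by move=> r; exact: integrable_sum.
under eq_bigr => r _.
  rewrite integral_sum//.
  under eq_bigr => s _.
    rewrite integralZl//; last first.
      by apply: fin_num_integrable; [exact: measurable_funM|rewrite ext_gram].
    rewrite ext_gram -EFinM.
    over.
  rewrite sumEFin (bigD1 r)//= eqxx mulr1 big1 ?addr0 => [|s sr]; last first.
    by rewrite eq_sym (negbTE sr) mulr0.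
  over.
rewrite sumEFin; congr EFin; rewrite big_ord_recl /b unlift_none -expr2 sqrrN addrC.
by congr (_ + _); apply: eq_bigr => i _; rewrite liftK -expr2.
Qed.

Lemma measurable_combo (a : 'I_n -> R) : measurable_fun setT (fun w => \sum_i a i * x i w).
Proof.
apply: measurable_sum => i; apply: measurableT_comp; first exact: mulrl_measurable.
exact: measurable_tnth_comp.
Qed.

(* Matching the second moments about every point [h] identifies the mean and
   the variance of a linear combination at once. *)
Lemma combination_params (a : 'I_n -> R) : exists mu sigma : R,
  [/\ forall f : R -> \bar R, measurable_fun setT f -> (forall y, 0 <= f y)%E ->
      (\int[P]_w f (\sum_i a i * x i w)%R = \int[gamma]_y f (`|sigma| * y + mu)%R)%E &
      forall h, ((\sum_i a i ^+ 2 + h ^+ 2)%:E = (sigma ^+ 2)%:E * gauss_var R + ((mu - h) ^+ 2)%:E)%E].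
Proof.
have [mu [sigma lawX]] := Xg a; exists mu, sigma.
have lawf (f : R -> \bar R) : measurable_fun setT f -> (forall y, 0 <= f y)%E ->
    (\int[P]_w f (\sum_i a i * x i w)%R = \int[gamma]_y f (`|sigma| * y + mu)%R)%E.
  move=> mf f0.
  pose lawR := @law _ T _ (measurableTypeR R) R P _ (measurable_combo a).
  rewrite -(@integral_law _ T _ (measurableTypeR R) R P _ (measurable_combo a) f mf f0).
  have lE A : measurable A -> lawR A = gaussian_law mu sigma A.
    by move=> mA; rewrite -(lawX _ mA).
  have [s0|s0] := eqVneq sigma 0.
    rewrite s0 normr0; under [RHS]eq_integral do rewrite mul0r add0r.
    rewrite integral_cst//= [gamma setT]probability_setT mule1.
    transitivity (\int[@dirac _ (measurableTypeR R) mu R]_y f y)%E; last first.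
      by rewrite integral_dirac// diracT mul1e.
    apply: eq_measure_integral => A mA _; have := lE _ mA.
    by rewrite /gaussian_law s0 eqxx.
  rewrite -(integral_normal_probE mu s0 mf f0).
  apply: eq_measure_integral => A mA _; have := lE _ mA.
  by rewrite /gaussian_law (negbTE s0).
split => // h.
have mf : measurable_fun setT (fun y : R => ((y - h) ^+ 2)%:E).
  by apply/measurable_EFinP/measurable_funX; exact: measurable_funB.
have f0 (y : R) : (0 <= ((y - h) ^+ 2)%:E)%E by rewrite lee_fin sqr_ge0.
have := lawf _ mf f0; rewrite combination_second_moment => ->.
under eq_integral do rewrite -addrA.
by rewrite gauss_second_moment real_normK ?num_real.
Qed.

(** A single coordinate has second moment [1 + h ^+ 2] about [h]. If [gauss_var] were zero, or if
    [sigma] were, this would equal [(mu - h) ^+ 2] at 0, 1 and -1, which is impossible; an infinite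
    [gauss_var] with [sigma] nonzero would make it infinite. *)
Lemma gauss_var_fin : (0 < n)%N -> exists2 v : R, 0 < v & gauss_var R = v%:E.
Proof.
move=> n0; have i0 := Ordinal n0.
have [mu [sigma [_ hE]]] := combination_params (fun i => (i == i0)%:R).
have a1 : \sum_i ((i == i0)%:R : R) ^+ 2 = 1.
  by rewrite (bigD1 i0)//= eqxx expr1n big1 ?addr0// => i /negbTE ->; rewrite expr0n.
rewrite a1 in hE; have v0 := gauss_var_ge0 R; move: hE v0.
case: (gauss_var R) => [v| |//] hE; rewrite ?lee_fin => v0.
  exists v => //; rewrite lt0r v0 andbT; apply/eqP => v00.
  have e0 := EFin_inj (hE 0); have e1 := EFin_inj (hE 1); have e2 := EFin_inj (hE (-1)).
  by rewrite v00 in e0 e1 e2; nra.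
exfalso; have [s0|s0] := eqVneq sigma 0.
  have e h : 1 + h ^+ 2 = (mu - h) ^+ 2.
    by apply: EFin_inj; rewrite (hE h) s0 expr0n mul0e add0e.
  have := e 0; have := e 1; have := e (-1); nra.
by have := hE 0; rewrite gt0_muley ?lte_fin ?exprn_even_gt0.
Qed.

(** Second moments about 0, 1 and -1 force mean 0, and then [sigma ^+ 2 * v] is the sum of the
    squared coefficients. *)
Lemma combination_gauss (v : R) (a : 'I_n -> R) (f : R -> \bar R) :
  0 < v -> gauss_var R = v%:E ->
  measurable_fun setT f -> (forall y, 0 <= f y)%E ->
  (\int[P]_w f (\sum_i a i * x i w)%R =
   \int[gamma]_y f ((Num.sqrt v)^-1 * Num.sqrt (\sum_i a i ^+ 2) * y)%R)%E.
Proof.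
move=> v0 vE mf f0; have [mu [sigma [lawf hE]]] := combination_params a.
have e h : \sum_i a i ^+ 2 + h ^+ 2 = sigma ^+ 2 * v + (mu - h) ^+ 2.
  by apply: EFin_inj; rewrite hE vE.
have mu0 : mu = 0 by have := e 0; have := e 1; have := e (-1); lra.
have sE : `|sigma| = (Num.sqrt v)^-1 * Num.sqrt (\sum_i a i ^+ 2).
  have := e 0; rewrite mu0 subr0 expr0n !addr0 => ->.
  by rewrite sqrtrM ?sqr_ge0// sqrtr_sqr mulrCA mulVf ?mulr1// gt_eqF// sqrtr_gt0.
by rewrite lawf// mu0 sE; under eq_integral do rewrite addr0.
Qed.

End gaussian_vector.

(** * Joint law of the innovations *)

Section gaussian_noise.
Context d (T : measurableType d) (R : realType) (P : probability T R) (d0 : nat).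
Hypothesis d00 : (0 < d0)%N.
Variable eps : int -> {RV P >-> d0.-tuple R}.
Hypothesis eps_indep : mutually_independent P (fun k => eps k : T -> d0.-tuple R).
Hypothesis eps_gauss : forall k, gaussian_vector P (eps k).
Hypothesis eps_centered : forall k, centered P (eps k).
Hypothesis eps_cov : forall k, identity_covariance P (eps k).
Local Notation I := ((int * 'I_d0)%type : choiceType).
Local Notation gamma := (@normal_prob R 0 1).

Definition noise (s0 : R) (w : T) : seqspace R I := fun c => tnth (eps c.1 w) c.2 / s0.

Lemma measurable_noise_coord (s0 : R) k i :
  measurable_fun setT (fun w => tnth (eps k w) i / s0).
Proof.
by apply: measurable_funM => //; exact: measurable_tnth_comp.
Qed.

Lemma measurable_noise (s0 : R) : measurable_fun setT (noise s0).
Proof. by apply: measurable_seqspace => -[k i]; exact: measurable_noise_coord. Qed.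

Section scaled.
Variable v : R.
Hypothesis v0 : 0 < v.
Hypothesis vE : gauss_var R = v%:E.
Let s0 := (Num.sqrt v)^-1.

Let s00 : 0 < s0. Proof. by rewrite invr_gt0 sqrtr_gt0. Qed.

Lemma noise_combination k (a : 'I_d0 -> R) (f : R -> \bar R) :
  measurable_fun setT f -> (forall y, 0 <= f y)%E ->
  (\int[P]_w f (\sum_i a i * (tnth (eps k w) i / s0))%R =
   \int[gamma]_y f (Num.sqrt (\sum_i a i ^+ 2) * y)%R)%E.
Proof.
move=> mf f0.
have mg : measurable_fun setT (fun y : R => f (y / s0)%R).
  by apply: (measurableT_comp mf); exact: measurable_funM.
have g0 (y : R) : (0 <= f (y / s0)%R)%E by exact: f0.
have := combination_gauss (eps_gauss k) (eps_centered k) (eps_cov k) a v0 vE mg g0.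
rewrite -/s0 => h; apply: etrans (etrans h _).
  by apply: eq_integral => w _; congr f; rewrite mulr_suml; apply: eq_bigr => i _; ring.
by apply: eq_integral => y _; congr f; field; rewrite gt_eqF.
Qed.

Lemma noise_coord_law k i (A : set R) : measurable A ->
  P [set w | A (tnth (eps k w) i / s0)] = gamma A.
Proof.
move=> mA.
have mf : measurable_fun setT (fun y : R => (\1_A y : R)%:E) by exact/measurable_EFinP/measurable_indic.
have f0 (y : R) : (0 <= (\1_A y : R)%:E)%E by rewrite lee_fin.
have mB : measurable [set w | A (tnth (eps k w) i / s0)].
  by rewrite -[X in measurable X]setTI; exact: measurable_noise_coord.
have := noise_combination k (fun j => (j == i)%:R) mf f0.
have -> : \sum_j ((j == i)%:R : R) ^+ 2 = 1.
  by rewrite (bigD1 i)//= eqxx expr1n big1 ?addr0// => j /negbTE ->; rewrite expr0n.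
rewrite sqrtr1; under [RHS]eq_integral do rewrite mul1r.
rewrite (integral_1 gamma mA) => h; rewrite (probE gamma mA) -h (probE P mB) -(integral_1 P mB).
apply: eq_integral => w _; congr EFin; rewrite !indicE.
rewrite (bigD1 i)//= eqxx mul1r big1 ?addr0 => [|j /negbTE ->]; last by rewrite mul0r.
by congr (nat_of_bool _)%:R; apply/idP/idP; rewrite !inE.
Qed.

Let i0 := Ordinal d00.

(* A reference vector whose coordinates are independent by construction. *)
Let diag (w : T) : seqspace R 'I_d0 := fun i => tnth (eps (i : nat)%:Z w) i0 / s0.

Let mdiag : measurable_fun setT diag.
Proof. by apply: measurable_seqspace => i; exact: measurable_noise_coord. Qed.

Lemma diag_iid : iid_gauss (law P mdiag).
Proof.
move=> l A ul mA.
(* Independence is stated for families over all integer times, so [insubd] supplies a default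
   coordinate outside the range of ['I_d0]. *)
pose B (k : int) : set (d0.-tuple R) :=
  [set x | A (insubd i0 `|k|%N) (tnth x i0 / s0)].
have mB k : measurable (B k).
  rewrite -[X in measurable X]setTI.
  suff : measurable_fun setT (fun x : d0.-tuple R => tnth x i0 / s0) by apply.
  by apply: measurable_funM => //; exact: measurable_tnth.
have ul' : uniq [seq (i : nat)%:Z | i : 'I_d0 <- l].
  by rewrite map_inj_uniq// => i j [] /val_inj.
have BE (i : 'I_d0) : B (i : nat)%:Z = [set x | A i (tnth x i0 / s0)].
  by rewrite /B absz_nat valKd.
have := eps_indep ul' mB; rewrite big_map => indep.
rewrite lawE -[LHS]fineK; last by apply: fin_num_measure; rewrite -[X in measurable X]setTI; apply: mdiag => //; exact: measurable_cylinder.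
congr EFin; transitivity (\prod_(i <- l) prob P (eps (i : nat)%:Z @^-1` B (i : nat)%:Z)).
  rewrite -indep /prob; congr (fine (P _)); apply/seteqP; split => w /= h.
    by move=> k /mapP[i il ->]; rewrite BE; exact: h.
  by move=> i il; have := h (i : nat)%:Z; rewrite BE => /(_ (map_f _ il)).
by apply: eq_bigr => i _; rewrite BE /prob -(noise_coord_law (i : nat)%:Z i0 (mA i)).
Qed.

Let vec k (w : T) : seqspace R 'I_d0 := fun i => tnth (eps k w) i / s0.

Let mvec k : measurable_fun setT (vec k).
Proof. by apply: measurable_seqspace => i; exact: measurable_noise_coord. Qed.

(** Every linear form has the same distribution under the vector at time [k] as under [diag], so
    Cramer-Wold identifies the two laws. *)
Lemma vec_iid k : iid_gauss (law P (mvec k)).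
Proof.
move=> l A ul mA; rewrite -diag_iid//; apply: cramer_wold; last exact: measurable_cylinder.
move=> a f mf f0.
have mcomb : measurable_fun setT (fun s : seqspace R 'I_d0 => \sum_i a i * s i).
  exact: measurable_combination.
rewrite (combination_law diag_iid)//; last exact: index_enum_uniq.
rewrite -(noise_combination k)//.
rewrite (integral_law P (mvec k) (g := fun s => f (\sum_i a i * s i)))//.
exact: (measurableT_comp mf).
Qed.

(** Coordinates are grouped by time: independence over time factors the cylinder, and [vec_iid]
    factors each time slice. *)
Lemma noise_iid : iid_gauss (law P (measurable_noise s0)).
Proof.
move=> l A ul mA.
pose ks := undup [seq c.1 | c <- l].
pose li k := [seq i <- enum 'I_d0 | (k, i) \in l].
have uli k : uniq (li k) by rewrite filter_uniq// enum_uniq.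
pose B (k : int) : set (d0.-tuple R) :=
  [set x | forall i, i \in li k -> A (k, i) (tnth x i / s0)].
have mB k : measurable (B k).
  have mx : measurable_fun setT (fun x : d0.-tuple R => (fun i => tnth x i / s0) : seqspace R 'I_d0).
    by apply: measurable_seqspace => i; apply: measurable_funM => //; exact: measurable_tnth.
  rewrite -[X in measurable X]setTI.
  by apply: (mx measurableT (cylinder (li k) (fun i => A (k, i)))); exact: measurable_cylinder.
have lE : perm_eq l [seq (k, i) | k <- ks, i <- li k].
  apply: uniq_perm => //.
    by apply: allpairs_uniq_dep => [|k _|[k i] [k' i'] _ _ []]; rewrite ?undup_uniq// => -> ->.
  move=> [k i]; apply/idP/allpairsPdep.
    move=> kil; exists k, i; split => //; last by rewrite mem_filter mem_enum kil.
    by rewrite mem_undup; apply/mapP; exists (k, i).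
  by move=> [k' [i' [_ ]]]; rewrite mem_filter mem_enum andbT => h [-> ->].
have indep := eps_indep (undup_uniq _ : uniq ks) mB.
rewrite lawE -[LHS]fineK; last by apply: fin_num_measure; rewrite -[X in measurable X]setTI; apply: measurable_noise => //; exact: measurable_cylinder.
congr EFin; rewrite (perm_big _ lE) big_allpairs_dep /=.
transitivity (\prod_(k <- ks) prob P (eps k @^-1` B k)).
  rewrite -indep /prob; congr (fine (P _)); apply/seteqP; split => w /= h.
    by move=> k _ i; rewrite mem_filter => /andP[kil _]; exact: (h (k, i)).
  move=> [k i] kil; have := h k; apply; last by rewrite mem_filter kil mem_enum.
  by rewrite mem_undup; apply/mapP; exists (k, i).
apply: eq_bigr => k _; rewrite /prob.
have := vec_iid k (uli k) (fun i => mA (k, i)); rewrite lawE => /(congr1 fine) /= <-.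
by [].
Qed.

End scaled.

Lemma exists_noise_iid : exists2 s0 : R, 0 < s0 & iid_gauss (law P (measurable_noise s0)).
Proof.
have [v v0 vE] := gauss_var_fin (eps_gauss 0) (eps_centered 0) (eps_cov 0) d00.
by exists (Num.sqrt v)^-1; [rewrite invr_gt0 sqrtr_gt0|exact: noise_iid].
Qed.

End gaussian_noise.
(** * Maxima *)

Section shift_invariance.
Context (R : realType) (d0 : nat) (Psi : nat -> 'M[R]_d0).
Local Notation I := ((int * 'I_d0)%type : choiceType).
Local Notation S := (seqspace R I).
Variable mu : probability S R.
Hypothesis muP : iid_gauss mu.

Definition tshift (h : int) (s : S) : S := fun c => s (c.1 + h, c.2).

Lemma measurable_tshift h : measurable_fun setT (tshift h).
Proof. by apply: measurable_seqspace => -[k i]; exact: measurable_coord. Qed.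

Lemma Xpath_tshift h s : Xpath Psi (tshift h s) = tshift h (Xpath Psi s).
Proof.
apply/funext => -[k i]; rewrite /tshift /Xpath /= !mxE; congr (fine (limn_esup _)).
apply/funext => N; congr EFin; rewrite /partial !summxE; apply: eq_bigr => l _.
congr ((_ *m _) i 0); apply/colP => j; rewrite !mxE /=; congr (s (_, j)); lia.
Qed.

Lemma law_tshift h E : measurable E -> mu (tshift h @^-1` E) = mu E.
Proof.
have key l A : uniq l -> (forall i, measurable (A i)) ->
    mu (tshift h @^-1` cylinder l A) = mu (cylinder l A).
  move=> ul mA; apply: etrans (esym (muP ul mA)).
  have tinj : injective (fun c : I => (c.1 + h, c.2)).
    by move=> [k i] [k' i'] /= [/addIr -> ->].
  rewrite (_ : _ @^-1` _ = cylinder [seq (c.1 + h, c.2) | c <- l] (fun c => A (c.1 - h, c.2))).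
    rewrite muP ?map_inj_uniq//; congr EFin; rewrite big_map; apply: eq_bigr => -[k i] _ /=.
    by rewrite addrK.
  apply/seteqP; split => s /= sA.
    move=> _ /mapP[[k i] kl ->] /=; rewrite addrK; exact: (sA (k, i)).
  move=> [k i] kl; have := sA (k + h, i); rewrite /= addrK; apply.
  by apply/mapP; exists (k, i).
apply: (@seqspace_measure_unique R I (law mu (measurable_tshift h)) mu).
  by apply: le_lt_trans (ltry 1); exact: probability_le1.
exact: key.
Qed.

Lemma law_Xpath_tshift h E : measurable E ->
  mu (Xpath Psi @^-1` (tshift h @^-1` E)) = mu (Xpath Psi @^-1` E).
Proof.
move=> mE; have mX : measurable (Xpath Psi @^-1` E).
  by rewrite -[X in measurable X]setTI; exact: measurable_Xpath.
rewrite -[RHS](law_tshift h mX).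
by congr (mu _); apply/seteqP; split => s; rewrite /preimage /= Xpath_tshift.
Qed.

End shift_invariance.

Section convergence.
Context (R : realType) (d0 : nat) (Psi : nat -> 'M[R]_d0).
Local Notation I := ((int * 'I_d0)%type : choiceType).
Local Notation S := (seqspace R I).

(** Convergence written with countable operations, hence a measurable event; this lets almost sure
    convergence pass from [P] to the law of the noise by [ae_law]. *)
Definition cvg_set (c : I) : set S := \bigcap_(p : nat) \bigcup_(n : nat) \bigcap_(m : nat)
  [set s | (n <= m)%N -> `|Xpath Psi s c - partial Psi c.1 m s c.2 0| <= p.+1%:R^-1].

Lemma measurable_cvg_set c : measurable (cvg_set c).
Proof.
apply: bigcapT_measurable => p; apply: bigcupT_measurable => n.
apply: bigcapT_measurable => m.
have [nm|nm] := leqP n m; last by rewrite (_ : mkset _ = setT)//; apply/seteqP; split => // s _; lia.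
rewrite (_ : mkset _ = [set s | `|Xpath Psi s c - partial Psi c.1 m s c.2 0| <= p.+1%:R^-1]).
  rewrite -[X in measurable X]setTI; apply: measurable_fun_le => //.
  apply: measurableT_comp => //; apply: measurable_funB.
    by apply: (measurableT_comp (measurable_coord c)); exact: measurable_Xpath.
  exact: measurable_partial.
by apply/seteqP; split => s /= h; [exact: h|move=> _; exact: h].
Qed.

Lemma cvg_setP c s : cvg_set c s <->
  partial Psi c.1 N s c.2 0 @[N --> \oo] --> Xpath Psi s c.
Proof.
split.
  move=> h; apply/cvgrPdist_le => e e0.
  have [n _ hn] := h (Num.truncn e^-1) Logic.I.
  exists n => // m /= nm; apply: (le_trans (hn m Logic.I nm)).
  rewrite -[leRHS]invrK lef_pV2 ?posrE ?invr_gt0//; apply: ltW; exact: truncnS_gt.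
move/cvgrPdist_le => h p _; have p0 : 0 < p.+1%:R^-1 :> R by rewrite invr_gt0.
by have [n _ hn] := h _ p0; exists n => // m _ nm; exact: hn.
Qed.

End convergence.

Lemma ae_law d (T : measurableType d) d' (T' : measurableType d') (R : realType)
    (P : probability T R) (f : T -> T') (mf : measurable_fun setT f) (E : set T') :
  measurable E -> {ae P, forall w, E (f w)} -> {ae law P mf, forall s, E s}.
Proof.
move=> mE [N [mN N0 sub]]; exists (~` E); split => //; first exact: measurableC.
have mC : measurable (f @^-1` (~` E)).
  by rewrite -[X in measurable X]setTI; apply: mf => //; exact: measurableC.
rewrite lawE; apply: (subset_measure0 mC mN _ N0) => w nE; exact: sub.
Qed.

Lemma ae_forall_countable d (T : measurableType d) (R : realType)
    (P : probability T R) (J : countType) (Q : J -> set T) :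
  (forall j, {ae P, forall w, Q j w}) -> {ae P, forall w j, Q j w}.
Proof.
move=> h; have : {ae P, forall w (n : nat), forall j, unpickle n = Some j -> Q j w}.
  apply: ae_foralln => n; case E : (unpickle n) => [j|]; last exact: aeW.
  by apply: filterS (h j) => w Qw _ [<-].
by apply: filterS => w H j; apply: (H (pickle j)); rewrite pickleK.
Qed.

(** * From the given process to sequence space *)

Section linear_process_law.
Context d (T : measurableType d) (R : realType) (P : probability T R) (d0 : nat).
Variable eps : int -> {RV P >-> d0.-tuple R}.
Variables (Psi : nat -> 'M[R]_d0) (X : int -> {RV P >-> d0.-tuple R}).
Hypothesis X_linear : linear_process P Psi (fun k => eps k) (fun k => X k).
Variable s0 : R.
Hypothesis s00 : 0 < s0.
Local Notation I := ((int * 'I_d0)%type : choiceType).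
Local Notation S := (seqspace R I).
Let mu := law P (measurable_noise eps s0).

(** Compensates the division by [s0] in [noise], leaving the products of filter and innovation
    unchanged. *)
Definition scaled_filter (l : nat) : 'M[R]_d0 := s0 *: Psi l.
Local Notation Psi' := scaled_filter.

Definition path (w : T) : S := fun c => tnth (X c.1 w) c.2.

Lemma measurable_path : measurable_fun setT path.
Proof. by apply: measurable_seqspace => -[k i]; exact: measurable_tnth_comp. Qed.

Lemma path_cvg : {ae P, forall w (c : I),
  partial Psi' c.1 N (noise eps s0 w) c.2 0 @[N --> \oo] --> path w c}.
Proof.
have : {ae P, forall w (k : int), forall i : 'I_d0,
    (\sum_(0 <= l < N) \sum_(j < d0) Psi l i j * tnth (eps (k - l%:Z) w) j)
      @[N --> \oo] --> tnth (X k w) i}.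
  by apply: ae_forall_countable => k; exact: X_linear.
apply: filterS => w h [k i]; have := h k i.
rewrite (_ : (fun N => \sum_(0 <= l < N) _) = fun N => partial Psi' k N (noise eps s0 w) i 0)//.
apply/funext => N; rewrite big_mkord /partial summxE; apply: eq_bigr => l _.
rewrite mxE; apply: eq_bigr => j _; rewrite !mxE /noise /=; field.
by rewrite gt_eqF.
Qed.

Lemma path_Xpath : {ae P, forall w, path w = Xpath Psi' (noise eps s0 w)}.
Proof.
apply: filterS path_cvg => w h; apply/funext => c.
by rewrite /Xpath (Xh_lim (h c)).
Qed.

Lemma ae_converges : {ae mu, forall s, converges Psi' s}.
Proof.
have : {ae mu, forall s (c : I), cvg_set Psi' c s}.
  apply: ae_forall_countable => c; apply: ae_law; first exact: measurable_cvg_set.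
  apply: filterS2 path_cvg path_Xpath => w h e; apply/cvg_setP; rewrite -e; exact: h.
apply: filterS => s h k i; apply/cvg_ex; exists (Xpath Psi' s (k, i)).
exact: (cvg_setP Psi' (k, i) s).1 (h (k, i)).
Qed.

Lemma prob_path E : measurable E -> prob P (path @^-1` E) = prob mu (Xpath Psi' @^-1` E).
Proof.
move=> mE.
have mX : measurable (Xpath Psi' @^-1` E).
  by rewrite -[X in measurable X]setTI; exact: measurable_Xpath.
rewrite [RHS]/prob /mu lawE; apply: prob_ae_eq.
- by rewrite -[X in measurable X]setTI; exact: measurable_path.
- by rewrite -[X in measurable X]setTI; exact: measurable_noise.
- by apply: filterS path_Xpath => w e; rewrite /preimage /= e.
Qed.

End linear_process_law.

Section vector_order.
Context (R : realType) (d : nat).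
Implicit Types x y : d.-tuple R.

Lemma vnleE x y : vnle x y <-> ~ vle x y.
Proof.
split; first by move=> [i yx] /(_ i); rewrite leNgt yx.
move=> h; apply: contrapT => H; apply: h => i; rewrite leNgt; apply/negP => yx.
by apply: H; exists i.
Qed.

Lemma vleE x y : vle x y <-> ~ vnle x y.
Proof. by split => [h /vnleE //|h]; apply: contrapT => /vnleE. Qed.

Lemma measurable_vle y : measurable [set x | vle x y].
Proof.
have mx : measurable_fun setT (fun x : d.-tuple R => (fun i => tnth x i) : seqspace R 'I_d).
  by apply: measurable_seqspace => i; exact: measurable_tnth.
rewrite (_ : mkset _ =
  (fun x : d.-tuple R => (fun i => tnth x i) : seqspace R 'I_d) @^-1`
    cylinder (enum 'I_d) (fun i => `]-oo, tnth y i]%classic)).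
  rewrite -[X in measurable X]setTI; apply: mx => //.
  by apply: measurable_cylinder => i; exact: measurable_itv.
apply/seteqP; split => x h i; first by move=> _; rewrite /= in_itv /=; exact: h.
by have := h i; rewrite mem_enum => /(_ isT); rewrite /= in_itv.
Qed.

Lemma measurable_vnle y : measurable [set x | vnle x y].
Proof.
rewrite (_ : mkset _ = ~` [set x | vle x y]); first exact: measurableC (measurable_vle y).
by apply/seteqP; split => x /vnleE.
Qed.

Lemma running_max_le disp (T : measurableType disp) (Y : nat -> T -> d.-tuple R) n w y :
  (0 < n)%N ->
  vle (running_max Y n w) y <-> forall k, (0 < k <= n)%N -> vle (Y k w) y.
Proof.
case: n => // n _; split => [h [//|k] /andP[_ kn] i|h i].
  apply: le_trans (h i); rewrite /running_max tnth_mktuple.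
  have km : k.+1 \in index_iota 1 n.+2 by rewrite mem_index_iota.
  exact: (le_bigmax_seq _ _ xpredT (fun k => tnth (Y k w) i) km).
rewrite /running_max tnth_mktuple big_seq; apply: bigmax_le; first exact: h.
by move=> k; rewrite mem_index_iota ltnS => kn; exact: h.
Qed.

End vector_order.

(** * Exceedances as events of the path *)

Section observables.
Context (R : realType) (d0 d m : nat).
Variable G : 'I_d -> {mfun m.+1.-tuple (d0.-tuple R) >-> R}.
Local Notation I := ((int * 'I_d0)%type : choiceType).
Local Notation S := (seqspace R I).

Definition observe (k : int) (p : S) : d.-tuple R :=
  [tuple G i [tuple [tuple p (k - j%:Z, r) | r < d0] | j < m.+1] | i < d].

Lemma measurable_observe k : measurable_fun setT (observe k).
Proof.
apply/measurable_fun_tnthP => i.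
rewrite (_ : _ \o _ = (G i) \o (fun p : S => [tuple [tuple p (k - j%:Z, r) | r < d0] | j < m.+1])); last first.
  by apply/funext => p /=; rewrite tnth_mktuple.
apply: measurableT_comp => //; apply/measurable_fun_tnthP => j.
apply/measurable_fun_tnthP => r.
rewrite (_ : _ \o _ = fun p : S => p (k - (j : nat)%:Z, r)); first exact: measurable_coord.
by apply/funext => p /=; rewrite !tnth_mktuple.
Qed.

Lemma observe_dep k s s' : (forall c, k - m%:Z <= c.1 <= k -> s c = s' c) ->
  observe k s = observe k s'.
Proof.
move=> h; apply: eq_from_tnth => i; rewrite !tnth_mktuple; congr (G i _).
apply: eq_from_tnth => j; rewrite !tnth_mktuple; apply: eq_from_tnth => r.
rewrite !tnth_mktuple; apply: h => /=; have := ltn_ord j; lia.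
Qed.

Lemma observe_tshift k h p : observe k (tshift h p) = observe (k + h) p.
Proof.
apply: eq_from_tnth => i; rewrite !tnth_mktuple; congr (G i _).
apply: eq_from_tnth => j; rewrite !tnth_mktuple; apply: eq_from_tnth => r.
by rewrite !tnth_mktuple /tshift /= addrAC.
Qed.

Definition exceed (y : d.-tuple R) (k : int) : set S := [set p | vnle (observe k p) y].

Lemma measurable_exceed y k : measurable (exceed y k).
Proof.
rewrite -[X in measurable X]setTI; exact: (measurable_observe k measurableT (measurable_vnle y)).
Qed.

Definition cluster_end (y : d.-tuple R) (k : int) : set S :=
  exceed y k `&` [set p | forall j : nat, (1 <= j <= m)%N -> vle (observe (k + j%:Z) p) y].

Lemma measurable_cluster_end y k : measurable (cluster_end y k).
Proof.
apply: measurableI; first exact: measurable_exceed.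
rewrite (_ : mkset _ = \bigcap_(j : nat) (if (1 <= j <= m)%N then ~` exceed y (k + j%:Z) else setT)).
  apply: bigcapT_measurable => j; case: ifP => // _; apply: measurableC; exact: measurable_exceed.
apply/seteqP; split => p h j; first by move=> _; case: ifP => // jm /vnleE; apply; exact: h.
by move=> jm; have := h j Logic.I; rewrite jm => /vleE.
Qed.

Lemma tshift_exceed y k : tshift k @^-1` exceed y 0 = exceed y k.
Proof. by apply/seteqP; split => p; rewrite /exceed /preimage /= observe_tshift add0r. Qed.

Lemma tshift_cluster_end y k : tshift k @^-1` cluster_end y 0 = cluster_end y k.
Proof.
rewrite /cluster_end preimage_setI tshift_exceed; congr (_ `&` _).
by apply/seteqP; split => p h j jm; have := h j jm; rewrite observe_tshift add0r addrC.
Qed.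

Lemma last_of_cluster_preimage (f : S -> S) y (k : nat) :
  last_of_cluster (fun k : nat => f @^-1` exceed y k%:Z) m k = f @^-1` cluster_end y k%:Z.
Proof.
apply/seteqP; split => s [h1 h2]; split => //= j.
  move=> /andP[j1 jm]; apply/vleE => h; apply: (h2 (k + j)%N); first by lia.
  by rewrite /exceed /preimage /= PoszD.
move=> /andP[j1 jm] Ej.
have := h2 (j - k)%N; rewrite -PoszD subnKC ?(ltnW j1)// => h.
by apply: (vnleE _ _).1 Ej _; apply: h; lia.
Qed.

End observables.

Section maxima.
Context (R : realType) (d0 d m : nat) (Psi : nat -> 'M[R]_d0).
Hypothesis d00 : (0 < d0)%N.
Hypothesis Psi0 : Psi 0%N \in unitmx.
Local Notation I := ((int * 'I_d0)%type : choiceType).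
Local Notation S := (seqspace R I).
Variable mu : probability S R.
Hypothesis muP : iid_gauss mu.
Hypothesis Hcv : {ae mu, forall s, converges Psi s}.
Hypothesis decay : forall e : R, 0 < e ->
  \forall L \near \oo, forall N i, tailsq Psi L N i * ln L%:R <= e.
Variable G : 'I_d -> {mfun m.+1.-tuple (d0.-tuple R) >-> R}.

Let tailsq_ge0 L N i : 0 <= tailsq Psi L N i.
Proof. by apply: sumr_ge0 => l _; apply: sumr_ge0 => j _; exact: sqr_ge0. Qed.

Lemma tailsq_small (e : R) : 0 < e -> exists L : nat, forall N i, tailsq Psi L N i <= e ^+ 2.
Proof.
move=> e0; have e1 : 0 < e ^+ 2 / 2 by rewrite divr_gt0// exprn_gt0.
have [L _ hL] := decay e1; exists (maxn L 2) => N i.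
have := hL _ (leq_maxl L 2) N i; have := @half_le_ln R _ (leq_maxr L 2).
have := tailsq_ge0 (maxn L 2) N i; nra.
Qed.

Lemma tailsq_split L N i : tailsq Psi 0 N i <= tailsq Psi 0 (minn N L) i + tailsq Psi L N i.
Proof.
elim: N => [|N IH]; first by rewrite min0n lerDl.
have [LN|NL] := leqP L N; last first.
  have -> : minn N.+1 L = N.+1 by lia.
  by rewrite lerDl.
have rec L' : (L' <= N)%N -> tailsq Psi L' N.+1 i = tailsq Psi L' N i + \sum_j Psi N i j ^+ 2.
  by move=> h; rewrite /tailsq big_mkcond big_ord_recr -big_mkcond /= h.
have -> : minn N.+1 L = minn N L by lia.
by rewrite !rec// addrA lerD2r.
Qed.

(** Finitely many lags before [L] plus a tail bounded by 1; since [A + 1 >= 1], its square is a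
    bound as well. *)
Lemma tailsq_bounded : exists2 B : R, 0 < B & forall N i, tailsq Psi 0 N i <= B ^+ 2.
Proof.
have [L hL] := tailsq_small ltr01.
pose A := \sum_(N < L.+1) \sum_i tailsq Psi 0 N i.
have A0 : 0 <= A by apply: sumr_ge0 => N _; apply: sumr_ge0.
exists (A + 1); first by rewrite ltr_wpDl.
move=> N i; apply: (le_trans (tailsq_split L N i)).
have h1 : tailsq Psi 0 (minn N L) i <= A.
  have hm : (minn N L < L.+1)%N by rewrite ltnS geq_minr.
  rewrite /A (bigD1 (Ordinal hm))//= (bigD1 i)//= -addrA lerDl addr_ge0 ?sumr_ge0//.
  by move=> j _; exact: sumr_ge0.
have := hL N i; rewrite expr1n; nra.
Qed.

Local Notation X := (Xpath Psi).
Let E (y : d.-tuple R) (k : nat) : set S := X @^-1` exceed G y k%:Z.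

Let mX A : measurable A -> measurable (X @^-1` A).
Proof. by move=> mA; rewrite -[Y in measurable Y]setTI; exact: measurable_Xpath. Qed.

Let mE y k : measurable (E y k).
Proof. apply: mX; exact: measurable_exceed. Qed.

Let prob_shift (h : int) A : measurable A ->
  prob mu (X @^-1` (tshift h @^-1` A)) = prob mu (X @^-1` A).
Proof. by move=> mA; rewrite /prob (law_Xpath_tshift Psi muP). Qed.

Let probE_k y k : prob mu (E y k) = prob mu (X @^-1` exceed G y 0).
Proof.
apply: etrans (prob_shift k%:Z (measurable_exceed G y 0)).
by rewrite tshift_exceed.
Qed.

Let last_of_clusterE y k : last_of_cluster (E y) m k = X @^-1` cluster_end G y k%:Z.
Proof. exact: last_of_cluster_preimage. Qed.

Let prob_last y k : prob mu (last_of_cluster (E y) m k) = prob mu (X @^-1` cluster_end G y 0).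
Proof.
rewrite last_of_clusterE; apply: etrans (prob_shift k%:Z (measurable_cluster_end G y 0)).
by rewrite tshift_cluster_end.
Qed.

Let E_past y k : dep (predC (@future d0 (k%:Z + 1))) (E y k).
Proof.
move=> s s' ss'; suff e : observe G k%:Z (X s) = observe G k%:Z (X s').
  by rewrite /E /exceed /preimage /= e.
apply: observe_dep => c /andP[_ ck].
have e : Xh Psi c.1 s = Xh Psi c.1 s'.
  by apply: Xh_dep => c' cc'; apply: ss'; move: ck cc'; rewrite /future /=; clear; lia.
by rewrite /Xpath e.
Qed.

Let no_exceed_past y j (tau : int) : j%:Z < tau ->
  dep (predC (@future d0 tau)) (no_exceed (E y) 0 j).
Proof.
move=> jt s s' ss'; apply/propext.
have h i : (0 < i <= j)%N -> E y i s = E y i s'.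
  move=> ij; apply: E_past => c hc; apply: ss'.
  by move: hc ij jt; rewrite /future /=; lia.
by split => H i ij; [rewrite -h|rewrite h] => //; exact: H.
Qed.

Theorem maxima_cvg (y : nat -> d.-tuple R) (c b : R) :
  n%:R * prob mu (X @^-1` exceed G (y n) 0) @[n --> \oo] --> c ->
  n%:R * prob mu (X @^-1` cluster_end G (y n) 0) @[n --> \oo] --> b ->
  prob mu (X @^-1` [set p | forall k : nat, (0 < k <= n)%N -> vle (observe G k%:Z p) (y n)])
    @[n --> \oo] --> expR (- b).
Proof.
move=> pc qb.
have [B B0 hB] := tailsq_bounded.
have [eta [C [eta0 C0 rate]]] := @anticluster_rate R d0 Psi Psi0 mu muP Hcv m B d00 B0 hB tailsq_small.
have -> : (fun n => prob mu (X @^-1` [set p | forall k : nat, (0 < k <= n)%N ->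
      vle (observe G k%:Z p) (y n)])) = fun n => prob mu (no_exceed (E (y n)) 0 n).
  apply/funext => n; congr (prob mu _); apply/seteqP.
  by split => s h k kn; apply/vleE; exact: h.
apply: (@no_exceed_cvg _ S R mu (fun n => E (y n)) m
  (fun n => prob mu (X @^-1` exceed G (y n) 0))
  (fun n => prob mu (X @^-1` cluster_end G (y n) 0)) c b eta C) => //.
- move=> n k k' z kk z0 pz.
  have dA : dep (fun c => k'%:Z - m%:Z <= c.1 <= k'%:Z - m%:Z + m%:Z) (exceed G (y n) k'%:Z).
    move=> s s' ss'; suff e : observe G k'%:Z s = observe G k'%:Z s' by rewrite /exceed /= e.
    by apply: observe_dep => c' hc'; apply: ss'; rewrite subrK.
  have dF : dep (predC (@future d0 (k'%:Z - m%:Z))) (E (y n) k).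
    move=> s s' ss'; apply: E_past => c' hc'; apply: ss'.
    by move: hc' kk; rewrite /future /=; clear; lia.
  have pF : prob mu (E (y n) k) <= expR (- z) by rewrite probE_k.
  have pA : prob mu (X @^-1` exceed G (y n) k'%:Z) <= expR (- z).
    by have := probE_k (y n) k'; rewrite /E => ->.
  exact: (rate _ _ _ _ z0 (measurable_exceed G (y n) k'%:Z) dA (mE (y n) k) dF pF pA).
move=> kappa e e0.
(* A cluster end at [k] involves [Y] from [k] to [k + m], hence [X] from [k - m] to [k + m]: the
   window parameter is [2 * m], while it was [m] for a single exceedance. *)
have [n0 hn0] := process_mixing_small Psi0 muP Hcv d00 decay (2 * m)%N kappa e0.
exists n0 => n L n0n nL j k jk.
have q_le : prob mu (X @^-1` cluster_end G (y n) k%:Z) <= prob mu (X @^-1` exceed G (y n) 0).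
  rewrite -(probE_k _ k); apply: le_prob => //; last by move=> s [].
  by apply: mX; exact: measurable_cluster_end.
have mixed := hn0 n L n0n nL (j%:Z + 1) (k%:Z - m%:Z) (cluster_end G (y n) k%:Z)
  (no_exceed (E (y n)) 0 j).
rewrite last_of_clusterE -(prob_last _ k) last_of_clusterE.
apply: (le_trans (mixed _ _ _ _ _ _)).
- by move: jk; clear; lia.
- by move: jk; clear; lia.
- exact: measurable_cluster_end.
- move=> s s' ss'; apply/propext.
  have h i : (i <= m)%N -> observe G (k%:Z + i%:Z) s = observe G (k%:Z + i%:Z) s'.
    move=> im; apply: observe_dep => c' hc'; apply: ss'.
    by move: hc' im => /=; clear; lia.
  have h0 : observe G k%:Z s = observe G k%:Z s' by have := h 0%N; rewrite addr0; exact.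
  rewrite /cluster_end /exceed /=; rewrite /setI /mkset h0.
  by split => -[h1 h2]; split => // i im; have := h2 i im; rewrite h//; case/andP: im.
- exact: measurable_no_exceed.
- by apply: no_exceed_past; lia.
by apply: ler_wpM2l; [exact: ltW|rewrite lerD2r].
Qed.

End maxima.

Lemma cond_prob_itv d (T : measurableType d) (R : realType) (P : probability T R)
  (A B : set T) : measurable A -> measurable B -> 0 <= cond_prob P A B <= 1.
Proof.
move=> mA mB; have b0 := prob_ge0 P B.
have ab : prob P (A `&` B) <= prob P B by apply: le_prob; [exact: measurableI|exact: mB|exact: subIsetr].
rewrite /cond_prob divr_ge0 ?prob_ge0//=.
have [b|b] := eqVneq (prob P B) 0; first by rewrite b invr0 mulr0.
by rewrite ler_pdivrMr ?mul1r// lt0r b.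
Qed.

(** When [B] is null, both sides vanish, so no positivity condition appears. *)
Lemma prob_condM d (T : measurableType d) (R : realType) (P : probability T R)
  (A B : set T) : measurable A -> measurable B ->
  prob P (A `&` B) = prob P B * cond_prob P A B.
Proof.
move=> mA mB; rewrite /cond_prob.
have [b|b] := eqVneq (prob P B) 0; last by rewrite mulrC mulfVK.
have ab : prob P (A `&` B) <= prob P B by apply: le_prob; [exact: measurableI|exact: mB|exact: subIsetr].
by rewrite b mul0r; apply/eqP; rewrite eq_le prob_ge0 andbT -b.
Qed.

Lemma tailsq_scaled (R : realType) (d0 : nat) (Psi : nat -> 'M[R]_d0) s0 L N i :
  tailsq (scaled_filter Psi s0) L N i = s0 ^+ 2 * tailsq Psi L N i.
Proof.
rewrite /tailsq mulr_sumr; apply: eq_bigr => l _; rewrite mulr_sumr.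
by apply: eq_bigr => j _; rewrite /scaled_filter mxE exprMn.
Qed.

Lemma natmul_cvg0 (R : realType) (a : nat -> R) (c : R) :
  n%:R * a n @[n --> \oo] --> c -> a n @[n --> \oo] --> 0.
Proof.
have inv0 : (n%:R : R)^-1 @[n --> \oo] --> (0 : R).
  apply/(gtr0_cvgV0 (f := fun n : nat => n%:R : R)); last exact: cvgr_idn.
  by exists 1%N => // n /=; rewrite ltr0n.
move=> h; have hf : n%:R^-1 * (n%:R * a n) @[n --> \oo] --> (0 : R).
  by rewrite -(mul0r c); exact: cvgM.
apply: cvg_trans hf; apply: near_eq_cvg.
by exists 1%N => // n /= n0; rewrite mulKf// pnatr_eq0 -lt0n.
Qed.

Section iid_maximum.
Context d' (T' : measurableType d') (R : realType) (Q : probability T' R) (d : nat).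
Variable Z : nat -> {RV Q >-> d.-tuple R}.
Hypothesis indep : mutually_independent Q (fun k => Z k : T' -> d.-tuple R).

Lemma prob_iid_max (y : d.-tuple R) (a : R) (n : nat) : (0 < n)%N ->
  (forall k, prob Q (Z k @^-1` [set x | vnle x y]) = a) ->
  prob Q [set w | vle (running_max (fun k => Z k) n w) y] = (1 - a) ^+ n.
Proof.
move=> n0 Za.
have -> : [set w | vle (running_max (fun k => Z k) n w) y] =
    [set w | forall k, k \in index_iota 1 n.+1 -> [set x | vle x y] (Z k w)].
  apply/seteqP; split => w /=.
    by move/(running_max_le (fun k => Z k) w y n0) => h k; rewrite mem_index_iota ltnS => kn; exact: h.
  move=> h; apply/(running_max_le (fun k => Z k) w y n0) => k kn; apply: h.
  by rewrite mem_index_iota ltnS.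
rewrite (indep (iota_uniq _ _) (fun=> measurable_vle y)).
transitivity (\prod_(k <- index_iota 1 n.+1) (1 - a)); last first.
  by rewrite big_const_seq count_predT size_iota subn1 /= iter_mulr_1.
apply: eq_bigr => k _; rewrite -(Za k) -probC.
  by congr (prob Q _); apply/seteqP; split => w /vleE.
rewrite -[X in measurable X]setTI; exact: (measurable_funP (Z k) _ _ (measurable_vnle y)).
Qed.

End iid_maximum.
Theorem theorem2p1 (R : realType) (disp : measure_display)
    (T : measurableType disp) (P : probability T R)
    (d d0 m : nat) (d_gt0 : (0 < d)%N) (d0_gt0 : (0 < d0)%N)
    (eps : int -> {RV P >-> d0.-tuple R})
    (eps_indep : mutually_independent P (fun k => eps k : T -> d0.-tuple R))
    (eps_ident : forall j k, same_law P P (eps j) (eps k))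
    (eps_gauss : forall k, gaussian_vector P (eps k))
    (eps_centered : forall k, centered P (eps k))
    (eps_cov : forall k, identity_covariance P (eps k))
    (Psi : nat -> 'M[R]_d0)
    (Psi0_unit : Psi 0%N \in unitmx)
    (Psi_decay : forall i j : 'I_d0,
       (fun l : nat => Psi l i j) =o_\oo
       (fun l : nat => (Num.sqrt l%:R)^-1 * (ln l%:R)^-1))
    (X : int -> {RV P >-> d0.-tuple R})
    (X_linear : linear_process P Psi (fun k => eps k) (fun k => X k))
    (G : 'I_d -> {mfun m.+1.-tuple (d0.-tuple R) >-> R})
    (Y : int -> T -> d.-tuple R)
    (Y_def : Y = transformed_process (fun i => G i) (fun k => X k))
    (u : nat -> 'I_d -> R -> R)
    (H : d.-tuple R -> R)
    (theta : nat -> d.-tuple R -> R)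
    (cond_i : forall tau : d.-tuple R, vpos tau -> forall i : 'I_d,
       n%:R * prob P [set w | u n i (tnth tau i) < tnth (Y 0 w) i]
         @[n --> \oo] --> tnth tau i)
    (H_range : forall tau : d.-tuple R, vpos tau -> 0 < H tau < 1)
    (cond_ii : forall tau : d.-tuple R, vpos tau ->
       n%:R * prob P [set w | vnle (Y 0 w) (thresholds u n tau)]
         @[n --> \oo] --> - ln (H tau))
    (cond_iii : forall tau : d.-tuple R, vpos tau ->
       forall l : nat, (l <= m)%N ->
       cond_prob P
         [set w | forall j : nat, (1 <= j <= l)%N ->
            vle (Y j%:Z w) (thresholds u n tau)]
         [set w | vnle (Y 0 w) (thresholds u n tau)]
         @[n --> \oo] --> theta l tau) :
  (forall tau : d.-tuple R, vpos tau ->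
     prob P [set w | vle (running_max (fun k => Y k%:Z) n w)
                         (thresholds u n tau)]
       @[n --> \oo] --> H tau `^ theta m tau) /\
  extremal_index P Y u H (theta m).
Proof.
have [s0 s00 muP] := exists_noise_iid d0_gt0 eps_indep eps_gauss eps_centered eps_cov.
pose Psi' := scaled_filter Psi s0.
pose mu := law P (measurable_noise eps s0).
have Psi'0 : Psi' 0%N \in unitmx by rewrite /Psi' /scaled_filter unitmxZ// unitfE gt_eqF.
have Hcv : {ae mu, forall s, converges Psi' s} := ae_converges X_linear s00.
have decay e : 0 < e -> \forall L \near \oo, forall N i, tailsq Psi' L N i * ln L%:R <= e.
  move=> e0; have e1 : 0 < e / s0 ^+ 2 by rewrite divr_gt0// exprn_gt0.
  apply: filterS (tailsq_decay Psi_decay e1) => L h N i.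
  have s2 : 0 < s0 ^+ 2 by exact: exprn_gt0.
  by rewrite tailsq_scaled -mulrA -ler_pdivlMl// [leRHS]mulrC; exact: h.
have YE k w : Y k w = observe G k (path X w).
  rewrite Y_def; apply: eq_from_tnth => i; rewrite !tnth_mktuple; congr (G i _).
  apply: eq_from_tnth => j; rewrite !tnth_mktuple; apply: eq_from_tnth => r.
  by rewrite tnth_mktuple.
have mpath A : measurable A -> measurable (path X @^-1` A).
  by move=> mA; rewrite -[Z in measurable Z]setTI; exact: measurable_path.
have bridge A : measurable A ->
    prob P (path X @^-1` A) = prob mu (Xpath Psi' @^-1` A).
  by move=> mA; exact: (prob_path X_linear s00 mA).
have mY k B : measurable B -> measurable [set w | B (Y k w)].
  move=> mB; rewrite (_ : mkset _ = path X @^-1` (observe G k @^-1` B)).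
    by apply: mpath; rewrite -[Z in measurable Z]setTI; exact: measurable_observe.
  by apply/seteqP; split => w; rewrite /preimage /= YE.
have YexceedE y : [set w | vnle (Y 0 w) y] = path X @^-1` exceed G y 0.
  by apply/seteqP; split => w; rewrite /exceed /preimage /= YE.
pose before n tau := [set w | forall j : nat, (1 <= j <= m)%N ->
  vle (Y j%:Z w) (thresholds u n tau)].
have YclusterE n tau : before n tau `&` [set w | vnle (Y 0 w) (thresholds u n tau)] =
    path X @^-1` cluster_end G (thresholds u n tau) 0.
  apply/seteqP; split => w; rewrite /cluster_end /exceed /preimage /before /=.
    by move=> [h1 h2]; split => [|j jm]; rewrite -YE// add0r; exact: h1.
  by move=> [h1 h2]; split => [j jm|]; rewrite YE//; have := h2 j jm; rewrite add0r.
have mbefore n tau : measurable (before n tau).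
  rewrite (_ : before n tau = \bigcap_(j : nat)
    (if (1 <= j <= m)%N then [set w | vle (Y j%:Z w) (thresholds u n tau)] else setT)).
    by apply: bigcapT_measurable => j; case: ifP => // _; exact: mY (measurable_vle _).
  apply/seteqP; split => w h j; first by move=> _; case: ifP => // jm; exact: h.
  by move=> jm; have := h j Logic.I; rewrite jm.
have mnle n tau : measurable [set w | vnle (Y 0 w) (thresholds u n tau)].
  exact: mY (measurable_vnle _).
have theta_itv tau : vpos tau -> 0 <= theta m tau <= 1.
  move=> t0; have lim := cond_iii tau t0 m (leqnn m); apply/andP; split.
    apply: (cvgr_to_ge lim); apply: nearW => n.
    by have /andP[] := cond_prob_itv P (mbefore n tau) (mnle n tau).
  apply: (cvgr_to_le lim); apply: nearW => n.
  by have /andP[] := cond_prob_itv P (mbefore n tau) (mnle n tau).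
have main tau : vpos tau ->
    prob P [set w | vle (running_max (fun k => Y k%:Z) n w) (thresholds u n tau)]
      @[n --> \oo] --> H tau `^ theta m tau.
  move=> t0; have /andP[H0 H1] := H_range tau t0.
  have pc : n%:R * prob mu (Xpath Psi' @^-1` exceed G (thresholds u n tau) 0)
      @[n --> \oo] --> - ln (H tau).
    have := cond_ii tau t0; apply: cvg_trans; apply: near_eq_cvg; apply: nearW => n.
    by rewrite YexceedE bridge//; exact: measurable_exceed.
  (* The product of the limits in [cond_ii] and, for [l = m], in [cond_iii]. *)
  have qb : n%:R * prob mu (Xpath Psi' @^-1` cluster_end G (thresholds u n tau) 0)
      @[n --> \oo] --> - ln (H tau) * theta m tau.
    have lim : n%:R * prob P [set w | vnle (Y 0 w) (thresholds u n tau)] *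
        cond_prob P (before n tau) [set w | vnle (Y 0 w) (thresholds u n tau)]
        @[n --> \oo] --> - ln (H tau) * theta m tau.
      exact: cvgM (cond_ii tau t0) (cond_iii tau t0 m (leqnn m)).
    apply: cvg_trans lim; apply: near_eq_cvg; apply: nearW => n.
    rewrite -bridge; last exact: measurable_cluster_end.
    by rewrite -YclusterE prob_condM// mulrA.
  have := maxima_cvg d0_gt0 Psi'0 muP Hcv decay pc qb.
  rewrite mulNr opprK /powR gt_eqF// mulrC.
  (* The index 0 is excluded because [running_max] is a junk value there. *)
  apply: cvg_trans; apply: near_eq_cvg; exists 1%N => // n /= n0.
  have mall : measurable [set p : seqspace R ((int * 'I_d0)%type : choiceType) |
      forall k : nat, (0 < k <= n)%N -> vle (observe G k%:Z p) (thresholds u n tau)].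
    rewrite (_ : mkset _ = \bigcap_(k : nat)
        (if (0 < k <= n)%N then ~` exceed G (thresholds u n tau) k%:Z else setT)).
      apply: bigcapT_measurable => k; case: ifP => // _.
      exact: measurableC (measurable_exceed G _ _).
    apply/seteqP; split => p h k; first by move=> _; case: ifP => // kn /vnleE; apply; exact: h.
    by move=> kn; have := h k Logic.I; rewrite kn => /vleE.
  rewrite -(bridge _ mall); congr (prob P _); apply/seteqP; split => w.
    move=> h; apply/(running_max_le (fun k => Y k%:Z) w _ n0) => k kn.
    by rewrite YE; exact: h.
  move=> /(running_max_le (fun k => Y k%:Z) w _ n0) h k kn.
  by rewrite -YE; exact: h.
split => //; split => //.
- move=> n h A mA.
  pose B := [set p : seqspace R ((int * 'I_d0)%type : choiceType) |
    A [tuple observe G k%:Z p | k < n]].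
  have mB : measurable B.
    rewrite /B -[Z in measurable Z]setTI.
    suff : measurable_fun setT (fun p => [tuple observe G (k : nat)%:Z p | k < n]) by apply.
    apply/measurable_fun_tnthP => i.
    rewrite (_ : _ \o _ = observe G (i : nat)%:Z); first exact: measurable_observe.
    by apply/funext => p /=; rewrite tnth_mktuple.
  have mBh : measurable (tshift h @^-1` B).
    by rewrite -[Z in measurable Z]setTI; exact: measurable_tshift.
  have -> : [set w | A [tuple Y (k%:Z + h) w | k < n]] = path X @^-1` (tshift h @^-1` B).
    apply/seteqP; split => w; rewrite /B /preimage /=; congr A;
      by apply: eq_from_tnth => k; rewrite !tnth_mktuple observe_tshift YE.
  have -> : [set w | A [tuple Y k%:Z w | k < n]] = path X @^-1` B.
    apply/seteqP; split => w; rewrite /B /preimage /=; congr A;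
      by apply: eq_from_tnth => k; rewrite !tnth_mktuple YE.
  rewrite (probE P (mpath _ mBh)) (probE P (mpath _ mB)) (bridge _ mBh) (bridge _ mB).
  by rewrite /prob (law_Xpath_tshift Psi' muP).
(* The maximum of [n] independent copies stays below the threshold with probability
   [(1 - a n) ^+ n], and [n%:R * a n] tends to [- ln (H tau)]. *)
- move=> d' T' Q Z indep same tau t0; have /andP[H0 H1] := H_range tau t0.
  pose a n := prob P [set w | vnle (Y 0 w) (thresholds u n tau)].
  have a0 : \forall n \near \oo, 0 <= a n by apply: nearW => n; exact: prob_ge0.
  have := @cvg_onem_exp R a id _ a0 (natmul_cvg0 (cond_ii tau t0)) (cond_ii tau t0).
  rewrite opprK lnK ?posrE//; apply: cvg_trans; apply: near_eq_cvg.
  exists 1%N => // n /= n0; rewrite (prob_iid_max (a := a n) indep)// => k.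
  by rewrite /a /prob (same k _ (measurable_vnle _)).
Qed.
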